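(* Let $\kappa\in(-1,1)$, $t\ge 0$ and $n\ge1$. The moments of $U_t$ are given by $$\tau(U_t^n)=1-\int_0^t\left[n\,b_n(\kappa,s)+2\sum_{k=1}^{n-1}k\,b_k(\kappa,s)\,b_{n-k}(\kappa,s)\right]ds=1-n\int_0^t\sum_{k=1}^{n}b_k(\kappa,s)\,b_{n-k}(\kappa,s)\,ds,$$ where the sum in the first expression is empty when $n=1$, $b_0(\kappa,t)\equiv1$, and $b_n(\kappa,t)=\frac{c_n(\kappa,t)}{2}$ for $n\ge1$, with $$c_n(\kappa,t)=\frac{2}{n}\sum_{k=1}^n(-1)^{n+k}\frac{2n}{n+k}\binom{n+k}{n-k}\sum_{j=1}^{k}\binom{2k}{k-j}e^{-jt}\sum_{m=0}^{j-1}L_{j-m-1}^{(m+1)}(2jt)\,P_k^{(m)}(\kappa^2).$$ Consequently, $$\frac{\tau(J_t^n)}{\tau(P)}=1-\frac{2}{2^{2n}(1+\kappa)}\int_0^t\sum_{k=1}^n k\binom{2n}{n-k}\sum_{j=1}^{k}b_j(\kappa,s)\,b_{k-j}(\kappa,s)\,ds.$$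
   Context: Let $\mathscr{A}$ be a von Neumann algebra with tracial state $\tau$ and unit $\mathbf 1$, $P\in\mathscr{A}$ an orthogonal projection, and $(Y_t)_{t\ge0}\subset\mathscr{A}$ a free unitary Brownian motion (with $Y_0=\mathbf 1$, normalized so that $\tau(Y_t^n)=\frac{e^{-nt/2}}{n}L^{(1)}_{n-1}(nt)$ for $n\ge1$; in particular $\tau(Y_t)=e^{-t/2}$) which is free, in Voiculescu's sense, with $P$. Set $S=2P-\mathbf 1$, $\kappa=\tau(S)=2\tau(P)-1\in(-1,1)$, and $U_t=SY_tSY_t^\star$, a unitary operator. The free Jacobi process associated with $P$ is $J_t=PY_tPY_t^\star P$, viewed in the compressed algebra $(P\mathscr{A}P,\frac{1}{\tau(P)}\tau)$. $L_k^{(\gamma)}$ is the $k$-th generalized Laguerre polynomial of parameter $\gamma>-1$. For $k\ge1$, $m\ge0$, $$P_k^{(m)}(\kappa^2)=\frac{(-2)^m}{m!}\sum_{j=0}^k\binom{k}{j}(-\kappa^2)^j(2j)_m,\qquad (0)_m=\delta_{m0},\qquad (2j)_m=\frac{\Gamma(2j+m)}{\Gamma(2j)}\ \ (j\ge1).$$ *)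

(* Defs.v *)
From HB Require Import structures.
From mathcomp Require Import all_boot all_order all_algebra complex.
From mathcomp Require Import all_classical all_reals all_analysis.

Set Implicit Arguments.
Unset Strict Implicit.
Unset Printing Implicit Defensive.

Import Order.TTheory GRing.Theory Num.Theory.
Import numFieldNormedType.Exports.

Local Open Scope classical_set_scope.
Local Open Scope ring_scope.
Local Open Scope complex_scope.

Section Operators.
Variables (R : realType) (H : completeNormedModType R[i]).
Variable ip : {dot H for Num.conj}.

(* With a complete H, this makes (H, ip) a complex Hilbert space. *)
Definition inner_product_norm : Prop := forall x : H, `|x| ^+ 2 = ip x x.

Definition bounded_operator (f : H -> H) : Prop :=
  linear f /\ exists C : R[i], forall x, `|f x| <= C * `|x|.

Definition adjoint_of (f g : H -> H) : Prop :=
  forall x y, ip (f x) y = ip x (g y).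

Definition commutant (M : set (H -> H)) : set (H -> H) :=
  [set f | bounded_operator f /\ forall g, M g -> f \o g = g \o f].

Definition von_neumann_algebra_on (M : set (H -> H)) : Prop :=
  [/\ forall f, M f -> bounded_operator f,
      forall f, M f -> exists2 g, M g & adjoint_of f g
    & commutant (commutant M) = M].

End Operators.

Section FreeProbability.
Variables (R : realType) (A : algType R[i]) (star : A -> A).

Definition faithful_star_rep (H : completeNormedModType R[i])
    (ip : {dot H for Num.conj}) (pi : A -> H -> H) : Prop :=
  [/\ injective pi,
      pi 1 = id,
      forall (a : R[i]) x y, pi (a *: x + y) = (fun v => a *: pi x v + pi y v),
      forall x y, pi (x * y) = pi x \o pi y
    & forall x, adjoint_of ip (pi x) (pi (star x))].

(* A von Neumann algebra is an algebra with an involution, identified through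
   a faithful representation with a self-adjoint algebra of bounded operators
   on a Hilbert space that is equal to its bicommutant. *)
Definition is_von_neumann_algebra : Prop :=
  exists (H : completeNormedModType R[i]) (ip : {dot H for Num.conj})
         (pi : A -> H -> H),
    [/\ inner_product_norm ip,
        faithful_star_rep ip pi
      & von_neumann_algebra_on ip (range pi)].

Definition is_tracial_state (tau : {scalar A}) : Prop :=
  [/\ tau 1 = 1,
      forall x, 0 <= tau (star x * x)
    & forall x y, tau (x * y) = tau (y * x)].

Definition is_projection (P : A) : Prop := P * P = P /\ star P = P.

Definition is_unitary (u : A) : Prop := star u * u = 1 /\ u * star u = 1.

Definition star_subalgebra (B : set A) : Prop :=
  [/\ B 1,
      forall (a : R[i]) x y, B x -> B y -> B (a *: x + y),
      forall x y, B x -> B y -> B (x * y)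
    & forall x, B x -> B (star x)].

Definition star_algebra_gen (G : set A) : set A := smallest star_subalgebra G.

Variable tau : {scalar A}.

(* Consecutive indices must differ; equal indices may recur non-consecutively. *)
Definition free_family (I : Type) (B : I -> set A) : Prop :=
  forall (n : nat) (i : nat -> I) (a : nat -> A), (0 < n)%N ->
    (forall k, (k < n)%N -> B (i k) (a k) /\ tau (a k) = 0) ->
    (forall k, (k.+1 < n)%N -> i k <> i k.+1) ->
    tau (\prod_(k < n) a k) = 0.

Definition free_sets (G1 G2 : set A) : Prop :=
  free_family (fun b : bool => star_algebra_gen (if b then G1 else G2)).

End FreeProbability.

Section SpecialFunctions.
Variable R : realType.
Implicit Types (gamma x t kappa : R) (n k m : nat).

(* The sum over i <= k of binom(k + gamma, k - i) (-x)^i / i!, the generalized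
   binomial coefficient being written as
   (gamma + i + 1) ... (gamma + k) / (k - i)!. *)
Definition laguerre k gamma x : R :=
  \sum_(i < k.+1)
    (\prod_(i.+1 <= l < k.+1) (gamma + l%:R)) / (k - i)`!%:R
    * ((- x) ^+ i / i`!%:R).

(* (x)_m = Gamma(x + m) / Gamma(x) for x > 0, and (0)_m = delta_{m0}. *)
Definition pochhammer x m : R := \prod_(i < m) (x + i%:R).

(* P_k^{(m)}(x); it is used at x = kappa ^ 2. *)
Definition Pkm k m x : R :=
  (-2) ^+ m / m`!%:R
  * \sum_(j < k.+1) 'C(k, j)%:R * (- x) ^+ j * pochhammer (2 * j)%:R m.

Definition c_coef n kappa t : R :=
  2 / n%:R *
  \sum_(1 <= k < n.+1)
    (-1) ^+ (n + k) * ((2 * n)%:R / (n + k)%:R) * 'C(n + k, n - k)%:R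
    * \sum_(1 <= j < k.+1)
        'C(2 * k, k - j)%:R * expR (- (j%:R * t))
        * \sum_(0 <= m < j)
            laguerre (j - m - 1) m.+1%:R (2 * j%:R * t) * Pkm k m (kappa ^+ 2).

Definition b_coef n kappa t : R :=
  if n == 0%N then 1 else c_coef n kappa t / 2.

Definition free_unitary_moment n t : R :=
  expR (- (n%:R * t) / 2) / n%:R * laguerre n.-1 1 (n%:R * t).

End SpecialFunctions.

Section Processes.
Variables (R : realType) (A : algType R[i]) (star : A -> A) (tau : {scalar A}).

(* Only the times t >= 0 are relevant. The multiplicative increments are
   Y_t Y_s^*. *)
Record free_unitary_brownian_motion (Y : R -> A) : Prop := {
  fubm_unitary : forall t, 0 <= t -> is_unitary star (Y t);
  fubm_start : Y 0 = 1;
  fubm_free_increments : forall (n : nat) (t : nat -> R),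
    0 <= t 0%N -> (forall k, (k < n)%N -> t k < t k.+1) ->
    free_family tau (fun k : 'I_n =>
      star_algebra_gen star [set Y (t k.+1) * star (Y (t k))]);
  fubm_increment_law : forall (s t : R) (n : nat),
    0 <= s -> s <= t -> (0 < n)%N ->
    tau ((Y t * star (Y s)) ^+ n) = (free_unitary_moment n (t - s))%:C
}.

Definition symmetry_of (P : A) : A := 2 * P - 1.

Definition U_process (P : A) (Y : R -> A) (t : R) : A :=
  symmetry_of P * Y t * symmetry_of P * star (Y t).

(* For n >= 1 the power J_t ^+ n is the same in A and in the compressed algebra
   P A P, although the latter has unit P. *)
Definition free_jacobi (P : A) (Y : R -> A) (t : R) : A :=
  P * Y t * P * star (Y t) * P.

End Processes.

(* Main.v *)
Require Import Defs.
From HB Require Import structures.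
From mathcomp Require Import all_boot all_order all_algebra complex.
From mathcomp Require Import all_classical all_reals all_analysis.
From mathcomp Require Import ring lra zify.

Set Implicit Arguments.
Unset Strict Implicit.
Unset Printing Implicit Defensive.

Import Order.TTheory GRing.Theory Num.Theory.
Import numFieldNormedType.Exports.

Local Open Scope classical_set_scope.
Local Open Scope ring_scope.
Local Open Scope complex_scope.

(** Write S = 2 P - 1 and B_t = Y_t S Y_t', where ' is the involution, so that
   U_t = S B_t is a product of two reflections, and let u_n(t) = tau (U_t^n).
   The proof has two independent halves: the moments satisfy an explicit system
   of differential equations, and that system is solved by the coefficients
   b_n.

   The equations.  Over a time step h the increment V = Y_(t+h) Y_t' is free
   from the algebra generated by S and Y_t, because freeness is associative
   (alt_merge, inPY_free2), and U_(t+h) = S V B_t V'.  Only the first two moments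
   of V enter the expansion of tau (U_(t+h)^n) to first order in h: since
   V - tau V has size sqrt h in the tracial L2 norm, a product of two such
   factors contributes at order h, and a product of three of them is
   negligible.  The negligible terms are controlled by Cauchy-Schwarz, once
   freeness gives that v x v has size h, and not only sqrt h, when
   v = V - tau V and x is a word in the reflections (sandwich).  This gives
   (increment_bound, tder_u)
     u_n' = - n u_n - n sum_(0 < k < n) u_k u_(n-k) + n^2 kappa^2.

   The solution.  Put F = sum_n u_n z^n, D = z d/dz, H = 1 + 2 F, and let
   mu = z / (1 - z)^2.  The equations say F_t = - D (F + F^2 - kappa^2 mu).  The
   root y of y + y^2 = F + F^2 - kappa^2 mu is constant along the flow of H D
   (lder_y), and F_t = - D (y + y^2) already is the shape of the final formula:
   what is left is to show that the coefficients of y are the b_n.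
   With W = 1 + 2 y and zeta = (1 + z) / (1 - z), the series r = (W - H/zeta)/2
   and s = (W + H/zeta)/2 are eigenvectors of L = d/dt + H D with eigenvalues s
   and - r (lder_r).  As r + s = W, expanding ((r + s)/W)^(2k) = 1 writes the
   coefficient of z^k in (1 + z)^(2k) D y as a binomial sum of
     Theta_(k,j) = [z^k] (1 + z)^(2k) s^(k+j) r^(k-j) W^(-2k) D y   (mT_sum).
   Inserting powers y^m, an integration by parts shows that these numbers solve
   a finite triangular linear system in time (tder_Theta), whose solution is
   e^(-jt) times a polynomial (Theta_solve).  At time 0 one has r = y and the
   coefficients are residues in the coordinate y, which are evaluated by
   Pkm_expansion and residue_delta; together they produce the Laguerre
   polynomials and the P_k^(m).  Finally the same coefficient of (1 + z)^(2k) D y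
   is sum_j C(2k, k-j) j y_j, and this triangular system is inverted by the
   expansion of z^n + z^(-n) in powers of (1 + z)^2 / z (cheb_inversion), which
   gives y_n = b_n (my_bcoef).

   Integrating u_n' = - n sum_k b_k b_(n-k) gives the moments of U_t.  For the
   Jacobi process, 4 J_t = P (2 + U_t + U_t') with P commuting with the second
   factor, which is (1 + U_t)^2 U_t'; the binomial theorem then expresses the
   moments of J_t by those of U_t (jacobi_power, tau_jacobi). *)

(** * Formal power series *)

(** A record rather than a plain function, since functions already carry the
   pointwise product. *)
Record fps (R : comNzRingType) := Fps { fcoef :> nat -> R }.

Section FpsRing.
Variable R : comNzRingType.
Implicit Types f g h : fps R.

HB.instance Definition _ := gen_eqMixin (fps R).
HB.instance Definition _ := gen_choiceMixin (fps R).

Lemma fpsP f g : (forall n, f n = g n) -> f = g.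
Proof.
by case: f g => [f] [g] /= fg; congr Fps; apply/funext.
Qed.

Definition fzero : fps R := Fps (fun=> 0).
Definition fopp f : fps R := Fps (fun n => - f n).
Definition fadd f g : fps R := Fps (fun n => f n + g n).
Definition fone : fps R := Fps (fun n => (n == 0%N)%:R).
Definition fmul f g : fps R := Fps (fun n => \sum_(i < n.+1) f i * g (n - i)%N).

Fact faddA : associative fadd.
Proof. by move=> f g h; apply/fpsP => n /=; rewrite addrA. Qed.
Fact faddC : commutative fadd.
Proof. by move=> f g; apply/fpsP => n /=; rewrite addrC. Qed.
Fact fadd0 : left_id fzero fadd.
Proof. by move=> f; apply/fpsP => n /=; rewrite add0r. Qed.
Fact faddN : left_inverse fzero fopp fadd.
Proof. by move=> f; apply/fpsP => n /=; rewrite addNr. Qed.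

HB.instance Definition _ := GRing.isZmodule.Build (fps R) faddA faddC fadd0 faddN.

Definition ftrunc n f : {poly R} := \poly_(i < n.+1) f i.

Lemma ftruncE n f i : (i <= n)%N -> (ftrunc n f)`_i = f i.
Proof. by move=> lin; rewrite coef_poly ltnS lin. Qed.

(** A coefficient of a product only involves truncations, so the ring laws
   are those of polynomials. *)
Lemma fmul_trunc n f g i : (i <= n)%N -> fmul f g i = (ftrunc n f * ftrunc n g)`_i.
Proof.
move=> lin; rewrite coefM /=; apply: eq_bigr => j _.
by rewrite !ftruncE ?(leq_trans (leq_subr _ _)) // (leq_trans _ lin) // -ltnS.
Qed.

Lemma coefM_eq n (p q p' q' : {poly R}) :
  (forall i, (i <= n)%N -> p`_i = p'`_i) -> (forall i, (i <= n)%N -> q`_i = q'`_i) ->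
  (p * q)`_n = (p' * q')`_n.
Proof.
move=> pp qq; rewrite !coefM; apply: eq_bigr => j _.
by rewrite pp ?qq ?leq_subr // -ltnS.
Qed.

Fact fmulA : associative fmul.
Proof.
move=> f g h; apply/fpsP => n; rewrite !(@fmul_trunc n) //.
transitivity ((ftrunc n f * (ftrunc n g * ftrunc n h))`_n).
  by apply: coefM_eq => // i lin; rewrite ftruncE // (@fmul_trunc n).
by rewrite mulrA; apply: coefM_eq => // i lin; rewrite ftruncE // (@fmul_trunc n).
Qed.

Fact fmulC : commutative fmul.
Proof. by move=> f g; apply/fpsP => n; rewrite !(@fmul_trunc n) // mulrC. Qed.

Fact fmul1 : left_id fone fmul.
Proof.
move=> f; apply/fpsP => n /=; rewrite big_ord_recl /= subn0 mul1r big1 ?addr0 //.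
by move=> i _; rewrite mul0r.
Qed.

Fact fmulDl : left_distributive fmul fadd.
Proof.
move=> f g h; apply/fpsP => n /=; rewrite -big_split /=.
by apply: eq_bigr => i _; rewrite mulrDl.
Qed.

Fact fone_neq0 : fone != fzero.
Proof.
by apply/eqP => /(congr1 (fun f : fps R => f 0%N)) /= /eqP; rewrite oner_eq0.
Qed.

HB.instance Definition _ :=
  GRing.Zmodule_isComNzRing.Build (fps R) fmulA fmulC fmul1 fmulDl fone_neq0.

Lemma fcoefD f g n : (f + g) n = f n + g n. Proof. by []. Qed.
Lemma fcoefN f n : (- f) n = - f n. Proof. by []. Qed.
Lemma fcoefB f g n : (f - g) n = f n - g n. Proof. by []. Qed.
Lemma fcoef1 n : (1 : fps R) n = (n == 0%N)%:R. Proof. by []. Qed.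
Lemma fcoefM f g n : (f * g) n = \sum_(i < n.+1) f i * g (n - i)%N.
Proof. by []. Qed.

Lemma fcoefM0 f g : (f * g) 0%N = f 0%N * g 0%N.
Proof. by rewrite fcoefM big_ord_recl big_ord0 addr0. Qed.

Lemma fcoef_sum (I : Type) (r : seq I) (Q : pred I) (F : I -> fps R) n :
  (\sum_(i <- r | Q i) F i) n = \sum_(i <- r | Q i) F i n.
Proof. by elim/big_rec2: _ => [|i x y _ <-]. Qed.

Definition fconst (c : R) : fps R := Fps (fun n => if n is 0%N then c else 0).

Lemma fconst_is_monoid : monoid_morphism fconst.
Proof.
split; first by apply/fpsP => -[].
move=> a b; apply/fpsP => -[|n].
  by rewrite fcoefM0.
rewrite fcoefM big1 //= => -[[|i] /= _] _; by rewrite ?mul0r // mulr0.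
Qed.

Lemma fconst_is_additive : {morph fconst : a b / a - b}.
Proof. by move=> a b; apply/fpsP => -[|n] //=; rewrite subr0. Qed.

HB.instance Definition _ :=
  GRing.isZmodMorphism.Build R (fps R) fconst fconst_is_additive.
HB.instance Definition _ :=
  GRing.isMonoidMorphism.Build R (fps R) fconst fconst_is_monoid.

Lemma fcoefCM c f n : (fconst c * f) n = c * f n.
Proof.
rewrite fcoefM big_ord_recl /= subn0 big1 ?addr0 // => i _.
by rewrite mul0r.
Qed.

Definition fvar : fps R := Fps (fun n => (n == 1%N)%:R).

Lemma fcoef_varM f n : (fvar * f) n = if n is m.+1 then f m else 0.
Proof.
case: n => [|n]; first by rewrite fcoefM0 mul0r.
rewrite fcoefM !big_ord_recl /= mul0r add0r mul1r subSS subn0.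
by rewrite big1 ?addr0 // => i _; rewrite mul0r.
Qed.

Lemma fcoef_varXM m f n :
  (fvar ^+ m * f) n = if (m <= n)%N then f (n - m)%N else 0.
Proof.
elim: m n => [|m IH] n; first by rewrite expr0 mul1r subn0.
by rewrite exprS -mulrA fcoef_varM; case: n => // n; rewrite IH subSS.
Qed.

Lemma fvarI : injective (fun f => fvar * f).
Proof.
move=> f g fg; apply/fpsP => n.
by have := congr1 (fun f : fps R => f n.+1) fg; rewrite !fcoef_varM.
Qed.

Lemma fvarXI m : injective (fun f => fvar ^+ m * f).
Proof.
elim: m => [|m IH] f g; first by rewrite /= !mul1r.
by rewrite /= !exprS -!mulrA => /fvarI /IH.
Qed.

(** Euler's derivation z d/dz, which unlike d/dz preserves degrees. *)
Definition feuler f : fps R := Fps (fun n => n%:R * f n).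

Lemma feulerE f n : feuler f n = n%:R * f n. Proof. by []. Qed.

Lemma feulerB : {morph feuler : f g / f - g}.
Proof. by move=> f g; apply/fpsP => n /=; rewrite mulrBr. Qed.

HB.instance Definition _ :=
  GRing.isZmodMorphism.Build (fps R) (fps R) feuler feulerB.

Lemma feulerM f g : feuler (f * g) = feuler f * g + f * feuler g.
Proof.
apply/fpsP => n; rewrite fcoefD feulerE !fcoefM mulr_sumr -big_split /=.
apply: eq_bigr => i _.
have lin : (i <= n)%N by rewrite -ltnS.
by rewrite -[n in n%:R](subnKC lin) natrD; ring.
Qed.

Lemma feulerD f g : feuler (f + g) = feuler f + feuler g.
Proof. exact: raddfD. Qed.

Lemma feulerC c : feuler (fconst c) = 0.
Proof. by apply/fpsP => -[|n] /=; rewrite ?mul0r ?mulr0. Qed.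

Lemma feuler1 : feuler 1 = 0.
Proof. by rewrite -(rmorph1 fconst) feulerC. Qed.

Lemma feulerX f m : feuler (f ^+ m) = m%:R * f ^+ m.-1 * feuler f.
Proof.
elim: m => [|m IH]; first by rewrite expr0 feuler1 !mul0r.
rewrite exprS feulerM IH /=; case: m {IH} => [|m] /=.
  by rewrite expr0; ring.
by rewrite exprS -[m.+2%:R]natr1; ring.
Qed.

Lemma feuler_var : feuler fvar = fvar.
Proof. by apply/fpsP => -[|[|n]] /=; rewrite ?mul0r ?mulr0 ?mul1r. Qed.

Definition fsmall n f := forall i, (i < n)%N -> f i = 0.

Lemma fsmallM m n f g : fsmall m f -> fsmall n g -> fsmall (m + n) (f * g).
Proof.
move=> fm gn i lti; rewrite fcoefM big1 // => -[j /= ltj] _.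
case: (ltnP j m) => [/fm -> | lemj]; first by rewrite mul0r.
rewrite (gn (i - j)%N) ?mulr0 //; lia.
Qed.

Lemma fsmallMl n f g : fsmall n g -> fsmall n (f * g).
Proof. by move=> gn; apply: (@fsmallM 0). Qed.

Lemma fsmallMr n f g : fsmall n f -> fsmall n (f * g).
Proof. by move=> fn; rewrite mulrC; apply: fsmallMl. Qed.

Lemma fsmallX m f : f 0%N = 0 -> fsmall m (f ^+ m).
Proof.
move=> f0; elim: m => [|m IH] //; rewrite exprS.
by apply: (@fsmallM 1) => // -[].
Qed.

Lemma fsmall_euler1 f : fsmall 1 (feuler f).
Proof. by move=> -[|i] //= _; rewrite mul0r. Qed.

(** The n-th coefficient of the iterates is constant from step n + 1 on when
   the map is contracting. *)
Definition ffix (Phi : fps R -> fps R) : fps R :=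
  Fps (fun n => iter n.+1 Phi 0 n).

Definition fcontracting (Phi : fps R -> fps R) := forall n f g,
  (forall i, (i < n)%N -> f i = g i) -> forall i, (i <= n)%N -> Phi f i = Phi g i.

Lemma ffixP Phi : fcontracting Phi -> Phi (ffix Phi) = ffix Phi.
Proof.
move=> PhiC.
have stab n m i : (i < n)%N -> (i < m)%N -> iter n Phi 0 i = iter m Phi 0 i.
  elim: n m i => [//|n IH] [//|m] i ltin ltim /=.
  by apply: (PhiC i) => // j ltj; apply: IH; apply: leq_trans ltj _.
apply/fpsP => n; rewrite [RHS]/=; apply: (PhiC n) => // i ltin /=.
by rewrite -[Phi _]/(iter i.+1 Phi 0) (@stab i.+1 n).
Qed.

End FpsRing.

Arguments fvar {R}.
Arguments fconst {R}.

(** * Functions of a positive time *)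

Section TimeDerivative.
Variable R : realType.
Implicit Types phi psi : R -> R.

(** A derivative on the open half line, with continuity at its end: nothing is
   known of a process at negative times, and this is what the mean value
   theorem and the fundamental theorem of calculus need on [0, t]. *)
Definition tder phi phi' :=
  (forall t : R, 0 < t -> is_derive t 1 phi (phi' t)) /\ (phi x @[x --> (0 : R)^'+] --> phi 0).

Lemma tder_cst c : tder (fun=> c) (fun=> 0).
Proof. by split=> [t _|]; [exact: is_derive_cst|exact: cvg_cst]. Qed.

Lemma tderD phi psi phi' psi' : tder phi phi' -> tder psi psi' ->
  tder (fun t => phi t + psi t) (fun t => phi' t + psi' t).
Proof.
move=> [d1 c1] [d2 c2]; split=> [t t0|]; last exact: cvgD.
by have := is_deriveD (d1 t t0) (d2 t t0).
Qed.

Lemma tderN phi phi' : tder phi phi' -> tder (fun t => - phi t) (fun t => - phi' t).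
Proof.
move=> [d1 c1]; split=> [t t0|]; last exact: cvgN.
by have := is_deriveN (d1 t t0).
Qed.

Lemma tderB phi psi phi' psi' : tder phi phi' -> tder psi psi' ->
  tder (fun t => phi t - psi t) (fun t => phi' t - psi' t).
Proof. by move=> h1 h2; apply: tderD h1 (tderN h2). Qed.

Lemma tderM phi psi phi' psi' : tder phi phi' -> tder psi psi' ->
  tder (fun t => phi t * psi t) (fun t => phi' t * psi t + phi t * psi' t).
Proof.
move=> [d1 c1] [d2 c2]; split=> [t t0|]; last exact: cvgM.
have := is_deriveM (d1 t t0) (d2 t t0).
by rewrite /GRing.scale /= addrC [psi t * _]mulrC.
Qed.

Lemma tder_sum (I : Type) (r : seq I) (phi phi' : I -> R -> R) :
  (forall i, tder (phi i) (phi' i)) ->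
  tder (fun t => \sum_(i <- r) phi i t) (fun t => \sum_(i <- r) phi' i t).
Proof.
move=> dphi; elim: r => [|i r IH].
  under eq_fun do rewrite big_nil.
  under [X in tder _ X]eq_fun do rewrite big_nil.
  exact: tder_cst.
under eq_fun do rewrite big_cons.
under [X in tder _ X]eq_fun do rewrite big_cons.
exact: tderD.
Qed.

Lemma tder_ext phi phi' psi' :
  (forall t, 0 < t -> phi' t = psi' t) -> tder phi phi' -> tder phi psi'.
Proof. by move=> e [d c]; split=> // t t0; rewrite -e //; apply: d. Qed.

Lemma tder_global phi phi' :
  (forall t : R, is_derive t 1 phi (phi' t)) -> tder phi phi'.
Proof.
move=> d; split=> // ; apply: cvg_at_right_filter.
by apply/differentiable_continuous/derivable1_diffP; have [] := d 0.
Qed.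

Lemma tder_uniq phi phi' psi' t : tder phi phi' -> tder phi psi' -> 0 < t ->
  phi' t = psi' t.
Proof.
by move=> [d1 _] [d2 _] t0; rewrite -(@derive_val _ _ _ _ _ _ _ (d1 t t0))
   -(@derive_val _ _ _ _ _ _ _ (d2 t t0)).
Qed.

Lemma tder_within phi phi' t : tder phi phi' -> 0 < t ->
  {within `[0, t], continuous phi}.
Proof.
move=> [d c] t0.
have C (x : R) : 0 < x -> phi @ x --> phi x.
  move=> x0; apply/differentiable_continuous/derivable1_diffP.
  by have [] := d x x0.
apply/continuous_within_itvP => //; split => //.
  by move=> x; rewrite in_itv /= => /andP[x0 _]; exact: C.
by apply: cvg_at_left_filter; exact: C.
Qed.

Lemma tder0_cst phi t : tder phi (fun=> 0) -> 0 <= t -> phi t = phi 0.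
Proof.
move=> dphi; rewrite le_eqVlt => /predU1P[<- //|t0].
have [d _] := dphi.
have dd (x : R) : x \in `]0, t[%R -> is_derive x 1 phi 0.
  by rewrite in_itv /= => /andP[x0 _]; exact: d.
have [c _ e] := MVT t0 dd (tder_within dphi t0).
by apply/eqP; rewrite -subr_eq0 e mul0r.
Qed.

Lemma tder_eq phi psi phi' psi' t :
  tder phi phi' -> tder psi psi' -> (forall s, 0 < s -> phi' s = psi' s) ->
  phi 0 = psi 0 -> 0 <= t -> phi t = psi t.
Proof.
move=> d1 d2 e e0 t0; apply/eqP; rewrite -subr_eq0; apply/eqP.
have := @tder0_cst (fun t => phi t - psi t) t _ t0; rewrite e0 subrr; apply.
by apply: tder_ext (tderB d1 d2) => s s0; rewrite e // subrr.
Qed.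

Lemma tder_FTC phi phi' t : tder phi phi' -> continuous phi' -> 0 <= t ->
  \int[lebesgue_measure]_(s in `[0, t]) phi' s = phi t - phi 0.
Proof.
move=> dphi cphi'; rewrite le_eqVlt => /predU1P[<-|t0].
  by rewrite set_itv1 Rintegral_set1 subrr.
have [d c] := dphi.
have cd (x : R) : 0 < x -> derivable phi x 1 by move=> /d[].
have FTC : (\int[lebesgue_measure]_(s in `[0%R, t]) (phi' s)%:E = (phi t)%:E - (phi 0)%:E)%E.
  apply: continuous_FTC2 => //.
  - exact: continuous_subspaceT.
  - split=> //.
    + by move=> x; rewrite in_itv /= => /andP[x0 _]; exact: cd.
    + by apply: cvg_at_left_filter; apply/differentiable_continuous/derivable1_diffP; exact: cd.
  - move=> x; rewrite inE /= ?in_itv /= => /andP[x0 _].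
    by rewrite derive1E; apply: (@derive_val _ _ _ _ _ _ _ (d x x0)).
by rewrite /Rintegral FTC.
Qed.

Lemma tder_exp c :
  tder (fun t : R => expR (c * t)) (fun t => c * expR (c * t)).
Proof.
apply: tder_global => t.
have h : is_derive t 1 ( *%R c) (c *: (1 : R)) by exact: is_deriveZ.
have := @is_derive1_comp _ expR ( *%R c) t _ _ (is_derive_expR _) h.
by rewrite /GRing.scale /= mulr1 mulrC.
Qed.

Lemma tder_pow n : tder (fun t : R => t ^+ n) (fun t => n%:R * t ^+ n.-1).
Proof.
have did : tder id (fun=> 1) by apply: tder_global => t; exact: is_derive_id.
elim: n => [|n IH].
  by apply: tder_ext (tder_cst 1) => t _; rewrite mul0r.
under eq_fun do rewrite exprS.
apply: tder_ext (tderM did IH) => t _; rewrite mul1r.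
case: n {IH} => [|n] /=; first by rewrite expr0; ring.
by rewrite exprS -[n.+2%:R]natr1; ring.
Qed.

Lemma expansion_lipschitz phi gam K C :
  0 <= C ->
  (forall t, 0 <= t -> `|gam t| <= K) ->
  (forall t h, 0 <= t -> 0 < h <= 1 ->
     `|phi (t + h) - phi t - h * gam t| <= C * h * Num.sqrt h) ->
  forall t s, 0 <= t -> t <= s -> s <= t + 1 ->
    `|phi s - phi t| <= (C + K) * (s - t).
Proof.
move=> C0 gamK ex t s t0; rewrite le_eqVlt => /predU1P[<-|ts] st1.
  by rewrite !subrr normr0 mulr0.
have h01 : 0 < s - t <= 1 by apply/andP; split; lra.
have := ex t (s - t) t0 h01; rewrite [t + _]addrC subrK => e.
have sq1 : Num.sqrt (s - t) <= 1.
  by rewrite -sqrtr1; apply: ler_wsqrtr; case/andP: h01.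
have -> : phi s - phi t = (phi s - phi t - (s - t) * gam t) + (s - t) * gam t by ring.
apply: le_trans (ler_normD _ _) _.
rewrite [leRHS]mulrDl; apply: lerD.
  apply: le_trans e _; rewrite -[leRHS]mulr1; apply: ler_wpM2l => //.
  by apply: mulr_ge0 => //; lra.
rewrite normrM (gtr0_norm (_ : 0 < s - t)) ?subr_gt0 // mulrC.
by apply: ler_wpM2r; [lra|exact: gamK].
Qed.

Lemma lipschitz_continuous phi L :
  0 <= L ->
  (forall t s, 0 <= t -> t <= s -> s <= t + 1 -> `|phi s - phi t| <= L * (s - t)) ->
  (forall t : R, 0 < t -> {for t, continuous phi}) /\ (phi x @[x --> (0 : R)^'+] --> phi 0).
Proof.
move=> L0 lip; have L1 : 0 < L + 1 by lra.
have key (t s e : R) : 0 < e -> 0 <= t -> 0 <= s -> `|t - s| < Num.min 1 (e / (L + 1)) ->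
    `|phi t - phi s| < e.
  move=> e0 t0 s0; rewrite lt_min => /andP[ts1].
  rewrite ltr_pdivlMr // => tse.
  have : `|phi t - phi s| <= L * `|t - s|.
    move: ts1; case: (lerP s t) => [st|/ltW ts]; first by move=> ?; apply: lip => //; lra.
    by move=> ?; rewrite distrC; apply: lip => //; lra.
  move=> /le_lt_trans; apply; apply: le_lt_trans tse.
  by rewrite mulrC; apply: ler_wpM2l => //; lra.
have m0 e : 0 < e -> 0 < Num.min 1 (e / (L + 1)).
  by move=> e0; rewrite lt_min ltr01 divr_gt0.
split.
  move=> t t0; apply/cvgrPdist_lt => e e0; near=> s.
  apply: key => //; first exact: ltW.
    by near: s; apply: filterS (lt_nbhsr t0) => x /ltW.
  near: s; apply: (@cvgr_dist_lt _ _ _ (nbhs t) _ id t) => //; exact: m0.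
apply/cvgrPdist_lt => e e0; near=> s.
have s0 : 0 < s by near: s; exact: nbhs_right_gt.
apply: (key _ _ _ e0 (lexx 0) (ltW s0)).
rewrite sub0r normrN gtr0_norm //; near: s.
by apply: nbhs_right_lt; exact: m0.
Unshelve. all: by end_near. Qed.

(** The left difference quotient at t is read from the expansion at the earlier
   time, where the drift is gam there and not gam t; hence the continuity of
   gam. *)
Lemma expansion_tder phi gam K C :
  0 <= C -> 0 <= K ->
  (forall t, 0 <= t -> `|gam t| <= K) ->
  (forall t h, 0 <= t -> 0 < h <= 1 ->
     `|phi (t + h) - phi t - h * gam t| <= C * h * Num.sqrt h) ->
  (forall t : R, 0 < t -> {for t, continuous gam}) ->
  tder phi gam.
Proof.
move=> C0 K0 gamK ex cgam; split; last first.
  have CK : 0 <= C + K by lra.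
  by have [] := lipschitz_continuous CK (expansion_lipschitz C0 gamK ex).
move=> t t0.
suff H : h^-1 *: (phi (h *: (1 : R) + t) - phi t) @[h --> (0 : R)^'] --> gam t.
  by split; [apply/cvg_ex; exists (gam t)|apply: cvg_lim].
apply/cvgrPdist_lt => e e0.
have C1 : 0 < C + 1 by lra.
have e2 : 0 < e / 2 by lra.
have eC : 0 < e / 2 / (C + 1) by apply: divr_gt0.
have sqC h : `|h| < (e / 2 / (C + 1)) ^+ 2 -> C * Num.sqrt `|h| < e / 2.
  move=> hC; have : Num.sqrt `|h| < e / 2 / (C + 1).
    rewrite -[ltRHS]gtr0_norm // -sqrtr_sqr ltr_sqrt //.
    by apply: exprn_gt0.
  rewrite ltr_pdivlMr // mulrDr mulr1 mulrC; have := sqrtr_ge0 `|h|; lra.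
have /cvgrPdist_lt/(_ _ e2)/nbhs_ballP[d /= d0 hd] := cgam t t0.
near=> h.
have h0 : h != 0 by near: h; exact: nbhs_dnbhs_neq.
have h1 : `|h| < 1 by near: h; exact: dnbhs0_lt.
have ht : `|h| < t by near: h; exact: dnbhs0_lt.
have sq : C * Num.sqrt `|h| < e / 2.
  by apply: sqC; near: h; apply: dnbhs0_lt; apply: exprn_gt0.
have hg : `|gam t - gam (t + h)| < e / 2.
  apply: hd; rewrite /ball /= opprD addNKr normrN.
  by near: h; apply: dnbhs0_lt.
rewrite /GRing.scale /= mulr1.
move: h1 ht sq; case: (ltrP 0 h) => [hp|hn].
  rewrite gtr0_norm // => h1 ht sq.
  have := ex t h (ltW t0); rewrite hp ltW // => /(_ isT) b.
  have -> : gam t - h^-1 * (phi (h + t) - phi t) = - (h^-1 * (phi (t + h) - phi t - h * gam t)).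
    by rewrite [h + t]addrC; field.
  rewrite normrN normrM normfV (gtr0_norm hp) mulrC ltr_pdivrMr //.
  by apply: le_lt_trans b _; rewrite -mulrA [h * _]mulrC mulrA ltr_pM2r //; lra.
have {}hn : h < 0 by rewrite lt_neqAle h0.
rewrite ltr0_norm // => h1 ht sq.
have th0 : 0 <= t + h by lra.
(* Here h < 0, and the expansion is used from t + h to t. *)
have := ex (t + h) (- h) th0; rewrite addrK => b.
have {}b : `|phi t - phi (t + h) - - h * gam (t + h)| <= C * - h * Num.sqrt (- h).
  by apply: b; apply/andP; split; lra.
have -> : gam t - h^-1 * (phi (h + t) - phi t) =
   (gam t - gam (t + h)) + h^-1 * (phi t - phi (t + h) - - h * gam (t + h)).
  by rewrite [h + t]addrC; field.
apply: le_lt_trans (ler_normD _ _) _.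
have -> : e = e / 2 + e / 2 by field.
apply: ltrD => //.
rewrite normrM normfV (ltr0_norm hn) mulrC ltr_pdivrMr; last by lra.
by apply: le_lt_trans b _; rewrite -mulrA [- h * _]mulrC mulrA ltr_pM2r //; lra.
Unshelve. all: by end_near. Qed.

End TimeDerivative.

(** * Power series depending on time *)

Section TimeSeries.
Variable R : realType.
Implicit Types F G : R -> fps R.

Definition sder F F' := forall n, tder (fun t => F t n) (fun t => F' t n).

Lemma sder_ext F F' G' : (forall t, 0 < t -> F' t = G' t) -> sder F F' -> sder F G'.
Proof. by move=> e d n; apply: tder_ext (d n) => t t0; rewrite e. Qed.

Lemma sder_uniq F F' G' t : sder F F' -> sder F G' -> 0 < t -> F' t = G' t.
Proof. by move=> d1 d2 t0; apply/fpsP => n; apply: tder_uniq (d1 n) (d2 n) t0. Qed.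

Lemma sder_cst (f : fps R) : sder (fun=> f) (fun=> 0).
Proof. by move=> n; apply: tder_cst. Qed.

Lemma sderD F G F' G' : sder F F' -> sder G G' ->
  sder (fun t => F t + G t) (fun t => F' t + G' t).
Proof. by move=> d1 d2 n; apply: tderD (d1 n) (d2 n). Qed.

Lemma sderB F G F' G' : sder F F' -> sder G G' ->
  sder (fun t => F t - G t) (fun t => F' t - G' t).
Proof. by move=> d1 d2 n; apply: tderB (d1 n) (d2 n). Qed.

Lemma sderM F G F' G' : sder F F' -> sder G G' ->
  sder (fun t => F t * G t) (fun t => F' t * G t + F t * G' t).
Proof.
move=> d1 d2 n.
have := @tder_sum R _ (index_enum 'I_n.+1) (fun i t => F t i * G t (n - i)%N) _
   (fun i => tderM (d1 i) (d2 (n - i)%N)).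
by apply: tder_ext => t _; rewrite big_split.
Qed.

Lemma sder_euler F F' : sder F F' ->
  sder (fun t => feuler (F t)) (fun t => feuler (F' t)).
Proof.
move=> d n; apply: tder_ext (tderM (tder_cst n%:R) (d n)) => t _.
by rewrite mul0r add0r.
Qed.

(** Each coefficient of the fixed point is one of a finite iterate, so it is
   differentiable, whatever its derivative is. *)
Lemma sder_fix (Phi : R -> fps R -> fps R) :
  (forall F F', sder F F' -> exists G', sder (fun t => Phi t (F t)) G') ->
  exists Y', sder (fun t => ffix (Phi t)) Y'.
Proof.
move=> PhiD.
have it n : exists G', sder (fun t => iter n (Phi t) 0) G'.
  elim: n => [|n [G' IH]]; first by exists (fun=> 0); apply: sder_cst.
  exact: PhiD IH.
have [G GP] := choice it.
by exists (fun t => Fps (fun n => G n.+1 t n)) => n; apply: GP.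
Qed.

Section Flow.
Variable H : R -> fps R.

(** G is the image of F under the derivation d/dt + H z d/dz, that is, the rate
   of change of F along the flow of the vector field H z d/dz. *)
Definition lder F G := sder F (fun t => G t - H t * feuler (F t)).

Lemma lder_ext F G G' : (forall t, 0 < t -> G t = G' t) -> lder F G -> lder F G'.
Proof. by move=> e; apply: sder_ext => t t0; rewrite e. Qed.

Lemma lderM F1 F2 G1 G2 : lder F1 G1 -> lder F2 G2 ->
  lder (fun t => F1 t * F2 t) (fun t => G1 t * F2 t + F1 t * G2 t).
Proof.
by move=> d1 d2; apply: sder_ext (sderM d1 d2) => t _; rewrite feulerM; ring.
Qed.

Lemma lderD F1 F2 G1 G2 : lder F1 G1 -> lder F2 G2 ->
  lder (fun t => F1 t + F2 t) (fun t => G1 t + G2 t).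
Proof.
by move=> d1 d2; apply: sder_ext (sderD d1 d2) => t _; rewrite feulerD; ring.
Qed.

Lemma lderB F1 F2 G1 G2 : lder F1 G1 -> lder F2 G2 ->
  lder (fun t => F1 t - F2 t) (fun t => G1 t - G2 t).
Proof.
by move=> d1 d2; apply: sder_ext (sderB d1 d2) => t _; rewrite feulerB; ring.
Qed.

Lemma lder_cst f : lder (fun=> f) (fun t => H t * feuler f).
Proof. by apply: sder_ext (sder_cst f) => t _; rewrite subrr. Qed.

Lemma lder_eigenM F1 F2 c1 c2 :
  lder F1 (fun t => c1 t * F1 t) -> lder F2 (fun t => c2 t * F2 t) ->
  lder (fun t => F1 t * F2 t) (fun t => (c1 t + c2 t) * (F1 t * F2 t)).
Proof. by move=> d1 d2; apply: lder_ext (lderM d1 d2) => t _; ring. Qed.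

Lemma lder_eigenX F c n : lder F (fun t => c t * F t) ->
  lder (fun t => F t ^+ n) (fun t => n%:R * c t * F t ^+ n).
Proof.
move=> d; elim: n => [|n IH].
  by apply: lder_ext (lder_cst 1) => t _; rewrite feuler1 !mul0r mulr0.
under eq_fun do rewrite exprS.
apply: lder_ext (lder_eigenM d IH) => t _.
by rewrite exprS -natr1; ring.
Qed.

End Flow.

End TimeSeries.

(** * The Koebe function and related series *)

Section SpecialSeries.
Variable R : realType.

Notation z := (@fvar R).

Definition fgeom : fps R := Fps (fun=> 1).
Definition falt : fps R := Fps (fun n => (-1) ^+ n).

Lemma fgeomP : (1 - z) * fgeom = 1.
Proof.
by apply/fpsP => -[|n]; rewrite mulrBl mul1r fcoefB fcoef_varM ?subr0 ?subrr.
Qed.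

Lemma faltP : (1 + z) * falt = 1.
Proof.
apply/fpsP => -[|n]; rewrite mulrDl mul1r fcoefD fcoef_varM ?addr0 //=.
by rewrite exprS mulN1r addNr.
Qed.

(** The Koebe function z / (1 - z)^2. *)
Definition fkoebe : fps R := z * fgeom ^+ 2.
(** The Moebius map z / (1 + z); the frequent factor 1 - 2 * fmoeb is
   (1 - z) / (1 + z). *)
Definition fmoeb : fps R := z * falt.

Lemma fkoebeE n : fkoebe n = n%:R.
Proof.
rewrite fcoef_varM; case: n => // n; rewrite expr2 fcoefM.
under eq_bigr do rewrite /= mulr1.
by rewrite sumr_const card_ord.
Qed.

Lemma fmoebP : (1 + z) * fmoeb = z.
Proof. by rewrite /fmoeb mulrCA faltP mulr1. Qed.

Lemma feuler_geom : feuler fgeom = z * fgeom ^+ 2.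
Proof. by apply/fpsP => n; rewrite fkoebeE /= mulr1. Qed.

Lemma feuler_koebe : feuler fkoebe * (1 - 2 * fmoeb) = fkoebe.
Proof.
rewrite feulerM feuler_var feulerX feuler_geom.
have -> : 2 * fmoeb = 1 - (1 - z) * falt.
  by transitivity ((1 + z) * falt - (1 - z) * falt); [rewrite /fmoeb; ring|rewrite faltP].
have -> : z * fgeom ^+ 2 + z * (2%:R * fgeom ^+ 2.-1 * (z * fgeom ^+ 2)) =
  ((1 - z) * fgeom) * (z * fgeom ^+ 2) + 2 * z * fgeom ^+ 2 * (z * fgeom).
  by rewrite fgeomP -[2.-1]/1%N expr1; ring.
rewrite /fkoebe.
transitivity (z * fgeom ^+ 2 * ((1 - z) * fgeom) * ((1 + z) * falt)); first by ring.
by rewrite fgeomP faltP !mulr1.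
Qed.

Lemma feuler_moeb : feuler fmoeb = fmoeb - fmoeb ^+ 2.
Proof.
have dz := congr1 (@feuler R) fmoebP.
rewrite feulerM feulerD feuler1 feuler_var add0r in dz.
have -> : feuler fmoeb = ((1 + z) * falt) * feuler fmoeb by rewrite faltP mul1r.
transitivity (falt * (z * fmoeb + (1 + z) * feuler fmoeb) - falt * z * fmoeb); first by ring.
by rewrite dz /fmoeb; ring.
Qed.

(** The coefficient of z^k in (1 + z)^(2k) G is the constant term of K^k G with
   K = (1 + z)^2 / z.  Euler's derivation kills constant terms, and
   D K = - (1 - z) / (1 + z) K, so that D can be moved from X to K^k. *)
Lemma koebe_by_parts k (X : fps R) :
  ((1 + z) ^+ (2 * k) * feuler X) k =
  k%:R * ((1 + z) ^+ (2 * k) * ((1 - 2 * fmoeb) * X)) k.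
Proof.
have dA : feuler ((1 + z) ^+ (2 * k)) = (2 * k)%:R * (1 + z) ^+ (2 * k) * fmoeb.
  rewrite feulerX feulerD feuler1 feuler_var add0r.
  case: k => [|k]; first by rewrite !mul0r.
  by rewrite -{2}fmoebP mulnS !addSn add0n /= [in RHS]exprS; ring.
have -> : (1 + z) ^+ (2 * k) * feuler X =
    feuler ((1 + z) ^+ (2 * k) * X) - (2 * k)%:R * (1 + z) ^+ (2 * k) * fmoeb * X.
  by rewrite feulerM dA; ring.
have -> : (1 + z) ^+ (2 * k) * ((1 - 2 * fmoeb) * X) =
   (1 + z) ^+ (2 * k) * X - 2 * ((1 + z) ^+ (2 * k) * fmoeb * X) by ring.
have -> : (2 * k)%:R * (1 + z) ^+ (2 * k) * fmoeb * X =
   fconst (2 * k)%:R * ((1 + z) ^+ (2 * k) * fmoeb * X).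
  by rewrite rmorph_nat; ring.
rewrite fcoefB feulerE fcoefB -[2 in RHS](rmorph_nat (@fconst R)) !fcoefCM natrM.
ring.
Qed.

Lemma fcoef_1zX N i : ((1 + z) ^+ N) i = 'C(N, i)%:R.
Proof.
elim: N i => [|N IH] i; first by rewrite expr0 fcoef1 bin0n.
rewrite exprS mulrDl mul1r fcoefD fcoef_varM; case: i => [|i].
  by rewrite IH !bin0 addr0.
by rewrite !IH binS natrD.
Qed.

End SpecialSeries.

(** * Inversion of the binomial sums *)

Section Inversion.
Variable R : realType.
Notation z := (@fvar R).

(** With x = (1 + z)^2 / z = z + 2 + 1/z, the sum of cheb n k * x^k over k is
   z^(-n) + z^(1-n) + ... + z^n: these are the coefficients of a Chebyshev
   polynomial of the fourth kind, up to a change of variable. *)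
Definition cheb n k : R := (-1) ^+ (n + k) * 'C(n + k, 2 * k)%:R.

(** The three-term recurrence with multiplier x - 2 = z + 1/z, read on
   coefficients; it is Pascal's rule used twice. *)
Lemma cheb_rec n k : cheb n.+2 k.+1 = cheb n.+1 k - 2 * cheb n.+1 k.+1 - cheb n k.+1.
Proof.
rewrite /cheb; have e1 : (n.+2 + k.+1 = (n + k).+3)%N by lia.
have e2 : (n.+1 + k.+1 = (n + k).+2)%N by lia.
have e3 : (n + k.+1 = (n + k).+1)%N by lia.
have e4 : (n.+1 + k = (n + k).+1)%N by lia.
have e5 : (2 * k.+1 = (2 * k).+2)%N by lia.
by rewrite e1 e2 e3 e4 e5 !binS !natrD !exprS; ring.
Qed.

Lemma cheb_gt n k : (n < k)%N -> cheb n k = 0.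
Proof. by move=> ltnk; rewrite /cheb bin_small ?mulr0 //; lia. Qed.

Lemma cheb0 n : cheb n 0 = (-1) ^+ n.
Proof. by rewrite /cheb muln0 bin0 mulr1 addn0. Qed.

(** The factor z^n clears the denominators of the powers of (1 + z)^2 / z. *)
Definition chebS n : fps R :=
  \sum_(k < n.+1) fconst (cheb n k) * (1 + z) ^+ (2 * k) * z ^+ (n - k).

(** Padding with vanishing terms, to put sums of different lengths over a
   common range. *)
Lemma chebS_widen n d K : (n < K)%N ->
  z ^+ d * chebS n = \sum_(k < K) fconst (cheb n k) * (1 + z) ^+ (2 * k) * z ^+ (n + d - k).
Proof.
move=> ltnK; rewrite /chebS mulr_sumr.
rewrite (big_ord_widen K (fun k => z ^+ d * (fconst (cheb n k) * (1 + z) ^+ (2 * k) * z ^+ (n - k)))) //.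
rewrite big_mkcond; apply: eq_bigr => k _; case: ifP => ltkn.
  have -> : (n + d - k = d + (n - k))%N by lia.
  by rewrite exprD; ring.
by rewrite cheb_gt ?rmorph0 ?mul0r //; lia.
Qed.

Lemma chebS_rec n : chebS n.+2 = ((1 + z) ^+ 2 - 2 * z) * chebS n.+1 - z ^+ 2 * chebS n.
Proof.
have -> : ((1 + z) ^+ 2 - 2 * z) * chebS n.+1 - z ^+ 2 * chebS n =
   (1 + z) ^+ 2 * (z ^+ 0 * chebS n.+1) - 2 * (z ^+ 1 * chebS n.+1) - z ^+ 2 * chebS n by ring.
rewrite (@chebS_widen n.+1 0 n.+2) // (@chebS_widen n.+1 1 n.+3) ?leqnSn //.
rewrite (@chebS_widen n 2 n.+3); last by lia.
rewrite {1}/chebS !(big_ord_recl n.+2).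
set b0 := fconst (cheb n.+1 _) * _ * _; set c0 := fconst (cheb n _) * _ * _.
set S1 := \sum_(_ < _) _; set S2 := \sum_(_ < _) _; set S3 := \sum_(_ < _) _; set S4 := \sum_(_ < _) _.
have -> : (1 + z) ^+ 2 * S2 - 2 * (b0 + S3) - (c0 + S4) =
  (- 2 * b0 - c0) + ((1 + z) ^+ 2 * S2 - 2 * S3 - S4) by ring.
congr (_ + _).
  rewrite /b0 /c0 -[nat_of_ord ord0]/0%N !cheb0 muln0 !subn0 addn1 addn2 !rmorphXn rmorphN1.
  by rewrite !exprS; ring.
rewrite /S1 /S2 /S3 /S4 !mulr_sumr -!sumrB; apply: eq_bigr => -[k /= ltk] _.
rewrite /bump /= !add1n.
have e5 : (2 * k.+1 = (2 * k).+2)%N by lia.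
have -> : (n.+1 + 1 - k.+1 = n.+2 - k.+1)%N by lia.
have -> : (n + 2 - k.+1 = n.+2 - k.+1)%N by lia.
have -> : (n.+1 + 0 - k = n.+2 - k.+1)%N by lia.
have e : fconst (cheb n.+2 k.+1) =
    fconst (cheb n.+1 k) - 2 * fconst (cheb n.+1 k.+1) - fconst (cheb n k.+1).
  by rewrite cheb_rec !rmorphB (rmorphM (@fconst R) 2) rmorph_nat.
by rewrite e5 e !exprS; ring.
Qed.

Lemma chebS_geom n : (1 - z) * chebS n = 1 - z ^+ (2 * n).+1.
Proof.
suff [] : (1 - z) * chebS n = 1 - z ^+ (2 * n).+1 /\ (1 - z) * chebS n.+1 = 1 - z ^+ (2 * n.+1).+1 by [].
elim: n => [|n [IH1 IH2]].
  have c11 : cheb 1 1 = 1.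
    by rewrite /cheb -[(1 + 1)%N]/2%N -[(2 * 1)%N]/2%N binn mulr1 expr2 mulN1r opprK.
  rewrite /chebS !big_ord_recl !big_ord0 -[nat_of_ord ord0]/0%N -[nat_of_ord (lift ord0 ord0)]/1%N.
  by rewrite !cheb0 c11 rmorph1 rmorphN1 -[(2 * 0)%N]/0%N; split; ring.
split=> //; rewrite chebS_rec.
have -> : (1 - z) * (((1 + z) ^+ 2 - 2 * z) * chebS n.+1 - z ^+ 2 * chebS n) =
   ((1 + z) ^+ 2 - 2 * z) * ((1 - z) * chebS n.+1) - z ^+ 2 * ((1 - z) * chebS n) by ring.
rewrite IH1 IH2 (_ : 2 * n.+2 = (2 * n).+4)%N; last by lia.
by rewrite (_ : 2 * n.+1 = (2 * n).+2)%N; [rewrite !exprS; ring|lia].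
Qed.

(** The coefficients of z^n + z^(-n) as a polynomial in (1 + z)^2 / z, namely
   differences of those of two consecutive geometric sums (chebME). *)
Definition chebM n k : R :=
  (-1) ^+ (n + k) * ((2 * n)%:R / (n + k)%:R) * 'C(n + k, n - k)%:R.

Lemma chebME n k : (k <= n.+1)%N -> chebM n.+1 k = cheb n.+1 k - cheb n k.
Proof.
move=> lek; rewrite /chebM /cheb addSn exprS.
have -> : (n.+1 - k = (n + k).+1 - 2 * k)%N by lia.
rewrite bin_sub; last by lia.
have : (n + k).+1%:R * 'C(n + k, 2 * k)%:R =
    ((n + k).+1%:R - (2 * k)%:R) * 'C((n + k).+1, 2 * k)%:R :> R.
  by rewrite -natrB; [rewrite -!natrM -mul_bin_down succnK|lia].
have -> : (2 * n.+1)%:R = (n + k).+1%:R + ((n + k).+1%:R - (2 * k)%:R) :> R.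
  by rewrite -natrB; [rewrite -natrD; congr (_%:R)|]; lia.
have : (n + k).+1%:R != 0 :> R by rewrite pnatr_eq0.
move: ((n + k).+1%:R) ('C((n + k).+1, 2 * k)%:R) => f c f0 e.
transitivity ((-1) * (-1) ^+ (n + k) * (c + (f - (2 * k)%:R) * c / f)); first by field.
by rewrite -e; field.
Qed.

(** The coefficient of z^j in ((1 + z)^2 / z)^k is the binomial C(2k, k + j), so
   this compares coefficients of z^j in the expansion of z^n + z^(-n) in powers
   of (1 + z)^2 / z, multiplied by z^n. *)
Lemma cheb_inversion n j : (0 < n)%N -> (0 < j)%N -> (j <= n)%N ->
  \sum_(1 <= k < n.+1) chebM n k * 'C(2 * k, k + j)%:R = (j == n)%:R.
Proof.
case: n => // n _ j0 lejn.
have geom : chebS n.+1 - z * chebS n = 1 + z ^+ (2 * n.+1).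
  have inj (f g : fps R) : (1 - z) * f = (1 - z) * g -> f = g.
    move=> e; transitivity (fgeom R * ((1 - z) * f)); first by rewrite mulrA [fgeom R * _]mulrC fgeomP mul1r.
    by rewrite e mulrA [fgeom R * _]mulrC fgeomP mul1r.
  apply: inj; transitivity ((1 - z) * chebS n.+1 - z * ((1 - z) * chebS n)); first by ring.
  rewrite !chebS_geom (_ : 2 * n.+1 = (2 * n).+2)%N; last by lia.
  by rewrite !exprS; ring.
have <- : (1 + z ^+ (2 * n.+1)) (n.+1 + j)%N = (j == n.+1)%:R.
  rewrite fcoefD fcoef1 -[z ^+ (2 * _)]mulr1 fcoef_varXM fcoef1.
  have -> : (n.+1 + j == 0)%N = false by lia.
  rewrite add0r; case: ifP => h; first by congr (_%:R); lia.
  by have -> : (j == n.+1) = false by lia.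
rewrite -geom -{1}[z]expr1 (@chebS_widen n 1 n.+2) ?leqnSn // /chebS -sumrB fcoef_sum.
rewrite -(big_mkord xpredT (fun k => (fconst (cheb n.+1 k) * (1 + z) ^+ (2 * k) * z ^+ (n.+1 - k) -
   fconst (cheb n k) * (1 + z) ^+ (2 * k) * z ^+ (n + 1 - k)) (n.+1 + j)%N)) big_ltn //.
have coefE k : (k <= n.+1)%N -> (fconst (cheb n.+1 k) * (1 + z) ^+ (2 * k) * z ^+ (n.+1 - k) -
   fconst (cheb n k) * (1 + z) ^+ (2 * k) * z ^+ (n + 1 - k)) (n.+1 + j)%N =
   chebM n.+1 k * 'C(2 * k, k + j)%:R.
  move=> lek; rewrite chebME // addn1.
  have -> : fconst (cheb n.+1 k) * (1 + z) ^+ (2 * k) * z ^+ (n.+1 - k) -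
     fconst (cheb n k) * (1 + z) ^+ (2 * k) * z ^+ (n.+1 - k) =
     fconst (cheb n.+1 k - cheb n k) * (z ^+ (n.+1 - k) * (1 + z) ^+ (2 * k)).
    by rewrite rmorphB; ring.
  rewrite fcoefCM fcoef_varXM (_ : (n.+1 - k <= n.+1 + j)%N); last by lia.
  by rewrite fcoef_1zX (_ : n.+1 + j - (n.+1 - k) = k + j)%N //; lia.
rewrite coefE // bin_small ?mulr0 ?add0r; last by lia.
by rewrite !big_nat; apply: eq_bigr => k /andP[_ lek]; rewrite coefE.
Qed.

Lemma cheb_solve (w T : nat -> R) n : (0 < n)%N ->
  (forall k, T k = \sum_(1 <= j < k.+1) 'C(2 * k, k - j)%:R * w j) ->
  w n = \sum_(1 <= k < n.+1) chebM n k * T k.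
Proof.
move=> n0 TE.
have TE' k : (k <= n)%N -> T k = \sum_(1 <= j < n.+1) 'C(2 * k, k + j)%:R * w j.
  move=> lekn; rewrite TE [RHS](big_cat_nat (n := k.+1)) //= [X in _ = _ + X]big_nat [X in _ = _ + X]big1 ?addr0.
    rewrite !big_nat; apply: eq_bigr => j /andP[_ lej]; rewrite -bin_sub; last by lia.
    by rewrite (_ : 2 * k - (k - j) = k + j)%N //; lia.
  by move=> j /andP[ltkj _]; rewrite bin_small ?mul0r //; lia.
transitivity (\sum_(1 <= j < n.+1) (j == n)%:R * w j).
  rewrite big_nat_recr //= eqxx mul1r big_nat big1 ?add0r // => j /andP[_ ltjn].
  by rewrite ltn_eqF // mul0r.
transitivity (\sum_(1 <= j < n.+1) \sum_(1 <= k < n.+1) chebM n k * ('C(2 * k, k + j)%:R * w j)).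
  rewrite !big_nat; apply: eq_bigr => j /andP[j0 lej].
  by rewrite -(@cheb_inversion n j) // mulr_suml; apply: eq_bigr => k _; rewrite mulrA.
rewrite exchange_big /= !big_nat; apply: eq_bigr => k /andP[_ lek].
by rewrite TE' // mulr_sumr.
Qed.

End Inversion.

(** * The solution of the moment equations *)

Section MomentSystem.
Variables (R : realType) (kappa : R) (u : nat -> R -> R).

Hypothesis u_ode : forall n, (0 < n)%N -> tder (u n) (fun t =>
  - (n%:R * u n t) - n%:R * (\sum_(1 <= k < n) u k t * u (n - k)%N t)
  + n%:R ^+ 2 * kappa ^+ 2).
Hypothesis u_start : forall n, u n 0 = 1.
Hypothesis kappa_sqr_neq1 : 1 - kappa ^+ 2 != 0.

Notation z := (@fvar R).
Notation k2 := (fconst (kappa ^+ 2)).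
Notation mu := (fkoebe R).
Notation om := (fmoeb R).

Definition mF t : fps R := Fps (fun n => if n is 0%N then 0 else u n t).
Definition mH t : fps R := 1 + 2 * mF t.
Definition mE t : fps R := mF t + mF t ^+ 2 - k2 * mu.

Lemma sqr_coef (f : fps R) n : f 0%N = 0 ->
  (f ^+ 2) n = \sum_(1 <= k < n) f k * f (n - k)%N.
Proof.
move=> f0; rewrite expr2 fcoefM; case: n => [|n].
  by rewrite big_ord_recl big_ord0 f0 mul0r addr0 big_geq.
rewrite big_ord_recl f0 mul0r add0r big_ord_recr /= subnn f0 mulr0 addr0.
by rewrite big_add1 /= big_mkord; apply: eq_bigr.
Qed.

(** The differential equations of all the moments, in one formula. *)
Lemma sder_F : sder mF (fun t => - feuler (mE t)).
Proof.
case=> [|n]; first by apply: tder_ext (tder_cst 0) => t _ /=; rewrite mul0r oppr0.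
apply: tder_ext (u_ode (ltn0Sn n)) => t _.
rewrite fcoefN feulerE fcoefB fcoefD sqr_coef // fcoefCM fkoebeE.
have -> : \sum_(1 <= k < n.+1) mF t k * mF t (n.+1 - k)%N =
          \sum_(1 <= k < n.+1) u k t * u (n.+1 - k)%N t.
  rewrite !big_nat; apply: eq_bigr => k /andP[k1 kn].
  have: (0 < n.+1 - k)%N by rewrite subn_gt0.
  by case: k k1 kn => // k _ _ ; case: (n.+1 - k.+1)%N.
by rewrite /=; ring.
Qed.

(** The series my solves y + y^2 = mE t with y(0) = 0.  Writing y = z x turns
   the equation into a contracting fixed point equation for x, which also gives
   the invertibility of x at time 0. *)
Definition mx t := ffix (fun f => Fps (fun n => mE t n.+1) - z * f ^+ 2).
Definition my t := z * mx t.
(** The inverse of W = 1 + 2 y. *)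
Definition mV t := ffix (fun f => 1 - 2 * z * mx t * f).

Lemma mE0 t : mE t 0%N = 0.
Proof.
by rewrite /mE fcoefB fcoefD expr2 fcoefM0 fcoefCM fkoebeE /= !mulr0 addr0 subrr.
Qed.

(** Multiplication by z delays a dependence by one degree. *)
Lemma contracting_varM (e : fps R) (P : fps R -> fps R) :
  (forall n (f g : fps R), (forall i, (i < n)%N -> f i = g i) -> forall i, (i < n)%N -> P f i = P g i) ->
  fcontracting (fun f => e - z * P f).
Proof.
move=> PP n f g fg [|i] lin; rewrite !fcoefB !fcoef_varM //.
by rewrite (PP n f g).
Qed.

Lemma fmul_agree n (f f' g g' : fps R) :
  (forall i, (i < n)%N -> f i = f' i) -> (forall i, (i < n)%N -> g i = g' i) ->
  forall i, (i < n)%N -> (f * g) i = (f' * g') i.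
Proof.
move=> ff gg i lin; rewrite !fcoefM; apply: eq_bigr => -[j /= lej] _.
by rewrite ff ?gg //; lia.
Qed.

Lemma my_eq t : my t + my t ^+ 2 = mE t.
Proof.
have xP : mx t = Fps (fun n => mE t n.+1) - z * mx t ^+ 2.
  rewrite {1}/mx -ffixP //.
  by apply: contracting_varM => n f g fg i lin; rewrite !expr2 (@fmul_agree n f g f g).
have -> : my t + my t ^+ 2 = z * (mx t + z * mx t ^+ 2) by rewrite /my; ring.
rewrite {1}xP subrK; apply/fpsP => -[|n]; rewrite fcoef_varM //.
by rewrite mE0.
Qed.

Lemma mV_eq t : (1 + 2 * my t) * mV t = 1.
Proof.
have VP : mV t = 1 - 2 * z * mx t * mV t.
  rewrite {1}/mV -ffixP //.
  have -> : (fun f => 1 - 2 * z * mx t * f) = (fun f => 1 - z * (2 * mx t * f)).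
    by apply/funext => f; ring.
  by apply: contracting_varM => n f g fg i lin; rewrite (@fmul_agree n _ (2 * mx t) f g).
by rewrite mulrDl mul1r {1}VP /my; ring.
Qed.

Lemma sder_E : exists E', sder mE E'.
Proof.
eexists; apply: sderB (sder_cst _); apply: sderD; first exact: sder_F.
have -> : (fun t => mF t ^+ 2) = (fun t => mF t * mF t) by apply/funext => t; rewrite expr2.
by apply: sderM; exact: sder_F.
Qed.

Lemma sder_x : exists x', sder mx x'.
Proof.
have [E' dE] := sder_E.
have dE1 : sder (fun t => Fps (fun n => mE t n.+1)) (fun t => Fps (fun n => E' t n.+1)).
  by move=> n; exact: dE.
apply: sder_fix => F F' dF; eexists; exact: sderB dE1 (sderM (sder_cst z) (sderM dF dF)).
Qed.

Lemma sder_V : exists V', sder mV V'.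
Proof.
have [x' dx] := sder_x.
apply: sder_fix => F F' dF; eexists.
exact: sderB (sder_cst 1) (sderM (sderM (sder_cst (2 * z)) dx) dF).
Qed.

(** Differentiating y + y^2 = F + F^2 - kappa^2 mu in time gives
   (1 + 2 y) y_t = (1 + 2 F) F_t, and F_t = - D (y + y^2) = - (1 + 2 y) D y, so
   y_t = - H D y after division by W. *)
Lemma lder_y : lder mH my (fun=> 0).
Proof.
have [y' dy] : exists y', sder my y'.
  by have [x' dx] := sder_x; eexists; exact: sderM (sder_cst z) dx.
apply: sder_ext (dy) => t t0.
have d1 := sderD dy (sderM dy dy).
have d2 := sderB (sderD sder_F (sderM sder_F sder_F)) (sder_cst (k2 * mu)).
have e : (fun t => my t + my t * my t) = (fun t => mF t + mF t * mF t - k2 * mu).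
  by apply/funext => s; rewrite -!expr2 my_eq.
rewrite e in d1; have := sder_uniq d1 d2 t0; rewrite -my_eq /=.
rewrite feulerD feulerX /= => e2.
transitivity ((1 + 2 * my t) * mV t * y' t); first by rewrite mV_eq mul1r.
transitivity (mV t * (y' t + (y' t * my t + my t * y' t))); first by ring.
rewrite e2 sub0r.
transitivity (- (((1 + 2 * my t) * mV t) * mH t * feuler (my t))); first by rewrite /mH; ring.
by rewrite mV_eq mul1r.
Qed.

Lemma lder_V : lder mH mV (fun=> 0).
Proof.
have [V' dV] := sder_V.
apply: sder_ext (dV) => t t0; rewrite sub0r.
have dy := lder_y; rewrite /lder in dy.
have d1 := sderM (sderD (sder_cst 1) (sderM (sder_cst 2) dy)) dV.
have e : (fun t => (1 + 2 * my t) * mV t) = (fun=> 1) by apply/funext => s; exact: mV_eq.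
rewrite e in d1; have := sder_uniq d1 (sder_cst 1) t0 => /= e2.
have := congr1 (@feuler R) (mV_eq t).
rewrite feulerM feulerD feuler1 add0r feulerM.
have -> : feuler 2 = 0 :> fps R by rewrite -(rmorph_nat (@fconst R)) feulerC.
rewrite mul0r add0r => e3.
transitivity ((1 + 2 * my t) * mV t * V' t); first by rewrite mV_eq mul1r.
transitivity (- (((1 + 2 * my t) * mV t) * mH t * feuler (mV t))); last first.
  by rewrite mV_eq mul1r.
apply/eqP; rewrite -subr_eq0; apply/eqP.
transitivity (mV t * ((0 + (0 * my t + 2 * (0 - mH t * feuler (my t)))) * mV t + (1 + 2 * my t) * V' t)
  + mV t * mH t * (2 * feuler (my t) * mV t + (1 + 2 * my t) * feuler (mV t))); first by ring.
by rewrite e2 e3; ring.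
Qed.

(** These are r = (W - H/zeta)/2 and s = (W + H/zeta)/2 for
   zeta = (1 + z) / (1 - z). *)
Definition mr t : fps R := my t - mF t + om + 2 * mF t * om.
Definition ms t : fps R := 1 + 2 * my t - mr t.

Lemma lder_F : lder mH mF (fun=> k2 * feuler mu).
Proof.
apply: sder_ext sder_F => t _.
rewrite /mE feulerB feulerD feulerX feulerM feulerC /mH -[2.-1]/1%N expr1; ring.
Qed.

Lemma mrs_eq t : mr t * ms t = mH t ^+ 2 * (om - om ^+ 2) - k2 * mu.
Proof.
have e := my_eq t; rewrite /mE in e.
have -> : k2 * mu = mF t + mF t ^+ 2 - (my t + my t ^+ 2) by rewrite e; ring.
by rewrite /ms /mr /mH; ring.
Qed.

(** Along the flow H/zeta solves the Riccati equation with derivative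
   ((H/zeta)^2 - W^2)/2, while W is constant; and 4 r s = W^2 - (H/zeta)^2. *)
Lemma lder_r_rs : lder mH mr (fun t => mr t * ms t).
Proof.
have dom := lder_cst mH om.
have d := lderD (lderD (lderB lder_y lder_F) dom) (lderM (lderM (lder_cst mH 2) lder_F) dom).
apply: lder_ext d => t t0; rewrite mrs_eq -[in RHS]feuler_koebe feuler_moeb.
have -> : feuler 2 = 0 :> fps R by rewrite -(rmorph_nat (@fconst R)) feulerC.
by rewrite /mH; ring.
Qed.

Lemma lder_r : lder mH mr (fun t => ms t * mr t).
Proof. by apply: lder_ext lder_r_rs => t _; rewrite mulrC. Qed.

Lemma lder_W : lder mH (fun t => 1 + 2 * my t) (fun=> 0).
Proof.
have d := lderD (lder_cst mH 1) (lderM (lder_cst mH 2) lder_y).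
apply: lder_ext d => t _.
have -> : feuler 2 = 0 :> fps R by rewrite -(rmorph_nat (@fconst R)) feulerC.
by rewrite feuler1; ring.
Qed.

Lemma lder_s : lder mH ms (fun t => - mr t * ms t).
Proof. by apply: lder_ext (lderB lder_W lder_r_rs) => t _; ring. Qed.

Definition mN k j m t : fps R :=
  ms t ^+ (k + j) * mr t ^+ (k - j) * mV t ^+ (2 * k) * my t ^+ m.

Lemma lder_eigen0 F : lder mH F (fun=> 0) -> lder mH F (fun t => 0 * F t).
Proof. by apply: lder_ext => t _; rewrite mul0r. Qed.

(** The eigenvalues add up to - (k + j) r + (k - j) s = k (s - r) - j (s + r),
   where s - r = H/zeta and s + r = W. *)
Lemma lder_N k j m : (j <= k)%N -> lder mH (mN k j m) (fun t =>
  (k%:R * (1 - 2 * om) * mH t - j%:R * (1 + 2 * my t)) * mN k j m t).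
Proof.
move=> lejk.
have d := lder_eigenM (lder_eigenM (lder_eigenM
  (lder_eigenX (k + j) lder_s) (lder_eigenX (k - j) lder_r))
  (lder_eigenX (2 * k) (lder_eigen0 lder_V))) (lder_eigenX m (lder_eigen0 lder_y)).
apply: lder_ext d => t _; congr (_ * _).
by rewrite natrB // natrD /ms /mr /mH; ring.
Qed.

Definition mTheta k j m t : R :=
  ((1 + z) ^+ (2 * k) * (mN k j m t * feuler (my t))) k.

(** The part k H/zeta of the eigenvalue is what integration by parts
   produces from the transport term, and they cancel; the part
   - j W = - j (1 + 2 y) stays, and multiplication by y raises m. *)
Lemma tder_Theta k j m : (j <= k)%N ->
  tder (mTheta k j m) (fun t => - j%:R * (mTheta k j m t + 2 * mTheta k j m.+1 t)).
Proof.
move=> lejk.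
have d := sderM (sder_cst ((1 + z) ^+ (2 * k)))
  (sderM (lder_N m lejk) (sder_euler lder_y)).
apply: tder_ext (d k) => t _.
cbv beta; rewrite mul0r add0r sub0r raddfN.
set N := mN k j m t; set A := (1 + z) ^+ _; set Dy := feuler (my t).
have -> : A * (((k%:R * (1 - 2 * om) * mH t - j%:R * (1 + 2 * my t)) * N - mH t * feuler N) * Dy
     + N * - feuler (mH t * Dy)) =
  fconst k%:R * (A * ((1 - 2 * om) * (N * (mH t * Dy)))) - A * feuler (N * (mH t * Dy))
  - fconst j%:R * (A * (N * Dy) + fconst 2 * (A * (N * my t * Dy))).
  by rewrite !rmorph_nat [feuler (N * _)]feulerM; ring.
rewrite !fcoefB koebe_by_parts !fcoefCM subrr sub0r fcoefD fcoefCM mulNr /mTheta.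
by rewrite /mN exprSr !mulrA.
Qed.

Lemma my0 t : my t 0%N = 0. Proof. by rewrite fcoef_varM. Qed.

Lemma mr0 t : mr t 0%N = 0.
Proof.
have om0 : om 0%N = 0 by rewrite fcoef_varM.
by rewrite /mr fcoefD [X in _ + X]fcoefM0 !fcoefD fcoefN my0 om0 mulr0 subr0 !addr0.
Qed.

(** The series r, y and D y have no constant term, so the product starts at
   degree k - j + m + 1 > k. *)
Lemma Theta0 k j m t : (j <= k)%N -> (j <= m)%N -> mTheta k j m t = 0.
Proof.
move=> lejk lejm; have small : fsmall ((k - j) + m + 1) (mN k j m t * feuler (my t)).
  apply: fsmallM; last exact: fsmall_euler1.
  apply: fsmallM; last by apply: fsmallX; exact: my0.
  by apply: fsmallMr; apply: fsmallMl; apply: fsmallX; exact: mr0.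
by apply: (fsmallMl _ small); lia.
Qed.

(** This coefficient is computed twice: from the time evolution (mT_laguerre)
   and from the coefficients of y (mT_binomial). *)
Definition mT k t : R := ((1 + z) ^+ (2 * k) * feuler (my t)) k.

(** The binomial expansion of 1 = (s + r)^(2k) W^(-2k); the terms with at least
   k factors r have too high an order, because D y has order 1. *)
Lemma mT_sum k t : mT k t = \sum_(1 <= j < k.+1) 'C(2 * k, k - j)%:R * mTheta k j 0 t.
Proof.
have W1 : (ms t + mr t) ^+ (2 * k) * mV t ^+ (2 * k) = 1.
  by rewrite -exprMn /ms subrK mV_eq expr1n.
have -> : mT k t = \sum_(i < (2 * k).+1) 'C(2 * k, i)%:R *
    ((1 + z) ^+ (2 * k) * (ms t ^+ (2 * k - i) * mr t ^+ i * mV t ^+ (2 * k) * feuler (my t))) k.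
  have {1}-> : mT k t = ((1 + z) ^+ (2 * k) *
      ((ms t + mr t) ^+ (2 * k) * mV t ^+ (2 * k) * feuler (my t))) k.
    by rewrite W1 mul1r.
  rewrite [(ms t + _) ^+ _]exprDn !mulr_suml mulr_sumr fcoef_sum.
  apply: eq_bigr => i _; rewrite -fcoefCM rmorph_nat; congr (fcoef _ _).
  by rewrite -[_ *+ _]mulr_natl; ring.
have lek : (k <= (2 * k).+1)%N by lia.
rewrite -(big_mkord xpredT (fun i => 'C(2 * k, i)%:R *
    ((1 + z) ^+ (2 * k) * (ms t ^+ (2 * k - i) * mr t ^+ i * mV t ^+ (2 * k) * feuler (my t))) k)).
rewrite (big_cat_nat (leq0n k) lek) [X in _ + X = _]big_nat [X in _ + X = _]big1 ?addr0; last first.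
  move=> i /andP[leki _].
  have small : fsmall (i + 1) (ms t ^+ (2 * k - i) * mr t ^+ i * mV t ^+ (2 * k) * feuler (my t)).
    apply: fsmallM; last exact: fsmall_euler1.
    by apply: fsmallMr; apply: fsmallMl; apply: fsmallX; exact: mr0.
  by rewrite (fsmallMl _ small) ?mulr0 //; lia.
rewrite [RHS]big_add1 [RHS]big_nat_rev add0n.
rewrite big_nat [RHS]big_nat; apply: eq_bigr => i /andP[_ ltik].
have -> : (k - (k - i.+1).+1 = i)%N by lia.
rewrite /mTheta /mN expr0 mulr1.
have -> : (k - (k - i.+1).+1 = i)%N by lia.
by have -> : (k + (k - i.+1).+1 = 2 * k - i)%N by lia.
Qed.

(** Removing the factor e^(-jt) leaves the system T_m' = - 2 j T_(m+1), which is
   nilpotent as T_m = 0 for m >= j; its solution is a Taylor polynomial. *)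
Lemma Theta_solve k j m t : (j <= k)%N -> 0 <= t ->
  mTheta k j m t = expR (- (j%:R * t)) *
    \sum_(r < j - m) ((- (2 * j%:R * t)) ^+ r / r`!%:R) * mTheta k j (m + r) 0.
Proof.
move=> lejk t0; have [d dE] : exists d, (j - m = d)%N by exists (j - m)%N.
elim: d m dE t t0 => [|d IH] m dE t t0.
  by rewrite dE big_ord0 mulr0 Theta0 // -subn_eq0 dE.
have expVK (s : R) : expR (j%:R * s) * expR (- (j%:R * s)) = 1.
  by rewrite -expRD subrr expR0.
apply: (mulfI (lt0r_neq0 (expR_gt0 (j%:R * t)))); rewrite mulrA expVK mul1r.
have dl := tderM (tder_exp j%:R) (tder_Theta m lejk).
pose c r := (- (2 * j%:R)) ^+ r / r`!%:R * mTheta k j (m + r) 0.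
have dr := @tder_sum R _ (index_iota 0 d.+1) _ _ (fun r => tderM (tder_cst (c r)) (tder_pow R r)).
have sumE s : \sum_(r < j - m) ((- (2 * j%:R * s)) ^+ r / r`!%:R) * mTheta k j (m + r) 0 =
    \sum_(0 <= r < d.+1) c r * s ^+ r.
  rewrite dE big_mkord; apply: eq_bigr => r _.
  by rewrite /c -mulNr exprMn; ring.
rewrite sumE; apply: (tder_eq dl dr) => [s s0||//]; last first.
  rewrite mulr0 expR0 mul1r big_nat_recl // expr0 mulr1 big1 => [|r _].
    by rewrite /c expr0 fact0 divr1 mul1r addn0 addr0.
  by rewrite expr0n mulr0.
have jm1 : (j - m.+1)%N = d by lia.
transitivity (- (2 * j%:R) * (expR (j%:R * s) * mTheta k j m.+1 s)); first by ring.
rewrite (IH _ jm1 s (ltW s0)) [expR _ * (_ * _)]mulrA expVK mul1r jm1.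
cbv beta; rewrite big_nat_recl // /c. rewrite ?mulr0n !(mul0r, mulr0, add0r).
rewrite mulr_sumr big_mkord; apply: eq_bigr => r _.
rewrite mul0r add0r addnS addSn -[r.+1.-1]/(nat_of_ord r).
have -> : - (2 * j%:R * s) = (- (2 * j%:R)) * s by ring.
rewrite factS natrM exprMn exprS.
have : r.+1%:R != 0 :> R by rewrite pnatr_eq0.
have : r`!%:R != 0 :> R by rewrite pnatr_eq0 -lt0n fact_gt0.
by move: (r`!%:R) (r.+1%:R) => f g f0 g0; field; apply/andP.
Qed.

Let aa : fps R := fconst (1 - kappa ^+ 2).
Let Y : fps R := my 0.
Let W0 : fps R := 1 + 2 * Y.

Lemma mF_start : (1 - z) * mF 0 = z.
Proof.
apply/fpsP => -[|[|n]]; rewrite mulrBl mul1r fcoefB fcoef_varM /= ?u_start ?subr0 //.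
by rewrite subrr.
Qed.

Lemma Y_eq : Y + Y ^+ 2 = aa * mu.
Proof.
rewrite /Y my_eq /mE /aa rmorphB rmorph1.
suff -> : mF 0 + mF 0 ^+ 2 = mu by ring.
have -> : mF 0 = z * fgeom R.
  transitivity ((1 - z) * fgeom R * mF 0); first by rewrite fgeomP mul1r.
  by transitivity (fgeom R * ((1 - z) * mF 0)); [ring|rewrite mF_start mulrC].
transitivity (z * fgeom R * ((1 - z) * fgeom R) + z ^+ 2 * fgeom R ^+ 2).
  by rewrite fgeomP mulr1; ring.
by rewrite /fkoebe; ring.
Qed.

(** At time 0 all moments are 1, so H = (1 + z) / (1 - z) = zeta. *)
Lemma mr_start : mr 0 = Y.
Proof.
rewrite /mr -/Y.
suff e : om + 2 * mF 0 * om - mF 0 = 0.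
  by transitivity (Y + (om + 2 * mF 0 * om - mF 0)); [ring|rewrite e addr0].
transitivity (((1 - z) * fgeom R) * ((1 + z) * falt R) * (om + 2 * mF 0 * om - mF 0)).
  by rewrite fgeomP faltP !mul1r.
transitivity (fgeom R * falt R * ((1 - z) * ((1 + z) * om) + 2 * ((1 - z) * mF 0) * ((1 + z) * om)
    - (1 + z) * ((1 - z) * mF 0))); first by ring.
by rewrite mF_start fmoebP; ring.
Qed.

Lemma ms_start : ms 0 = 1 + Y.
Proof. by rewrite /ms mr_start -/Y; ring. Qed.

Lemma koebe_sqr : (1 + z) ^+ 2 * fgeom R ^+ 2 = 1 + 4 * mu.
Proof.
transitivity (((1 - z) * fgeom R) ^+ 2 + 4 * (z * fgeom R ^+ 2)); first by ring.
by rewrite fgeomP expr1n.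
Qed.

(** Here Y (1 + Y) = (1 - kappa^2) mu and W0^2 - kappa^2 = (1 - kappa^2) (1 + 4 mu),
   while 1 + 4 mu = ((1 + z) / (1 - z))^2. *)
Lemma Y_koebe : (1 + z) ^+ 2 * (Y * (1 + Y)) = z * (W0 ^+ 2 - k2).
Proof.
have e : Y * (1 + Y) = aa * mu by rewrite -Y_eq; ring.
have -> : W0 ^+ 2 - k2 = aa + 4 * (Y * (1 + Y)).
  by rewrite /aa rmorphB rmorph1 /W0; ring.
rewrite e /fkoebe.
transitivity (z * aa * ((1 + z) ^+ 2 * fgeom R ^+ 2)); first by ring.
by rewrite koebe_sqr /fkoebe; ring.
Qed.

(** The series y starts with (1 - kappa^2) z, so kappa^2 <> 1 makes
   y a coordinate near 0. *)
Lemma x_unit : exists xb, mx 0 * xb = 1.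
Proof.
have x0 : mx 0 0%N = 1 - kappa ^+ 2.
  have := congr1 (fun f : fps R => f 1%N) Y_eq; rewrite fcoefD sqr_coef; last exact: my0.
  by rewrite big_geq // addr0 fcoefCM fkoebeE mulr1 fcoef_varM.
pose w := fconst (1 - kappa ^+ 2)^-1 * mx 0.
have w0 : w 0%N = 1 by rewrite fcoefCM x0 mulVf.
pose e : fps R := Fps (fun n => w n.+1).
have wE : w = 1 + z * e.
  apply/fpsP => -[|n]; rewrite fcoefD fcoef_varM ?w0 ?addr0 //.
  by rewrite fcoef1 add0r.
have C : fcontracting (fun f => 1 - z * (e * f)).
  by apply: contracting_varM => n f g fg i lin; rewrite (@fmul_agree n e e f g).
exists (fconst (1 - kappa ^+ 2)^-1 * ffix (fun f => 1 - z * (e * f))).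
rewrite mulrA [mx 0 * _]mulrC -/w wE mulrDl mul1r -{1}(ffixP C); ring.
Qed.

(** As xb = z / Y, the coefficient of z^j is the residue of Y^(l-j) dY: the form
   Y^(l-j) dY is exact unless l - j = -1. *)
Lemma residue_delta (xb : fps R) j l : mx 0 * xb = 1 -> (0 < j)%N ->
  (xb ^+ j * (Y ^+ l * feuler Y)) j = (l.+1 == j)%:R.
Proof.
move=> xxb j0; set x := mx 0 in xxb.
have YE : Y = z * x by [].
have Y0 : Y 0%N = 0 by exact: my0.
case: (leqP j l) => [lejl|ltlj].
  rewrite gtn_eqF //.
  have small : fsmall (l + 1) (Y ^+ l * feuler Y).
    by apply: fsmallM; [exact: fsmallX|exact: fsmall_euler1].
  by rewrite (fsmallMl _ small) //; lia.
have -> : j = (l + (j - l.+1).+1)%N by lia.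
set s := (j - l.+1)%N.
have -> : xb ^+ (l + s.+1) * (Y ^+ l * feuler Y) =
    z ^+ l.+1 * ((x * xb) ^+ l * (xb ^+ s.+1 * (x + feuler x))).
  by rewrite YE feulerM feuler_var exprD !exprMn !exprS; ring.
rewrite xxb expr1n mul1r fcoef_varXM.
have -> : (l < l + s.+1)%N by lia.
have -> : (l + s.+1 - l.+1 = s)%N by lia.
have -> : (l.+1 == (l + s.+1)%N) = (s == 0%N) by lia.
have dxb : feuler xb = - (xb ^+ 2 * feuler x).
  have := congr1 (@feuler R) xxb; rewrite feulerM feuler1 => e.
  transitivity (x * xb * feuler xb); first by rewrite xxb mul1r.
  transitivity (xb * (feuler x * xb + x * feuler xb) - xb ^+ 2 * feuler x); first by ring.
  by rewrite e mulr0 sub0r.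
case: s => [|s].
  rewrite expr1 mulrDr [xb * x]mulrC xxb fcoefD fcoef1 fcoefM0.
  by rewrite feulerE mul0r mulr0 addr0.
have e : feuler (xb ^+ s.+1) = - (s.+1%:R * (xb ^+ s.+2 * feuler x)).
  by rewrite feulerX dxb -[s.+1.-1]/s !exprS; ring.
have -> : xb ^+ s.+2 * (x + feuler x) = xb ^+ s.+1 + xb ^+ s.+2 * feuler x.
  transitivity (x * xb * xb ^+ s.+1 + xb ^+ s.+2 * feuler x); first by rewrite exprS; ring.
  by rewrite xxb mul1r.
have := congr1 (fun f : fps R => f s.+1) e.
rewrite feulerE fcoefN -(rmorph_nat (@fconst R)) fcoefCM => e2.
rewrite fcoefD; apply: (@mulfI _ s.+1%:R); first by rewrite pnatr_eq0.
by rewrite mulrDr e2 addNr mulr0.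
Qed.

(** By Y_koebe, (1 + z)^(2k) (Y (1 + Y))^k W^(-2k) is z^k (1 - kappa^2 / W^2)^k,
   so the coefficient becomes the residue of
   (1 + 1/Y)^j (1 - kappa^2 / W^2)^k Y^m dY. *)
Lemma Theta_start k j m (xb : fps R) : mx 0 * xb = 1 -> (j <= k)%N ->
  mTheta k j m 0 =
  (xb ^+ j * ((1 + Y) ^+ j * (1 - k2 * mV 0 ^+ 2) ^+ k * Y ^+ m * feuler Y)) j.
Proof.
move=> xxb lejk.
have VW : W0 * mV 0 = 1 := mV_eq 0.
have key : (1 + z) ^+ (2 * k) * ((1 + Y) ^+ (k + j) * Y ^+ (k - j) * mV 0 ^+ (2 * k)) =
   z ^+ (k - j) * (xb ^+ j * ((1 + Y) ^+ j * (1 - k2 * mV 0 ^+ 2) ^+ k)).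
  apply: (@fvarXI _ j); cbv beta; rewrite [RHS]mulrA -exprD subnKC //.
  have -> : 1 - k2 * mV 0 ^+ 2 = (W0 ^+ 2 - k2) * mV 0 ^+ 2.
    by rewrite mulrBl -exprMn VW expr1n.
  transitivity ((mx 0 * xb) ^+ j * (z ^+ j * ((1 + z) ^+ (2 * k) * ((1 + Y) ^+ (k + j) * Y ^+ (k - j) * mV 0 ^+ (2 * k))))).
    by rewrite xxb expr1n mul1r.
  transitivity (xb ^+ j * ((1 + Y) ^+ j * mV 0 ^+ (2 * k)) * ((1 + z) ^+ 2 * (Y * (1 + Y))) ^+ k).
    have -> : ((1 + z) ^+ 2 * (Y * (1 + Y))) ^+ k =
        (1 + z) ^+ (2 * k) * ((z ^+ j * mx 0 ^+ j * Y ^+ (k - j)) * (1 + Y) ^+ k).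
      have eY : z ^+ j * mx 0 ^+ j * Y ^+ (k - j) = Y ^+ k.
        by rewrite -exprMn -[z * mx 0]/Y -exprD subnKC.
      by rewrite eY [(_ * (Y * _)) ^+ k]exprMn [(Y * _) ^+ k]exprMn -exprM.
    by rewrite [(mx 0 * xb) ^+ j]exprMn exprD; ring.
  rewrite Y_koebe [(z * _) ^+ k]exprMn [((_ - _) * _) ^+ k]exprMn.
  by rewrite -[mV 0 ^+ 2 ^+ k]exprM; ring.
rewrite /mTheta /mN mr_start ms_start -/Y.
transitivity ((z ^+ (k - j) * (xb ^+ j * ((1 + Y) ^+ j * (1 - k2 * mV 0 ^+ 2) ^+ k * Y ^+ m * feuler Y))) k).
  congr (fcoef _ _).
  transitivity ((1 + z) ^+ (2 * k) * ((1 + Y) ^+ (k + j) * Y ^+ (k - j) * mV 0 ^+ (2 * k))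
     * (Y ^+ m * feuler Y)); first by ring.
  by rewrite key; ring.
by rewrite fcoef_varXM leq_subr subKn.
Qed.

(** The coefficient of Y^r in (1 + 2 Y)^(-s). *)
Definition negbin s r : R := (-2) ^+ r / r`!%:R * pochhammer s%:R r.

Lemma negbin_rec s r : negbin s.+1 r.+1 + 2 * negbin s.+1 r = negbin s r.+1.
Proof.
rewrite /negbin /pochhammer big_ord_recr [in RHS]big_ord_recl /=.
have -> : \prod_(i < r) (s%:R + (bump 0 i)%:R) = \prod_(i < r) (s.+1%:R + i%:R) :> R.
  by apply: eq_bigr => i _; rewrite /bump /= natrD -natr1; ring.
rewrite factS natrM exprS addr0 -natr1 -[in r.+1%:R]natr1.
have : r%:R + 1 != 0 :> R by rewrite natr1 pnatr_eq0.
have : r`!%:R != 0 :> R by rewrite pnatr_eq0 -lt0n fact_gt0.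
by move: (r`!%:R) (\prod_(_ < _) _) => f p f0 g0; field; apply/andP.
Qed.

Lemma negbin0 s : negbin s 0 = 1.
Proof. by rewrite /negbin /pochhammer big_ord0 expr0 fact0 divr1 mulr1. Qed.

(** Truncated expansions with an explicit remainder suffice: powers of Y from
   the j-th on have no residue.  The induction on s multiplies by W = 1 + 2 Y. *)
Lemma V_expansion s N : exists rho,
  mV 0 ^+ s = \sum_(r < N) fconst (negbin s r) * Y ^+ r + Y ^+ N * rho.
Proof.
case: N => [|N]; first by exists (mV 0 ^+ s); rewrite big_ord0 expr0; ring.
have WB s' : W0 * (\sum_(r < N.+1) fconst (negbin s'.+1 r) * Y ^+ r) =
   \sum_(r < N.+1) fconst (negbin s' r) * Y ^+ r + 2 * fconst (negbin s'.+1 N) * Y ^+ N.+1.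
  elim: N => [|N IH]; first by rewrite !big_ord_recl !big_ord0 !negbin0 rmorph1 expr0 expr1 /W0; ring.
  have e : fconst (negbin s' N.+1) = fconst (negbin s'.+1 N.+1) + 2 * fconst (negbin s'.+1 N).
    by rewrite -(negbin_rec s' N) rmorphD [X in _ + X]rmorphM rmorph_nat.
  transitivity (\sum_(r < N.+1) fconst (negbin s' r) * Y ^+ r + fconst (negbin s' N.+1) * Y ^+ N.+1
      + 2 * fconst (negbin s'.+1 N.+1) * Y ^+ N.+2); last by rewrite [in RHS]big_ord_recr.
  rewrite e big_ord_recr mulrDr IH /=.
  by rewrite /W0 !exprS; ring.
have VW : W0 * mV 0 = 1 := mV_eq 0.
elim: s => [|s [rho IH]].
  exists 0; rewrite mulr0 addr0 expr0 big_ord_recl negbin0 rmorph1 expr0 mulr1 big1 ?addr0 // => r _.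
  by rewrite /negbin /pochhammer /= big_ord_recl addr0 mul0r mulr0 rmorph0 mul0r.
exists (mV 0 * rho - 2 * fconst (negbin s.+1 N) * mV 0).
rewrite exprS IH; have -> : \sum_(r < N.+1) fconst (negbin s r) * Y ^+ r =
   W0 * (\sum_(r < N.+1) fconst (negbin s.+1 r) * Y ^+ r) - 2 * fconst (negbin s.+1 N) * Y ^+ N.+1.
  by rewrite WB addrK.
set B := \sum_(_ < _) _.
transitivity (W0 * mV 0 * B + Y ^+ N.+1 * (mV 0 * rho - 2 * fconst (negbin s.+1 N) * mV 0)); first by ring.
by rewrite VW mul1r.
Qed.

Lemma Pkm_expansion k N : exists rho,
  (1 - k2 * mV 0 ^+ 2) ^+ k =
  \sum_(r < N) fconst (Pkm k r (kappa ^+ 2)) * Y ^+ r + Y ^+ N * rho.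
Proof.
have [rho rhoE] := choice (fun i => V_expansion (2 * i) N).
exists (\sum_(i < k.+1) fconst ('C(k, i)%:R * (- kappa ^+ 2) ^+ i) * rho i).
rewrite exprDn.
transitivity (\sum_(i < k.+1) (\sum_(r < N) fconst ('C(k, i)%:R * (- kappa ^+ 2) ^+ i * negbin (2 * i) r) * Y ^+ r
   + Y ^+ N * (fconst ('C(k, i)%:R * (- kappa ^+ 2) ^+ i) * rho i))).
  apply: eq_bigr => i _; rewrite expr1n mul1r -mulNr -mulr_natl.
  have -> : - k2 = fconst (- kappa ^+ 2) by rewrite rmorphN.
  have cE : 'C(k, i)%:R * fconst (- kappa ^+ 2) ^+ i = fconst ('C(k, i)%:R * (- kappa ^+ 2) ^+ i).
    by rewrite rmorphM rmorphXn rmorph_nat.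
  rewrite exprMn -exprM rhoE mulrA cE mulrDr mulr_sumr; congr (_ + _); last by ring.
  by apply: eq_bigr => r _; rewrite [in RHS]rmorphM mulrA.
rewrite big_split /= -mulr_sumr exchange_big /=; congr (_ + _).
apply: eq_bigr => r _; rewrite -mulr_suml -rmorph_sum; congr (fconst _ * _).
by rewrite /Pkm mulr_sumr; apply: eq_bigr => i _; rewrite /negbin; ring.
Qed.

(** The residue selects a single term of the binomial expansion of (1 + 1/Y)^j. *)
Lemma Theta_startE k j m : (0 < j)%N -> (j <= k)%N ->
  mTheta k j m 0 = \sum_(r < j) Pkm k r (kappa ^+ 2) *
     (if (m + r < j)%N then 'C(j, j - (m + r).+1)%:R else 0).
Proof.
move=> j0 lejk; have [xb xxb] := x_unit.
rewrite (Theta_start m xxb lejk); have [rho ->] := Pkm_expansion k j.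
have Lsmall (f : fps R) : (xb ^+ j * ((1 + Y) ^+ j * (Y ^+ j * rho) * Y ^+ m * feuler Y)) j = 0.
  apply: fsmallMl (ltnSn j); rewrite -addn1; apply: fsmallM; last exact: fsmall_euler1.
  by apply: fsmallMr; apply: fsmallMl; apply: fsmallMr; apply: fsmallX; exact: my0.
rewrite mulrDr !mulrDl mulrDr fcoefD Lsmall // addr0.
rewrite !mulr_sumr !mulr_suml mulr_sumr fcoef_sum; apply: eq_bigr => r _.
transitivity (\sum_(i < j.+1) Pkm k r (kappa ^+ 2) * ('C(j, i)%:R * ((m + r + i).+1 == j)%N%:R)).
  rewrite exprDn !mulr_suml mulr_sumr fcoef_sum; apply: eq_bigr => i _.
  rewrite -(residue_delta _ xxb j0) -!fcoefCM; congr (fcoef _ _).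
  by rewrite expr1n mul1r -mulr_natl rmorph_nat !exprD; ring.
rewrite -mulr_sumr; congr (_ * _).
case: ltnP => [ltmr|lemr]; last first.
  by rewrite big1 // => i _; rewrite gtn_eqF ?mulr0 //; lia.
have lti : (j - (m + r).+1 < j.+1)%N by lia.
rewrite (bigD1 (Ordinal lti)) //= big1 ?addr0 => [|i].
  have -> : ((m + r + (j - (m + r).+1)).+1 == j)%N by lia.
  by rewrite mulr1.
rewrite -val_eqE /= => ne; have -> : ((m + r + i).+1 == j)%N = false by lia.
by rewrite mulr0.
Qed.

Lemma rising_factorial g i n : (i <= n)%N ->
  (\prod_(i.+1 <= l < n.+1) (g%:R + l%:R)) * (g + i)`!%:R = (g + n)`!%:R :> R.
Proof.
elim: n => [|n IH]; first by rewrite leqn0 => /eqP ->; rewrite big_geq // mul1r.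
rewrite leq_eqVlt => /predU1P[->|lein]; first by rewrite big_geq // mul1r.
rewrite big_nat_recr //= mulrAC IH // addnS factS natrM mulrC.
by rewrite -addnS natrD.
Qed.

(** The binomials that come from the residues at time 0 are the coefficients
   of Laguerre polynomials. *)
Lemma laguerreE j r (x : R) : (r < j)%N ->
  laguerre (j - r - 1) r.+1%:R x =
  \sum_(s < j - r) 'C(j, j - (s + r).+1)%:R * ((- x) ^+ s / s`!%:R).
Proof.
move=> ltrj; have e : (j - r - 1).+1 = (j - r)%N by lia.
rewrite /laguerre e; apply: eq_bigr => s _; congr (_ * _).
have lts := ltn_ord s.
have les : (s <= j - r - 1)%N by lia.
have f0 N : N`!%:R != 0 :> R by rewrite pnatr_eq0 -lt0n fact_gt0.
apply: (mulIf (f0 (r.+1 + s)%N)); apply: (mulIf (f0 (j - r - 1 - s)%N)).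
have := rising_factorial r.+1 les; rewrite e => P_eq.
transitivity ((\prod_(s.+1 <= l < j - r) (r.+1%:R + l%:R)) * (r.+1 + s)`!%:R : R).
  by field; rewrite f0.
rewrite P_eq -!natrM; congr (_%:R).
have -> : (r.+1 + s = s + r.+1)%N by lia.
have lej : (j - (s + r).+1 <= j)%N by lia.
have := bin_fact lej.
have -> : (j - (j - (s + r).+1) = s + r.+1)%N by lia.
have -> : (j - r - 1 - s = j - (s + r).+1)%N by lia.
have -> : (r.+1 + (j - r - 1) = j)%N by lia.
by move=> <-; rewrite -mulnA [in RHS](mulnC (_)`!).
Qed.

Definition laguerre_sum k t : R := \sum_(1 <= j < k.+1)
  'C(2 * k, k - j)%:R * expR (- (j%:R * t))
   * \sum_(0 <= m < j) laguerre (j - m - 1) m.+1%:R (2 * j%:R * t) * Pkm k m (kappa ^+ 2).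

Lemma mT_laguerre k t : 0 <= t -> mT k t = laguerre_sum k t.
Proof.
move=> t0; rewrite mT_sum /laguerre_sum !big_nat; apply: eq_bigr => j /andP[j0 lejk].
rewrite ltnS in lejk; rewrite Theta_solve // mulrA; congr (_ * _).
rewrite subn0 big_mkord.
under eq_bigr do rewrite add0n Theta_startE // mulr_sumr.
rewrite exchange_big /=; apply: eq_bigr => r _.
rewrite laguerreE // mulr_suml (big_ord_widen j (fun s => 'C(j, j - (s + r).+1)%:R *
  ((- (2 * j%:R * t)) ^+ s / s`!%:R) * Pkm k r (kappa ^+ 2))) ?leq_subr //.
rewrite [in RHS]big_mkcond /=; apply: eq_bigr => s _.
have -> : (s < j - r)%N = (s + r < j)%N by lia.
by case: ifP => _; rewrite ?mulr0 //; ring.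
Qed.

Lemma mT_binomial k t : mT k t = \sum_(1 <= j < k.+1) 'C(2 * k, k - j)%:R * (j%:R * my t j).
Proof.
rewrite /mT fcoefM -(big_mkord xpredT (fun i => ((1 + z) ^+ (2 * k)) i * feuler (my t) (k - i)%N)).
rewrite [LHS]big_nat_recr // subnn [feuler _ 0%N]feulerE mul0r mulr0. rewrite Monoid.mulm1.
rewrite [RHS]big_add1 [RHS]big_nat_rev add0n big_nat [RHS]big_nat; apply: eq_bigr => i /andP[_ lti].
have -> : (k - i.+1).+1 = (k - i)%N by lia.
by rewrite fcoef_1zX feulerE subKn // ltnW.
Qed.

Lemma my_bcoef n t : (0 < n)%N -> 0 <= t -> my t n = b_coef n kappa t.
Proof.
move=> n0 t0; have nn0 : n%:R != 0 :> R by rewrite pnatr_eq0 -lt0n.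
apply: (mulfI nn0).
rewrite (@cheb_solve R (fun j => j%:R * my t j) (mT ^~ t)) //; last first.
  by move=> k; exact: mT_binomial.
rewrite /b_coef gtn_eqF // /c_coef [2 / _]mulrC.
set S := (X in _ = n%:R * (_ * X / 2)); transitivity S; last by field.
by apply: eq_bigr => k _; rewrite mT_laguerre.
Qed.

(** This is the equation F_t = - D (y + y^2), coefficient by coefficient. *)
Lemma tder_moment n : (0 < n)%N -> tder (u n) (fun t =>
  - (n%:R * \sum_(1 <= k < n.+1) b_coef k kappa t * b_coef (n - k) kappa t)).
Proof.
case: n => // n _; apply: tder_ext (sder_F n.+1) => t t0.
rewrite fcoefN -my_eq feulerE fcoefD sqr_coef ?my0 //; congr (- (_ * _)).
rewrite [RHS]big_nat_recr // subnn [b_coef 0 _ _]/b_coef eqxx Monoid.mulm1 addrC.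
congr (_ + _); last by rewrite my_bcoef // ltW.
rewrite !big_nat; apply: eq_bigr => k /andP[k0 lekn].
by rewrite !my_bcoef ?(ltW t0) //; lia.
Qed.

End MomentSystem.

(** * Continuity of the coefficients *)

Section Continuity.
Variable R : realType.
Implicit Types F : R -> R.

Lemma continuous_bigsum (I : Type) (r : seq I) (F : I -> R -> R) :
  (forall i, continuous (F i)) -> continuous (fun t => \sum_(i <- r) F i t).
Proof.
move=> cF; elim: r => [|i r IH] t.
  by under eq_fun do rewrite big_nil; exact: cvg_cst.
under eq_fun do rewrite big_cons.
by apply: cvgD; [exact: cF|exact: IH].
Qed.

Lemma continuous_mul F G : continuous F -> continuous G -> continuous (fun t => F t * G t).
Proof. by move=> cF cG t; apply: cvgM; [exact: cF|exact: cG]. Qed.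

Lemma continuous_const (c : R) : continuous ((fun=> c) : R -> R).
Proof. by move=> t; exact: cvg_cst. Qed.

Lemma continuous_pow F n : continuous F -> continuous (fun t => F t ^+ n).
Proof.
move=> cF; elim: n => [|n IH]; first exact: continuous_const.
under eq_fun do rewrite exprS; exact: continuous_mul.
Qed.

Lemma continuous_opp F : continuous F -> continuous (fun t => - F t).
Proof. by move=> cF t; apply: cvgN; exact: cF. Qed.

Lemma b_coef_continuous n kappa : continuous (b_coef n kappa : R -> R).
Proof.
have cid c : continuous (fun t : R => c * t).
  by apply: continuous_mul; [exact: continuous_const|move=> t; exact: cvg_id].
rewrite /b_coef; case: eqP => _; first exact: continuous_const.
apply: continuous_mul; last exact: continuous_const.
apply: continuous_mul; first exact: continuous_const.
apply: continuous_bigsum => k; apply: continuous_mul; first exact: continuous_const.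
apply: continuous_bigsum => j; apply: continuous_mul.
  apply: continuous_mul; first exact: continuous_const.
  move=> t; apply: (@continuous_comp _ _ _ (fun t : R => - (j%:R * t)) expR).
    exact: (continuous_opp (cid _)).
  exact: continuous_expR.
apply: continuous_bigsum => m; apply: continuous_mul; last exact: continuous_const.
apply: continuous_bigsum => i; apply: continuous_mul; first exact: continuous_const.
apply: continuous_mul; last exact: continuous_const.
by apply: continuous_pow; apply: continuous_opp; exact: cid.
Qed.

(** Averaging over k and n - k replaces the weight k by n / 2. *)
Lemma convolution_symmetrize n (b : nat -> R) : b 0%N = 1 -> (0 < n)%N ->
  n%:R * b n + 2 * (\sum_(1 <= k < n) k%:R * b k * b (n - k)%N) =
  n%:R * \sum_(1 <= k < n.+1) b k * b (n - k)%N.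
Proof.
move=> b0 n0; rewrite big_nat_recr //= subnn b0 mulr1 mulrDr addrC; congr (_ + _).
have e : \sum_(1 <= k < n) k%:R * b k * b (n - k)%N =
         \sum_(1 <= k < n) (n - k)%:R * b k * b (n - k)%N.
  rewrite [LHS]big_nat_rev /= !big_nat; apply: eq_bigr => k /andP[k0 ltkn].
  have -> : (1 + n - k.+1 = n - k)%N by lia.
  by rewrite subKn ?(ltnW ltkn) // mulrAC.
rewrite mulr2n mulrDl mul1r {2}e -big_split mulr_sumr /= !big_nat.
apply: eq_bigr => k /andP[_ ltkn]; rewrite natrB ?(ltnW ltkn) //; ring.
Qed.

End Continuity.

(** * The involution and the trace *)

Record star_laws (R : realType) (A : algType R[i]) (star : A -> A) : Prop := {
  starZD : forall (a : R[i]) x y, star (a *: x + y) = Num.conj a *: star x + star y;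
  starM : forall x y, star (x * y) = star y * star x;
  starK : forall x, star (star x) = x
}.

(** The representation is faithful and adjoints are unique in a Hilbert space,
   so that star inherits the laws of the adjoint. *)
Lemma von_neumann_star_laws (R : realType) (A : algType R[i]) (star : A -> A) :
  is_von_neumann_algebra star -> star_laws star.
Proof.
case=> H [ip [pi [_ [pi_inj _ piZD piM pi_adj] _]]].
have ip_sep (f g : H -> H) : (forall u v, ip u (f v) = ip u (g v)) -> f = g.
  move=> fg; apply/funext => v; apply/eqP; rewrite -subr_eq0.
  case: (eqVneq (f v - g v) 0) => // ne0; have := @neq0_dnorm_gt0 _ _ _ ip _ ne0.
  by rewrite linearBr /= fg subrr ltxx.
have symm u v : ip u v = Num.conj (ip v u) by rewrite hermC expr0 mul1r.
have adjr x u v : ip (pi (star x) u) v = ip u (pi x v).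
  by rewrite symm -pi_adj -symm.
split.
- move=> a x y; apply: pi_inj; apply: ip_sep => u v.
  rewrite -pi_adj !piZD linearDr linearZr_LR /= -!pi_adj linearDl linearZl_LR /=.
  by rewrite conjCK.
- by move=> x y; apply: pi_inj; apply: ip_sep => u v; rewrite -pi_adj !piM /= -!pi_adj.
- by move=> x; apply: pi_inj; apply: ip_sep => u v; rewrite -pi_adj adjr.
Qed.

Section Trace.
Variables (R : realType) (A : algType R[i]) (star : A -> A) (tau : {scalar A}).
Hypotheses (hstar : star_laws star) (htau : is_tracial_state star tau).

Lemma starD x y : star (x + y) = star x + star y.
Proof. by have := starZD hstar 1 x y; rewrite !scale1r conjC1 scale1r. Qed.

Lemma star0 : star 0 = 0.
Proof. by have /eqP := starD 0 0; rewrite addr0 -subr_eq0 opprD addNKr oppr_eq0 => /eqP. Qed.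

Lemma starZ a x : star (a *: x) = Num.conj a *: star x.
Proof. by have := starZD hstar a x 0; rewrite addr0 star0 addr0. Qed.

Lemma starN x : star (- x) = - star x.
Proof. by rewrite -scaleN1r starZ conjCN1 scaleN1r. Qed.

Lemma starB x y : star (x - y) = star x - star y.
Proof. by rewrite starD starN. Qed.

Lemma star1 : star 1 = 1.
Proof. by have := starM hstar (star 1) 1; rewrite mulr1 (starK hstar) mulr1. Qed.

Lemma starX x n : star (x ^+ n) = star x ^+ n.
Proof. by elim: n => [|n IH]; rewrite ?star1 // exprS (starM hstar) IH exprSr. Qed.

Lemma tau1 : tau 1 = 1. Proof. by case: htau. Qed.
Lemma tauC x y : tau (x * y) = tau (y * x). Proof. by case: htau. Qed.

(** Positivity at x + 1 and at x + i forces tau (star x) + tau x and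
   i (tau (star x) - tau x) to be real. *)
Lemma tau_star x : tau (star x) = Num.conj (tau x).
Proof.
have pos y : 0 <= tau (star y * y) by case: htau.
have := pos (x + 1); have := pos (x + 'i%C *: 1).
rewrite !starD starZ star1 !mulrDl !mulrDr !mul1r !mulr1.
rewrite -!scalerAl -!scalerAr !mul1r !mulr1 !raddfD /= !linearZ /= tau1.
have /ger0_Im := pos x.
case: (tau (star x * x)) => a b /= ->; case: (tau x) (tau (star x)) => [c d] [e f] h1 h2.
have {h1} /= := ger0_Im h1; have {h2} /= := ger0_Im h2.
move=> h1 h2; have -> : e = c by lra.
by have -> : f = - d by lra.
Qed.
End Trace.

(** * Freeness *)

Section GeneratedAlgebra.
Variables (R : realType) (A : algType R[i]) (star : A -> A).
Implicit Types G M : set A.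

Lemma gen_subset G : G `<=` star_algebra_gen star G.
Proof. by move=> x Gx M [_]; apply. Qed.

Lemma gen_min G M : star_subalgebra star M -> G `<=` M -> star_algebra_gen star G `<=` M.
Proof. by move=> hM GM x; apply. Qed.

Lemma gen_subalgebra G : star_subalgebra star (star_algebra_gen star G).
Proof.
split.
- by move=> M [[]].
- by move=> a x y hx hy M hM; have [[_ h _ _] _] := hM; apply: h; [exact: hx|exact: hy].
- by move=> x y hx hy M hM; have [[_ _ h _] _] := hM; apply: h; [exact: hx|exact: hy].
- by move=> x hx M hM; have [[_ _ _ h] _] := hM; apply: h; exact: hx.
Qed.

Lemma gen1 G : star_algebra_gen star G 1.
Proof. by case: (gen_subalgebra G). Qed.

Lemma genM G x y : star_algebra_gen star G x -> star_algebra_gen star G y ->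
  star_algebra_gen star G (x * y).
Proof. by case: (gen_subalgebra G) => _ _ h _; apply: h. Qed.

Lemma gen_star G x : star_algebra_gen star G x -> star_algebra_gen star G (star x).
Proof. by case: (gen_subalgebra G) => _ _ _ h; apply: h. Qed.

Lemma genD G x y : star_algebra_gen star G x -> star_algebra_gen star G y ->
  star_algebra_gen star G (x + y).
Proof.
by case: (gen_subalgebra G) => _ h _ _ hx hy; have := h 1 _ _ hx hy; rewrite scale1r.
Qed.

Lemma genZ G a x : star_algebra_gen star G x -> star_algebra_gen star G (a *: x).
Proof.
case: (gen_subalgebra G) => h1 h _ _ hx.
have := h (a - 1) _ _ hx hx; rewrite scalerBl scale1r subrK; apply.
Qed.

Lemma genC G a : star_algebra_gen star G a%:A.
Proof. by apply: genZ; exact: gen1. Qed.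

Lemma genB G x y : star_algebra_gen star G x -> star_algebra_gen star G y ->
  star_algebra_gen star G (x - y).
Proof. by move=> hx hy; apply: genD => //; rewrite -scaleN1r; exact: genZ. Qed.

End GeneratedAlgebra.

Section Alternating.
Variables (R : realType) (A : algType R[i]) (tau : {scalar A}).

(** The index is the subalgebra of the first factor, None for the empty word; it
   decides by which factors the word can be extended on the left. *)
Inductive alt (I : Type) (B : I -> set A) : option I -> A -> Prop :=
| alt_nil : alt B None 1
| alt_cons i o x w : B i x -> tau x = 0 -> alt B o w -> o <> Some i ->
    alt B (Some i) (x * w).

Lemma alt_product (I : Type) (B : I -> set A) o w : alt B o w ->
  if o is Some j then
    exists n (i : nat -> I) (a : nat -> A),
    [/\ i 0%N = j, w = \prod_(k < n.+1) a k,
        forall k, (k < n.+1)%N -> B (i k) (a k) /\ tau (a k) = 0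
      & forall k, (k.+1 < n.+1)%N -> i k <> i k.+1]
  else w = 1.
Proof.
elim=> // i {}o x {}w Bx x0 _ IH oi; case: o oi IH => [j|] oi.
  case=> n [i' [a [i'0 -> h1 h2]]].
  exists n.+1, (fun k => if k is k'.+1 then i' k' else i), (fun k => if k is k'.+1 then a k' else x).
  split=> //; first by rewrite [RHS]big_ord_recl.
  - by case=> [|k] // ltk; apply: h1.
  - case=> [_ e|k ltk]; last exact: h2.
    by apply: oi; rewrite e i'0.
move=> ->; exists 0%N, (fun=> i), (fun=> x); split=> //.
by rewrite big_ord_recl big_ord0.
Qed.

Lemma alt_free (I : Type) (B : I -> set A) i w :
  free_family tau B -> alt B (Some i) w -> tau w = 0.
Proof.
move=> hf /alt_product [n [i' [a [_ -> h1 h2]]]].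
exact: (hf n.+1 i' a).
Qed.

(** The type of w does not show the index of its last factor, which must differ
   from that of the first factor of w'; so Q is imposed on all indices of w. *)
Lemma alt_cat (I : Type) (B : I -> set A) (Q : I -> Prop) i w o w' :
  alt (fun j x => Q j /\ B j x) (Some i) w -> alt B o w' ->
  (if o is Some j then ~ Q j else True) -> alt B (Some i) (w * w').
Proof.
move=> aw aw' Qo.
suff H o1 w1 : alt (fun j x => Q j /\ B j x) o1 w1 ->
    alt B (if o1 is Some j then Some j else o) (w1 * w').
  exact: (H _ _ aw).
elim=> [|j o2 x {}w1 [Qj Bx] x0 _ IH o2j]; first by rewrite mul1r.
rewrite -mulrA; apply: alt_cons Bx x0 IH _.
case: o2 o2j => // _; case: o Qo {aw'} => // k nQ [e].
by apply: nQ; rewrite e.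
Qed.

End Alternating.

Section Associativity.
Variables (R : realType) (A : algType R[i]) (star : A -> A) (tau : {scalar A}).
Hypothesis tau_unit : tau 1 = 1.
Hypothesis tau_tracial : forall x y, tau (x * y) = tau (y * x).
Variables GP GY GV GD : set A.
Let gen := star_algebra_gen star.
Let BYV (b : bool) : set A := gen (if b then GV else GY).
Hypothesis YD : gen GY `<=` gen GD.
Hypothesis VD : gen GV `<=` gen GD.
Hypothesis free_DP : free_sets star tau GD GP.
Hypothesis free_YV : forall b w, alt tau BYV (Some b) w -> tau w = 0.

Let B2 (b : bool) : set A := gen (if b then GD else GP).
Let B3 (l : option bool) : set A := if l is Some b then BYV b else gen GP.

(** Associativity of freeness: when the algebra of GD is free from that of GP
   and contains the mutually free algebras of GY and GV, the three are free.
   In an alternating word of the three, a maximal run d of factors from GY and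
   GV is centred by the freeness of these two, and it is a single factor from
   GD; so the word alternates between GD and GP.  The indices are None for GP,
   Some false for GY and Some true for GV. *)
Lemma alt_merge o w : alt tau B3 o w ->
  match o with
  | None => w = 1
  | Some None => alt tau B2 (Some false) w
  | Some (Some b) => exists d w' q2, [/\ w = d * w', alt tau BYV (Some b) d,
      gen GD d, alt tau B2 q2 w' & q2 <> Some true]
  end.
Proof.
have BD b x : BYV b x -> gen GD x by case: b => [/VD|/YD].
elim=> // i {}o x {}w Bx x0 _ IH oi.
case: i Bx oi => [b|] Bx oi.
  case: o oi IH => [[b2|] |] oi.
  - case=> d [w' [q2 [-> ad Dd aw' q21]]].
    exists (x * d), w', q2; split=> //; first by rewrite mulrA.
      by apply: alt_cons ad _ => // -[e]; apply: oi; rewrite e.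
    by apply: genM => //; exact: BD Bx.
  - move=> aw; exists x, w, (Some false); split=> //; last exact: BD Bx.
    by rewrite -[x]mulr1; apply: alt_cons (alt_nil _ _) _.
  - move=> ->; exists x, 1, None; split=> //; [|exact: BD Bx|exact: alt_nil].
    by rewrite -[x]mulr1; apply: alt_cons (alt_nil _ _) _.
case: o oi IH => [[b2|] |] oi //.
  case=> d [w' [ q2 [-> ad Dd aw' q21]]].
  have adw : alt tau B2 (Some true) (d * w').
    by apply: alt_cons aw' q21 => //; exact: free_YV ad.
  by apply: alt_cons adw _.
by move=> ->; apply: alt_cons (alt_nil _ _) _.
Qed.

Lemma alt3_tau0 l w : alt tau B3 (Some l) w -> tau w = 0.
Proof.
move/alt_merge; case: l => [b|]; last exact: alt_free.
case=> d [w' [q2 [-> ad Dd aw' q21]]].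
have adw : alt tau B2 (Some true) (d * w').
  by apply: alt_cons aw' q21 => //; exact: free_YV ad.
exact: (alt_free free_DP adw).
Qed.

Definition notV (l : option bool) := l <> Some true.
Let B3' (l : option bool) : set A := fun x => notV l /\ B3 l x.

(** The centred elements of the algebra generated by GP and GY, in a form that
   can be concatenated with centred elements of the algebra of GV. *)
Inductive cspan : A -> Prop :=
| cspan0 : cspan 0
| cspanP c l w x : alt tau B3' (Some l) w -> cspan x -> cspan (c *: w + x).

Lemma cspanD x y : cspan x -> cspan y -> cspan (x + y).
Proof.
move=> hx hy; elim: hx => [|c l w {}x aw _ IH]; first by rewrite add0r.
by rewrite -addrA; apply: cspanP aw IH.
Qed.

Lemma cspanZ a x : cspan x -> cspan (a *: x).
Proof.
elim=> [|c l w {}x aw _ IH]; first by rewrite scaler0; exact: cspan0.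
by rewrite scalerDr scalerA; apply: cspanP aw IH.
Qed.

Lemma cspan_word l w : alt tau B3' (Some l) w -> cspan w.
Proof. by move=> aw; rewrite -[w]scale1r -[_ *: w]addr0; apply: cspanP aw cspan0. Qed.

Lemma alt_weaken o w : alt tau B3' o w -> alt tau B3 o w.
Proof.
elim=> [|i {}o x {}w [_ Bx] x0 _ IH oi]; first exact: alt_nil.
exact: alt_cons Bx x0 IH oi.
Qed.

Lemma cspan_tau x : cspan x -> tau x = 0.
Proof.
elim=> [|c l w {}x aw _ IH]; first by rewrite raddf0.
by rewrite linearP /= IH (alt3_tau0 (alt_weaken aw)) mulr0 addr0.
Qed.

(** The algebra generated by GP and GY, described by its centred part.  This
   form makes freeness from GV a statement on words. *)
Definition inPY x := exists c x0, x = c%:A + x0 /\ cspan x0.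

Lemma inPY_tau x : inPY x -> cspan (x - (tau x)%:A).
Proof.
case=> c [x0 [-> sx]].
by rewrite linearP /= tau_unit (cspan_tau sx) mulr1 addr0 addrAC subrr add0r.
Qed.

Lemma inPY1 : inPY 1.
Proof. by exists 1, 0; rewrite scale1r addr0; split=> //; exact: cspan0. Qed.

Lemma inPYD x y : inPY x -> inPY y -> inPY (x + y).
Proof.
move=> [c [x0 [-> sx]]] [d [y0 [-> sy]]]; exists (c + d), (x0 + y0).
by split; [rewrite scalerDl addrACA|exact: cspanD].
Qed.

Lemma inPYZ a x : inPY x -> inPY (a *: x).
Proof.
move=> [c [x0 [-> sx]]]; exists (a * c), (a *: x0).
by split; [rewrite scalerDr scalerA|exact: cspanZ].
Qed.

Lemma inPY_word o w : alt tau B3' o w -> inPY w.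
Proof.
case: o => [l|] aw; last by rewrite (alt_product aw); exact: inPY1.
by exists 0, w; rewrite scale0r add0r; split=> //; exact: cspan_word aw.
Qed.

(** Multiplying a word by a factor of the same subalgebra as its first one, and
   centring the product, gives an alternating word plus a scalar multiple of a
   shorter one; this is how every product of generators is reached. *)
Lemma inPY_mul l g x : notV l -> B3 l g -> inPY x -> inPY (g * x).
Proof.
have B3C a l' : B3 l' a%:A by case: l' => [[]|]; exact: genC.
have B3B l' y z : B3 l' y -> B3 l' z -> B3 l' (y - z) by case: l' => [[]|]; exact: genB.
have B3M l' y z : B3 l' y -> B3 l' z -> B3 l' (y * z) by case: l' => [[]|]; exact: genM.
have cons y o w : notV l -> B3 l y -> alt tau B3' o w -> o <> Some l -> inPY (y * w).
  move=> nl By aw ol; rewrite -[y](subrK (tau y)%:A) mulrDl mulr_algl.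
  apply: inPYD; last by apply: inPYZ; exact: inPY_word aw.
  apply: (@inPY_word (Some l)); apply: alt_cons aw ol.
    by split=> //; apply: B3B.
  by rewrite linearB linearZ /= tau_unit mulr1 subrr.
move=> nl Bg [c [x0 [-> sx]]]; rewrite mulrDr; apply: inPYD.
  by rewrite mulr_algr; apply: inPYZ; rewrite -[g]mulr1; apply: cons (alt_nil _ _) _.
elim: sx => [|d l' w {}x aw _ IH]; first by rewrite mulr0 -[0](scale0r 1); apply: inPYZ; exact: inPY1.
rewrite mulrDr -scalerAr; apply: inPYD => //; apply: inPYZ.
have [e|ne] := pselect (Some l' = Some l); last exact: cons aw ne.
move: aw; rewrite e; move E : (Some l) => o aw.
case: aw E => // i q2 y w' [_ By] y0 aw' q2i [li].
rewrite mulrA; apply: cons aw' _ => //; last by rewrite li.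
by apply: B3M => //; rewrite li.
Qed.

Lemma inPY_free1 x a : inPY x -> gen GV a -> tau (x * a) = tau x * tau a.
Proof.
move=> hx Va; have sx := inPY_tau hx.
have key x0 a0 : cspan x0 -> gen GV a0 -> tau a0 = 0 -> tau (x0 * a0) = 0.
  move=> s Va0 a00; elim: s => [|c l w y aw _ IH]; first by rewrite mul0r raddf0.
  rewrite mulrDl -scalerAl linearP /= IH addr0 -[a0]mulr1.
  rewrite (@alt3_tau0 l) ?mulr0 //; apply: (@alt_cat _ _ _ _ B3 notV _ _ (Some (Some true))) aw _ _.
    by apply: alt_cons (alt_nil _ _) _.
  by move=> h; apply: h.
rewrite -{1}[x](subrK (tau x)%:A) mulrDl linearD /= -[X in tau (_ * X) + _](subrK (tau a)%:A).
rewrite mulrDr linearD /= key //; first last.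
- by rewrite linearB linearZ /= tau_unit mulr1 subrr.
- by apply: genB => //; exact: genC.
rewrite mulr_algr mulr_algl [tau (tau a *: _)]linearZ /= (cspan_tau sx) mulr0 [tau (tau x *: _)]linearZ.
by rewrite !add0r.
Qed.

(** With all four elements centred, x a y b is a combination of alternating words
   and has trace 0; expanding x = (x - tau x) + tau x and the like gives the
   formula, the moment formula of two free algebras. *)
Lemma inPY_free2 x y a b : inPY x -> inPY y -> inPY (x * y) -> inPY (y * x) ->
  gen GV a -> gen GV b ->
  tau (x * a * y * b) = tau x * tau y * tau (a * b) + tau (x * y) * tau a * tau b
                        - tau x * tau y * tau a * tau b.
Proof.
move=> hx hy hxy hyx Va Vb; have sx := inPY_tau hx; have sy := inPY_tau hy.
have key x0 y0 a0 b0 : cspan x0 -> cspan y0 -> gen GV a0 -> tau a0 = 0 ->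
    gen GV b0 -> tau b0 = 0 -> tau (x0 * a0 * y0 * b0) = 0.
  move=> s s' Va0 a00 Vb0 b00.
  elim: s => [|c l w z aw _ IH]; first by rewrite !mul0r raddf0.
  rewrite !mulrDl -!scalerAl linearP /= {}IH addr0.
  elim: s' => [|c' l' w' z' aw' _ IH]; first by rewrite mulr0 mul0r raddf0 mulr0.
  rewrite mulrDr mulrDl linearD /= mulrDr {}IH addr0 -scalerAr -scalerAl linearZ /=.
  rewrite (@alt3_tau0 l) ?mulr0 // -!mulrA -[b0]mulr1.
  have nV : ~ notV (Some true) by move=> h; apply: h.
  apply: (@alt_cat _ _ _ _ B3 notV _ _ (Some (Some true))) aw _ _ => //.
  apply: (@alt_cons _ _ _ _ _ _ (Some l')) => //.
    apply: (@alt_cat _ _ _ _ B3 notV _ _ (Some (Some true))) aw' _ _ => //.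
    by apply: alt_cons (alt_nil _ _) _.
  by case: aw' => // i o z2 w2 [h _] _ _ _ [].
have V0 c : gen GV c -> gen GV (c - (tau c)%:A) by move=> h; apply: genB => //; exact: genC.
have c0 c : tau (c - (tau c)%:A) = 0 by rewrite linearB linearZ /= tau_unit mulr1 subrr.
set a0 := a - (tau a)%:A; set b0 := b - (tau b)%:A.
set x0 := x - (tau x)%:A; set y0 := y - (tau y)%:A.
have Va0 : gen GV a0 := V0 _ Va; have Vb0 : gen GV b0 := V0 _ Vb.
have center p c q : tau (p * c * q) = tau (p * (c - (tau c)%:A) * q) + tau c * tau (p * q).
  by rewrite mulrBr mulr_algr mulrBl -scalerAl linearB linearZ /= subrK.
have centerl c q : tau (c * q) = tau ((c - (tau c)%:A) * q) + tau c * tau q.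
  by rewrite -[c]mul1r center !mul1r.
have centerr p c : tau (p * c) = tau (p * (c - (tau c)%:A)) + tau c * tau p.
  by rewrite -[p * c]mulr1 center !mulr1.
have hx0 : inPY x0 by exists 0, x0; rewrite scale0r add0r.
have e1 : tau (x * a0 * y * b0) = tau x * tau y * tau (a0 * b0).
  have E1 : tau (x * a0 * y * b0) = tau (x0 * a0 * y * b0) + tau x * tau (a0 * y * b0).
    by rewrite -!mulrA centerl.
  have E2 : tau (x0 * a0 * y * b0) = tau (x0 * a0 * y0 * b0) + tau y * tau (x0 * a0 * b0).
    by rewrite center.
  have E3 : tau (x0 * a0 * b0) = 0.
    by rewrite -mulrA (inPY_free1 hx0 (genM Va0 Vb0)) (cspan_tau sx) mul0r.
  have E4 : tau (a0 * y * b0) = tau y * tau (a0 * b0).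
    by rewrite -mulrA tau_tracial -mulrA (inPY_free1 hy (genM Vb0 Va0)) (tau_tracial b0).
  have E5 : tau (x0 * a0 * y0 * b0) = 0 by apply: key => //; exact: c0.
  by rewrite E1 E2 E5 E3 E4; ring.
have e2 : tau (a0 * b0) = tau (a * b) - tau a * tau b.
  have ta0 : tau a0 = 0 := c0 a.
  by rewrite (centerl a b) -/a0 (centerr a0 b) -/b0 ta0; ring.
have E1 : tau (x * a * y * b) = tau (x * a0 * y * b) + tau a * tau (x * y * b).
  by rewrite -!mulrA mulrA center !mulrA.
have E2 : tau (x * a0 * y * b) = tau (x * a0 * y * b0) + tau b * tau (x * a0 * y).
  by rewrite centerr.
have E3 : tau (x * a0 * y) = 0.
  by rewrite tau_tracial mulrA (inPY_free1 hyx Va0) (c0 a) mulr0.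
have E4 : tau (x * y * b) = tau (x * y) * tau b by rewrite inPY_free1.
by rewrite E1 E2 E3 E4 e1 e2; ring.
Qed.
End Associativity.

(** * The trace of a conjugated reflection after a small increment *)

Section TracialNorm.
Variables (R : realType) (A : algType R[i]) (star : A -> A) (tau : {scalar A}).
Hypotheses (hstar : star_laws star) (htau : is_tracial_state star tau).
Implicit Types x y u : A.

Lemma tau_add x y : tau (x + y) = tau x + tau y. Proof. exact: linearD. Qed.
Lemma tau_sub x y : tau (x - y) = tau x - tau y. Proof. exact: linearB. Qed.
Lemma tau_scale a x : tau (a *: x) = a * tau x. Proof. exact: linearZ. Qed.
Lemma tau_alg a : tau a%:A = a. Proof. by rewrite tau_scale (tau1 htau) mulr1. Qed.

Definition retr x : R := complex.Re (tau x).
Definition sqnorm x : R := retr (star x * x).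

Lemma retrD x y : retr (x + y) = retr x + retr y.
Proof. by rewrite /retr linearD /=; case: (tau x) (tau y) => [? ?] [? ?]. Qed.
Lemma retrN x : retr (- x) = - retr x.
Proof. by rewrite /retr linearN /=; case: (tau x). Qed.
Lemma retrB x y : retr (x - y) = retr x - retr y.
Proof. by rewrite retrD retrN. Qed.
Lemma retr0 : retr 0 = 0.
Proof. by rewrite /retr raddf0. Qed.
Lemma retr_sum (I : Type) (r : seq I) (F : I -> A) :
  retr (\sum_(i <- r) F i) = \sum_(i <- r) retr (F i).
Proof. by elim/big_rec2: _ => [|i x y _ <-]; rewrite ?retr0 ?retrD. Qed.
Lemma retrZ (c : R) x : retr (c%:C *: x) = c * retr x.
Proof. by rewrite /retr linearZ /=; case: (tau x) => a b /=; rewrite mul0r subr0. Qed.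
Lemma retrC x y : retr (x * y) = retr (y * x).
Proof. by rewrite /retr (tauC htau). Qed.
Lemma retr_star x : retr (star x) = retr x.
Proof. by rewrite /retr (tau_star hstar htau); case: (tau x). Qed.

Lemma sqnorm_ge0 x : 0 <= sqnorm x.
Proof.
have [_ pos _] := htau; have := pos x; rewrite /sqnorm /retr.
by rewrite lecE /= => /andP[].
Qed.

Lemma sqnorm_star x : sqnorm (star x) = sqnorm x.
Proof. by rewrite /sqnorm (starK hstar) retrC. Qed.

Lemma sqnorm_unitl u x : star u * u = 1 -> sqnorm (u * x) = sqnorm x.
Proof.
move=> uu; rewrite /sqnorm (starM hstar) -mulrA [star u * _]mulrA uu mul1r.
by [].
Qed.

Lemma sqnorm_unitr u x : u * star u = 1 -> sqnorm (x * u) = sqnorm x.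
Proof.
move=> uu; rewrite /sqnorm (starM hstar) -mulrA retrC -mulrA -mulrA uu mulr1.
by [].
Qed.

Lemma sqnormZ (c : R) x : sqnorm (c%:C *: x) = c ^+ 2 * sqnorm x.
Proof.
rewrite /sqnorm (starZ hstar) -scalerAl -scalerAr.
have -> : Num.conj (c%:C : R[i]) = c%:C by rewrite /Num.conj /= oppr0.
by rewrite !retrZ; ring.
Qed.

Lemma sqnormN x : sqnorm (- x) = sqnorm x.
Proof. by rewrite /sqnorm (starN hstar) mulrNN. Qed.

Lemma sqnormDE x y : sqnorm (x + y) = sqnorm x + sqnorm y + 2 * retr (star x * y).
Proof.
rewrite /sqnorm (starD hstar) mulrDl !mulrDr !retrD.
have -> : retr (star y * x) = retr (star x * y).
  by rewrite -retr_star (starM hstar) (starK hstar).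
ring.
Qed.

Lemma sqnormD x y : sqnorm (x + y) <= 2 * sqnorm x + 2 * sqnorm y.
Proof.
have := sqnorm_ge0 (x - y); rewrite !sqnormDE sqnormN mulrN retrN.
by move=> h; lra.
Qed.

Lemma sqnormB x y : sqnorm (x - y) <= 2 * sqnorm x + 2 * sqnorm y.
Proof. by rewrite -(sqnormN y); exact: sqnormD. Qed.

(** The Cauchy-Schwarz inequality in additive form, which avoids square roots:
   the weight c balances two factors of different sizes. *)
Lemma retr_bound (c : R) x y : 0 < c ->
  `|retr (x * y)| <= (sqnorm x / c + c * sqnorm y) / 2.
Proof.
move=> c0; have h1 := sqnorm_ge0 (star x + c%:C *: y).
have h2 := sqnorm_ge0 (star x + (- c)%:C *: y).
rewrite !sqnormDE !sqnormZ sqnorm_star (starK hstar) -!scalerAr !retrZ in h1 h2.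
have cc : c^-1 * c = 1 by rewrite mulVf // gt_eqF.
have ci : 0 < c^-1 by rewrite invr_gt0.
rewrite ler_norml; apply/andP; split; rewrite -subr_ge0.
  have -> : retr (x * y) - - ((sqnorm x / c + c * sqnorm y) / 2) =
    c^-1 * (sqnorm x + c ^+ 2 * sqnorm y + 2 * (c * retr (x * y))) / 2 by field; rewrite gt_eqF.
  by rewrite divr_ge0 // mulr_ge0 // ltW.
have -> : (sqnorm x / c + c * sqnorm y) / 2 - retr (x * y) =
    c^-1 * (sqnorm x + (- c) ^+ 2 * sqnorm y + 2 * (- c * retr (x * y))) / 2 by field; rewrite gt_eqF.
by rewrite divr_ge0 // mulr_ge0 // ltW.
Qed.

Lemma sqnorm_unitary u : star u * u = 1 -> sqnorm u = 1.
Proof. by move=> uu; rewrite /sqnorm uu /retr (tau1 htau). Qed.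

Lemma retr_unitary u : star u * u = 1 -> `|retr u| <= 1.
Proof.
move=> uu; rewrite -[u]mulr1; apply: le_trans (@retr_bound 1 u 1 ltr01) _.
rewrite sqnorm_unitary // sqnorm_unitary ?(star1 hstar) ?mulr1 //; lra.
Qed.

(** The bound |tau u|^2 <= 1 is the positivity of the variance of u. *)
Lemma tau_unitary_sqr u : star u * u = 1 ->
  exists2 w : R, tau (star u) * tau u = w%:C & 0 <= w <= 1.
Proof.
move=> uu; rewrite (tau_star hstar htau).
have [a b] : exists a b : R, tau u = a +i* b by case: (tau u) => a b; exists a, b.
case: b => b' tu; exists (a ^+ 2 + b' ^+ 2).
  rewrite tu /Num.conj /=; apply/eqP; rewrite eq_complex /=; apply/andP; split; apply/eqP; ring.
rewrite addr_ge0 ?sqr_ge0 //=.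
have := sqnorm_ge0 (u - (a +i* b')%:A); rewrite sqnormDE sqnormN sqnorm_unitary //.
rewrite /sqnorm (starZ hstar) (star1 hstar) mulrN retrN -scalerAl -!scalerAr !mulr1 ?mul1r.
rewrite /retr !linearZ /= (tau1 htau) (tau_star hstar htau) tu /=; lra.
Qed.

Lemma tau_expX_comm x y p : tau ((x * y) ^+ p) = tau ((y * x) ^+ p).
Proof.
case: p => [|p]; first by rewrite !expr0.
have -> : (x * y) ^+ p.+1 = x * ((y * x) ^+ p * y).
  elim: p => [|p IH]; first by rewrite !expr1 expr0 mul1r.
  by rewrite exprS IH [in RHS]exprS !mulrA.
by rewrite (tauC htau) -mulrA -exprSr.
Qed.

End TracialNorm.

Inductive isword (R : realType) (A : algType R[i]) (S B : A) : A -> Prop :=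
| word1 : isword S B 1
| wordS w : isword S B w -> isword S B (S * w)
| wordB w : isword S B w -> isword S B (B * w).

Section Words.
Variables (R : realType) (A : algType R[i]) (star : A -> A) (tau : {scalar A}).
Hypotheses (hstar : star_laws star) (htau : is_tracial_state star tau).
Variables (S B : A) (kappa : R).
Hypotheses (SS : S * S = 1) (BB : B * B = 1) (Sstar : star S = S) (Bstar : star B = B).
Hypotheses (tauS : tau S = kappa%:C) (tauB : tau B = kappa%:C).

Lemma wordM x y : isword S B x -> isword S B y -> isword S B (x * y).
Proof.
by move=> hx hy; elim: hx => [|w _ IH|w _ IH]; rewrite ?mul1r -?mulrA //; constructor.
Qed.

Lemma word_S : isword S B S. Proof. by rewrite -[S in isword _ _ S]mulr1; do 2 constructor. Qed.
Lemma word_B : isword S B B. Proof. by rewrite -[B in isword _ _ B]mulr1; do 2 constructor. Qed.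

Lemma word_X p : isword S B ((S * B) ^+ p).
Proof.
elim: p => [|p IH]; first by rewrite expr0; constructor.
by rewrite exprS -mulrA; do 2 constructor.
Qed.

Lemma word_star x : isword S B x -> isword S B (star x).
Proof.
elim=> [|w _ IH|w _ IH]; first by rewrite (star1 hstar); constructor.
  by rewrite (starM hstar) Sstar; apply: wordM => //; exact: word_S.
by rewrite (starM hstar) Bstar; apply: wordM => //; exact: word_B.
Qed.

Lemma word_unitary x : isword S B x -> star x * x = 1 /\ x * star x = 1.
Proof.
elim=> [|w _ [IH1 IH2]|w _ [IH1 IH2]]; first by rewrite (star1 hstar) mulr1.
  rewrite (starM hstar) Sstar; split; first by rewrite -mulrA [S * (S * w)]mulrA SS mul1r.
  by rewrite -mulrA [w * _]mulrA IH2 mul1r SS.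
rewrite (starM hstar) Bstar; split; first by rewrite -mulrA [B * (B * w)]mulrA BB mul1r.
by rewrite -mulrA [w * _]mulrA IH2 mul1r BB.
Qed.

Definition umom p : R := retr tau ((S * B) ^+ p).

(** The trace is real because the adjoint (B S)^p is cyclically equal to
   (S B)^p. *)
Lemma tau_umom p : tau ((S * B) ^+ p) = (umom p)%:C.
Proof.
have : tau ((S * B) ^+ p) = Num.conj (tau ((S * B) ^+ p)).
  rewrite -(tau_star hstar htau) (starX hstar) (starM hstar) Sstar Bstar.
  exact: (tau_expX_comm htau).
rewrite /umom /retr; case: (tau _) => a b /(congr1 (@complex.Im R)) /= e.
have -> : b = 0 by lra.
by [].
Qed.

(** A word of odd length reduces cyclically to a single reflection. *)
Lemma tau_odd p : tau ((S * B) ^+ p * S) = kappa%:C /\ tau (B * (S * B) ^+ p) = kappa%:C.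
Proof.
elim: p => [|p [IH1 IH2]]; first by rewrite expr0 mul1r mulr1.
split; first by rewrite exprS (tauC htau) !mulrA SS mul1r.
by rewrite exprSr (tauC htau) -!mulrA BB mulr1.
Qed.

End Words.

(** The reflections S and B stand for the symmetry and its conjugate at time t,
   V for the increment over a time h = r^2, with e = tau V close to 1 - h / 2, and
   X = S V B V' for the product at time t + h.  Remainders are measured in powers
   of r, since V - e has size r in the norm of sqnorm. *)
Section Increment.
Variables (R : realType) (A : algType R[i]) (star : A -> A) (tau : {scalar A}).
Hypotheses (hstar : star_laws star) (htau : is_tracial_state star tau).
Variables (S B : A) (kappa : R).
Hypotheses (SS : S * S = 1) (BB : B * B = 1) (Sstar : star S = S) (Bstar : star B = B).
Hypotheses (tauS : tau S = kappa%:C) (tauB : tau B = kappa%:C).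
Variables (V : A) (e r : R).
Let h := r ^+ 2.
Hypotheses (r_gt0 : 0 < r) (r_le1 : r <= 1) (e_gt0 : 0 < e).
Hypotheses (e_lower : 1 - h <= e ^+ 2) (e_upper : e ^+ 2 <= 1 - h + h ^+ 2).
Hypotheses (VV : star V * V = 1) (VV' : V * star V = 1).
Hypotheses (tauV : tau V = e%:C) (tauV2 : tau (V * V) = (e ^+ 2 * (1 - h))%:C).
Let DV := star_algebra_gen star [set V].
Hypothesis free2 : forall x y a b, isword S B x -> isword S B y -> DV a -> DV b ->
  tau (x * a * y * b) = tau x * tau y * tau (a * b) + tau (x * y) * tau a * tau b
                        - tau x * tau y * tau a * tau b.

Notation N := (sqnorm star tau).
Notation T := (retr tau).
Notation u := (umom tau S B).

Let v : A := V - e%:C%:A.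
Let vs : A := star V - e%:C%:A.
Let d : A := vs * v.

Fact h_ge0 : 0 <= h. Proof. exact: sqr_ge0. Qed.
Fact h_le1 : h <= 1. Proof. by rewrite /h expr_le1 // ltW. Qed.
Fact e_le1 : e ^+ 2 <= 1.
Proof.
apply: le_trans e_upper _; have := h_ge0; have := h_le1 => h1 h2.
have : h ^+ 2 <= h by rewrite expr2 ler_piMl.
lra.
Qed.

Fact conj_real (c : R) : Num.conj (c%:C : R[i]) = c%:C.
Proof. by rewrite /Num.conj /= oppr0. Qed.

Fact vstar : star v = vs.
Proof. by rewrite /v /vs (starB hstar) (starZ hstar) (star1 hstar) conj_real. Qed.
Fact vsstar : star vs = v.
Proof. by rewrite -vstar (starK hstar). Qed.

Fact vvs : v * vs = d.
Proof.
rewrite /d /v /vs !mulrBr !mulrBl VV VV' !mulr_algl !mulr_algr !opprB.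
by rewrite addrACA [RHS]addrACA; congr (_ + _); rewrite addrC.
Qed.

Fact DV_V : DV V. Proof. exact: gen_subset. Qed.
Fact DV_Vs : DV (star V). Proof. exact: gen_star DV_V. Qed.
Fact DV_v : DV v. Proof. by apply: genB; [exact: DV_V|exact: genC]. Qed.
Fact DV_vs : DV vs. Proof. by apply: genB; [exact: DV_Vs|exact: genC]. Qed.
Fact DV_d : DV d. Proof. exact: genM DV_vs DV_v. Qed.

Fact dE : d = (1 + e ^+ 2)%:C%:A - e%:C *: (V + star V).
Proof.
rewrite /d /v /vs !mulrBr !mulrBl VV mulr_algr mulr_algl -scalerAl mul1r scalerA.
rewrite rmorphD rmorph1 scalerDl scale1r rmorphXn expr2 scalerDr !opprB.
by rewrite opprD -!addrA; congr (_ + _); rewrite addrCA.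
Qed.

Fact tauVs : tau (star V) = e%:C.
Proof. by rewrite (tau_star hstar htau) tauV conj_real. Qed.

Fact tauv : tau v = 0.
Proof. by rewrite tau_sub (tau_alg htau) tauV subrr. Qed.

Fact tau_d : tau d = (1 - e ^+ 2)%:C.
Proof.
rewrite dE tau_sub (tau_alg htau) tau_scale tau_add tauV tauVs.
by apply/eqP; rewrite eq_complex /=; apply/andP; split; apply/eqP; ring.
Qed.

Fact tau_vv : tau (v * v) = (- (h * e ^+ 2))%:C.
Proof.
rewrite /v mulrBr mulr_algr mulrBl mulr_algl !tau_sub !tau_scale !tau_sub (tau_alg htau) tauV tauV2.
by apply/eqP; rewrite eq_complex /=; apply/andP; split; apply/eqP; ring.
Qed.

Fact tau_dd : tau (d * d) = (1 - e ^+ 4 - 2 * h * e ^+ 4)%:C.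
Proof.
have tauVs2 : tau (star V * star V) = (e ^+ 2 * (1 - h))%:C.
  by rewrite -(starM hstar) (tau_star hstar htau) tauV2 conj_real.
have tsq : tau ((V + star V) * (V + star V)) = (2 * (e ^+ 2 * (1 - h)) + 2)%:C.
  rewrite mulrDl !mulrDr VV VV' !tau_add tauV2 tauVs2 (tau1 htau).
  by apply/eqP; rewrite eq_complex /=; apply/andP; split; apply/eqP; ring.
set c := (X in _ = X).
rewrite dE mulrBr mulr_algr mulrBl -!scalerAr -!scalerAl !mul1r.
rewrite !tau_sub !tau_scale !tau_sub !tau_scale (tau1 htau) tsq tau_add tauV tauVs /c.
by apply/eqP; rewrite eq_complex /=; apply/andP; split; apply/eqP; ring.
Qed.

(** The centred increment v is small in L2 norm only, so v x v could be as large
   as v itself.  Freeness computes the square norm as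
     tau d ^ 2 + |tau x| ^ 2 (tau (d ^ 2) - tau d ^ 2),    d = v' v,
   and both tau d ^ 2 and tau (d ^ 2) are of order h^2. *)
Lemma sandwich x w1 w2 : isword S B x -> star w1 * w1 = d -> w2 * star w2 = d ->
  N (w1 * x * w2) <= 5 * h ^+ 2.
Proof.
move=> wx dw1 dw2.
have -> : N (w1 * x * w2) = T (star x * d * x * d).
  rewrite /sqnorm !(starM hstar) -!mulrA (retrC htau) -!mulrA dw2.
  by rewrite [star w1 * (w1 * _)]mulrA dw1 !mulrA.
have wsx := word_star hstar Sstar Bstar wx.
have [ux _] := word_unitary hstar SS BB Sstar Bstar wx.
rewrite /retr free2 //; try exact: DV_d.
rewrite ux (tau1 htau) tau_dd tau_d mul1r.
have [w -> /andP[w0 w1']] := tau_unitary_sqr hstar htau ux.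
rewrite -!rmorphM -rmorphD -rmorphB /=.
have e0 := e_le1; have h0 := h_ge0; have h1 := h_le1.
have e2 : 0 <= e ^+ 2 by exact: sqr_ge0.
have e4 : 1 - 2 * h <= e ^+ 4.
  have -> : e ^+ 4 = (e ^+ 2) ^+ 2 by rewrite -exprM.
  have : (1 - h) ^+ 2 <= (e ^+ 2) ^+ 2 by rewrite ler_sqr ?nnegrE //; lra.
  have -> : (1 - h) ^+ 2 = 1 - 2 * h + h ^+ 2 by ring.
  have := sqr_ge0 h; lra.
have k1 : 0 <= 1 - e ^+ 2 by lra.
have k2 : (1 - e ^+ 2) ^+ 2 <= h ^+ 2.
  have le1 : 1 - e ^+ 2 <= h by have := e_lower; lra.
  by apply: lerXn2r; rewrite ?nnegrE.
have k3 : 1 - e ^+ 4 - 2 * h * e ^+ 4 <= 4 * h ^+ 2.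
  have : (1 - 2 * h) * (1 + 2 * h) <= e ^+ 4 * (1 + 2 * h) by rewrite ler_wpM2r //; lra.
  by move=> ?; lra.
have k4 : 0 <= (1 - e ^+ 2) ^+ 2 by exact: sqr_ge0.
have k5 : w * (1 - e ^+ 4 - 2 * h * e ^+ 4) <= w * (4 * h ^+ 2) by rewrite ler_wpM2l.
have k6 : w * (4 * h ^+ 2) <= 4 * h ^+ 2 by rewrite ler_piMl // mulr_ge0 // sqr_ge0.
have k7 : 0 <= w * (1 - e ^+ 2) ^+ 2 by rewrite mulr_ge0.
by rewrite -[X in _ - X]mulrA -expr2; lra.
Qed.

Let X : A := S * V * B * star V.
Let E : A := X - S * B.
Let Ea : A := S * (v * B - B * v).
Let Eb : A := S * (v * B - B * v) * vs.

Fact E_eq : E = S * (v * B - B * v) * star V.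
Proof.
have -> : v * B - B * v = V * B - B * V.
  by rewrite /v mulrBl mulrBr mulr_algl mulr_algr opprB addrA subrK.
by rewrite mulrBr mulrBl /E /X !mulrA -[S * B * V * _]mulrA VV' mulr1.
Qed.

Fact Vs_split : star V = vs + e%:C%:A. Proof. by rewrite /vs subrK. Qed.

(** In E = S (v B - B v) V' the factor V' is e + vs; the main part Ea keeps a single
   v, and Eb has two of them and is of order h. *)
Fact E_split : E = e%:C *: Ea + Eb.
Proof. by rewrite E_eq {1}Vs_split mulrDr mulr_algr addrC. Qed.

Fact unitS : star S * S = 1. Proof. by rewrite Sstar. Qed.
Fact unitB : star B * B = 1. Proof. by rewrite Bstar. Qed.
Fact unitB' : B * star B = 1. Proof. by rewrite Bstar. Qed.
Fact unitVs : star (star V) * star V = 1. Proof. by rewrite (starK hstar). Qed.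
Fact unitVs' : star V * star (star V) = 1. Proof. by rewrite (starK hstar). Qed.

Fact N_v : N v <= h.
Proof.
have -> : N v = T d by rewrite /sqnorm vstar.
by rewrite /retr tau_d /=; have := e_lower; lra.
Qed.

Fact N_vmul y : N (v * y) <= 4 * N y.
Proof.
have -> : v * y = V * y - e%:C *: y by rewrite /v mulrBl mulr_algl.
apply: le_trans (sqnormB hstar htau _ _) _.
rewrite (sqnorm_unitl tau hstar _ VV) (sqnormZ tau hstar).
have := e_le1; have := sqnorm_ge0 htau y => n0 e1.
have : e ^+ 2 * N y <= N y by rewrite ler_piMl.
lra.
Qed.

Fact N_bracket : N (v * B - B * v) <= 4 * h.
Proof.
apply: le_trans (sqnormB hstar htau _ _) _.
rewrite (sqnorm_unitr hstar htau _ unitB') (sqnorm_unitl tau hstar _ unitB).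
by have := N_v; lra.
Qed.

Fact N_Ea : N Ea <= 4 * h.
Proof. by rewrite (sqnorm_unitl tau hstar _ unitS) N_bracket. Qed.

Fact N_E : N E <= 4 * h.
Proof.
by rewrite E_eq (sqnorm_unitr hstar htau _ unitVs') (sqnorm_unitl tau hstar _ unitS) N_bracket.
Qed.

Fact star_v_v : star v * v = d. Proof. by rewrite vstar. Qed.
Fact star_vs_vs : star vs * vs = d. Proof. by rewrite vsstar vvs. Qed.
Fact v_star_v : v * star v = d. Proof. by rewrite vstar vvs. Qed.
Fact vs_star_vs : vs * star vs = d. Proof. by rewrite vsstar. Qed.

Fact N_vxv x : isword S B x -> N (v * x * v) <= 5 * h ^+ 2.
Proof. by move=> wx; apply: sandwich => //; [exact: star_v_v|exact: v_star_v]. Qed.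
Fact N_vsxv x : isword S B x -> N (vs * x * v) <= 5 * h ^+ 2.
Proof. by move=> wx; apply: sandwich => //; [exact: star_vs_vs|exact: v_star_v]. Qed.
Fact N_vxvs x : isword S B x -> N (v * x * vs) <= 5 * h ^+ 2.
Proof. by move=> wx; apply: sandwich => //; [exact: star_v_v|exact: vs_star_vs]. Qed.

Fact N_Eb : N Eb <= 20 * h ^+ 2.
Proof.
rewrite /Eb -mulrA (sqnorm_unitl tau hstar _ unitS) mulrBl.
apply: le_trans (sqnormB hstar htau _ _) _.
rewrite -[B * v * vs]mulrA (sqnorm_unitl tau hstar _ unitB).
have := N_vxvs (word_B S B); have := N_vxvs (word1 S B); rewrite mulr1; lra.
Qed.

Fact N_vVsxv x : isword S B x -> N (v * star V * x * v) <= 5 * h ^+ 2.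
Proof.
move=> wx; have -> : v * star V = star V * v.
  by rewrite /v mulrBl mulrBr VV VV' mulr_algl mulr_algr.
by rewrite -!mulrA (sqnorm_unitl tau hstar _ unitVs) mulrA N_vxv.
Qed.

Fact N_vBVsxv x : isword S B x -> N (v * B * star V * x * v) <= 50 * h ^+ 2.
Proof.
move=> wx; have wBx : isword S B (B * x) by constructor.
have -> : v * B * star V * x * v = v * (B * (vs * x * v)) + e%:C *: (v * (B * x) * v).
  have -> : v * B * star V = v * B * vs + e%:C *: (v * B).
    by rewrite [star V]Vs_split mulrDr mulr_algr.
  by rewrite 2!mulrDl -!scalerAl !mulrA.
apply: le_trans (sqnormD hstar htau _ _) _.
have b1 := N_vmul (B * (vs * x * v)); rewrite (sqnorm_unitl tau hstar _ unitB) in b1.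
have b2 := N_vsxv wx; have b3 := N_vxv wBx; rewrite (sqnormZ tau hstar).
have n0 := sqnorm_ge0 htau (v * (B * x) * v).
have : e ^+ 2 * N (v * (B * x) * v) <= N (v * (B * x) * v) by rewrite ler_piMl // e_le1.
lra.
Qed.

Fact N_mulE w : N (w * E) <= 2 * N (w * S * v) + 2 * N (w * (S * B) * v).
Proof.
rewrite E_eq !mulrA (sqnorm_unitr hstar htau _ unitVs').
have -> : w * S * (v * B - B * v) = w * S * v * B - w * (S * B) * v by rewrite mulrBr !mulrA.
apply: le_trans (sqnormB hstar htau _ _) _.
by rewrite (sqnorm_unitr hstar htau _ unitB') !mulrA.
Qed.

(** Each factor E contributes a v, with unitaries and at most one further v
   between the two, so that the sandwich bound applies. *)
Fact N_ExE x : isword S B x -> N (E * x * E) <= 440 * h ^+ 2.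
Proof.
move=> wx; have wS : isword S B (x * S) by apply: wordM => //; exact: word_S.
have wSB : isword S B (x * (S * B)) by apply: wordM => //; constructor; exact: word_B.
have -> : E * x * E = S * (v * B * star V * x * E - B * (v * star V * x * E)).
  have -> : E * x * E = S * (v * B - B * v) * star V * (x * E) by rewrite -E_eq mulrA.
  by rewrite -!mulrA mulrBl -!mulrA.
rewrite (sqnorm_unitl tau hstar _ unitS); apply: le_trans (sqnormB hstar htau _ _) _.
rewrite (sqnorm_unitl tau hstar _ unitB).
have b1 := N_mulE (v * B * star V * x); have b2 := N_mulE (v * star V * x).
have b3 := N_vBVsxv wS; have b4 := N_vBVsxv wSB.
have b5 := N_vVsxv wS; have b6 := N_vVsxv wSB.
(* 440 = 2 * (2 * 50 + 2 * 50) + 2 * (2 * 5 + 2 * 5). *)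
by rewrite !mulrA in b1 b2 b3 b4 b5 b6 *; lra.
Qed.

Fact tau_vxvy x y : isword S B x -> isword S B y ->
  tau (v * x * v * y) = tau x * tau y * tau (v * v).
Proof.
move=> wx wy; rewrite -!mulrA (tauC htau) !mulrA.
by rewrite free2 // ?tauv; [ring|exact: DV_v|exact: DV_v].
Qed.

(** Opening both commutators leaves four terms tau (v x v y), where the two
   words both have even length, with traces among the u k, or both odd length,
   with trace kappa. *)
Fact tau_EaEa q p : tau (Ea * (S * B) ^+ q * Ea * (S * B) ^+ p) =
  (- (h * e ^+ 2) * (2 * u q.+1 * u p.+1 - 2 * kappa ^+ 2))%:C.
Proof.
set x := (S * B) ^+ q; set y := (S * B) ^+ p.
have wx : isword S B x by exact: word_X. have wy : isword S B y by exact: word_X.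
have wS := word_S S B; have wB := word_B S B.
have -> : tau (Ea * x * Ea * y) =
    tau (v * (B * x * S) * v * (B * y * S)) - tau (v * (B * x * S * B) * v * (y * S))
    - tau (v * (x * S) * v * (B * y * S * B)) + tau (v * (x * S * B) * v * (y * S * B)).
  have -> : tau (Ea * x * Ea * y) = tau ((v * B - B * v) * x * S * ((v * B - B * v) * (y * S))).
    by rewrite /Ea -!mulrA (tauC htau) -!mulrA.
  have -> : tau (v * (x * S) * v * (B * y * S * B)) = tau (B * v * x * S * (v * B * (y * S))).
    transitivity (tau (B * (v * x * S * (v * B * (y * S))))); last by rewrite !mulrA.
    by rewrite [RHS](tauC htau) !mulrA.
  have -> : tau (v * (x * S * B) * v * (y * S * B)) = tau (B * v * x * S * (B * v * (y * S))).
    transitivity (tau (B * (v * x * S * (B * v * (y * S))))); last by rewrite !mulrA.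
    by rewrite [RHS](tauC htau) !mulrA.
  generalize v => v0; rewrite !mulrBl !mulrBr !tau_sub !mulrA; ring.
have wXS z : isword S B z -> isword S B (z * S) by move=> wz; exact: wordM.
have wXB z : isword S B z -> isword S B (z * B) by move=> wz; exact: wordM.
have wBX z : isword S B z -> isword S B (B * z) by move=> wz; exact: wordM.
rewrite !tau_vxvy; try by repeat first [exact: wx|exact: wy|apply: wXS|apply: wXB|apply: wBX].
have t1 k : tau (B * (S * B) ^+ k * S) = (u k.+1)%:C.
  rewrite -(tau_umom hstar htau Sstar Bstar) -mulrA (tauC htau) -mulrA -exprSr.
  by [].
have t2 k : tau ((S * B) ^+ k * S * B) = (u k.+1)%:C.
  by rewrite -(tau_umom hstar htau Sstar Bstar) -mulrA -exprSr.
have odd k := tau_odd htau SS BB tauS tauB k.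
have t3 k : tau ((S * B) ^+ k * S) = kappa%:C by have [] := odd k.
have t4 k : tau (B * (S * B) ^+ k * S * B) = kappa%:C.
  by rewrite -!mulrA -exprSr; have [] := odd k.+1.
rewrite !t1 !t2 !t3 !t4 tau_vv.
by apply/eqP; rewrite eq_complex /=; apply/andP; split; apply/eqP; ring.
Qed.

Fact T_E m : T ((S * B) ^+ m * E) = (kappa ^+ 2 - u m.+1) * (1 - e ^+ 2).
Proof.
have [oS _] := tau_odd htau SS BB tauS tauB m.
have -> : (S * B) ^+ m * E = (S * B) ^+ m * S * V * B * star V - (S * B) ^+ m.+1.
  by rewrite /E /X mulrBr -exprSr !mulrA.
rewrite (retrB tau) -/(u m.+1) /retr free2; first last.
- exact: DV_Vs.
- exact: DV_V.
- exact: word_B.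
- by apply: wordM; [exact: word_X|exact: word_S].
have e2 : (S * B) ^+ m * S * B = (S * B) ^+ m.+1 by rewrite -mulrA -exprSr.
rewrite VV' oS tauB e2 (tau_umom hstar htau Sstar Bstar) tauV tauVs (tau1 htau) /=.
ring.
Qed.

Fact r3_ge0 : 0 <= r ^+ 3. Proof. by rewrite exprn_ge0 // ltW. Qed.
Fact h2_le : h ^+ 2 <= r ^+ 3.
Proof.
have -> : h ^+ 2 = r * r ^+ 3 by rewrite /h; ring.
by rewrite ler_piMl // r3_ge0.
Qed.

(** Cauchy-Schwarz with weight r: a factor of size h and one of size r give r^3. *)
Fact T_small K L x y : N x <= K * h ^+ 2 -> N y <= L * h ->
  `|T (x * y)| <= (K + L) / 2 * r ^+ 3.
Proof.
move=> Nx Ny; apply: le_trans (retr_bound hstar htau _ _ r_gt0) _.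
have r0 : r != 0 by rewrite gt_eqF.
have k1 : N x / r <= K * r ^+ 3.
  rewrite ler_pdivrMr //; apply: le_trans Nx _.
  by rewrite /h (_ : K * r ^+ 3 * r = K * r ^+ 2 ^+ 2) //; ring.
have k2 : r * N y <= L * r ^+ 3.
  rewrite (_ : L * r ^+ 3 = r * (L * h)); last by rewrite /h; ring.
  by rewrite ler_wpM2l // ltW.
lra.
Qed.

Fact u_bound k : `|u k| <= 1.
Proof.
have [ux _] := word_unitary hstar SS BB Sstar Bstar (word_X S B k).
exact: (retr_unitary hstar htau ux).
Qed.

Fact kappa_bound : kappa ^+ 2 <= 1.
Proof.
have := retr_unitary hstar htau unitS; rewrite /retr tauS /= => k1.
by rewrite -real_normK ?num_real // expr_le1.
Qed.

Fact unitX : star X * X = 1 /\ X * star X = 1.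
Proof.
have eX : star X = V * B * star V * S by rewrite /X !(starM hstar) (starK hstar) Sstar Bstar !mulrA.
rewrite eX /X; split.
  rewrite -!mulrA [S * (S * _)]mulrA SS mul1r [star V * (V * _)]mulrA VV mul1r.
  by rewrite [B * (B * _)]mulrA BB mul1r VV'.
rewrite -!mulrA [star V * (V * _)]mulrA VV mul1r [B * (B * _)]mulrA BB mul1r.
by rewrite [V * (star V * _)]mulrA VV' mul1r SS.
Qed.

Fact N_mulXr x l : N (x * X ^+ l) = N x.
Proof.
elim: l x => [|l IH] x; first by rewrite mulr1.
by rewrite exprSr mulrA (sqnorm_unitr hstar htau _ unitX.2) IH.
Qed.

Fact N_mulwl x w : isword S B w -> N (w * x) = N x.
Proof.
move=> ww; have [uw _] := word_unitary hstar SS BB Sstar Bstar ww.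
exact: (sqnorm_unitl tau hstar _ uw).
Qed.

Fact N_mulwr x w : isword S B w -> N (x * w) = N x.
Proof.
move=> ww; have [_ uw] := word_unitary hstar SS BB Sstar Bstar ww.
exact: (sqnorm_unitr hstar htau _ uw).
Qed.

(** Only Ea counts in both factors E, since Eb paired with a factor of size r is
   negligible.  The constant is 32 = 8 + 12 + 12: the replacement of e^4 by 1 in
   the main term and the two terms with Eb. *)
Fact second_order q p : `|T (E * (S * B) ^+ q * (E * (S * B) ^+ p))
   + h * (2 * u q.+1 * u p.+1 - 2 * kappa ^+ 2)| <= 32 * r ^+ 3.
Proof.
set x := (S * B) ^+ q; set y := (S * B) ^+ p.
have wx : isword S B x by exact: word_X. have wy : isword S B y by exact: word_X.
have -> : T (E * x * (E * y)) = e ^+ 2 * T (Ea * x * Ea * y) + e * T (Eb * (y * Ea * x))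
     + T (Eb * (x * E * y)).
  have -> : T (Eb * (y * Ea * x)) = T (Ea * x * (Eb * y)).
    by rewrite (retrC htau) -!mulrA (retrC htau) -!mulrA (retrC htau) !mulrA.
  have -> : Eb * (x * E * y) = E * x * (E * y) - e%:C *: (Ea * x * (E * y)).
    by rewrite {2}E_split mulrDl mulrDl -!scalerAl addrAC subrr add0r !mulrA.
  have -> : Ea * x * (E * y) = e%:C *: (Ea * x * Ea * y) + Ea * x * (Eb * y).
    by rewrite {1}E_split mulrDl mulrDr -scalerAl -scalerAr !mulrA.
  by rewrite (retrB tau) !(retrZ tau) (retrD tau) (retrZ tau); ring.
have b1 : `|T (Eb * (y * Ea * x))| <= 12 * r ^+ 3.
  have -> : 12 = (20 + 4) / 2 :> R by field.
  by apply: (T_small N_Eb); rewrite N_mulwr // N_mulwl // N_Ea.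
have b2 : `|T (Eb * (x * E * y))| <= 12 * r ^+ 3.
  have -> : 12 = (20 + 4) / 2 :> R by field.
  by apply: (T_small N_Eb); rewrite N_mulwr // N_mulwl // N_E.
rewrite [T (Ea * _ * _ * _)]/retr tau_EaEa /=.
set w := 2 * u q.+1 * u p.+1 - 2 * kappa ^+ 2.
have wb : `|w| <= 4.
  rewrite /w -mulrA; have := kappa_bound; have := sqr_ge0 kappa => k0 k1.
  have uu : `|u q.+1 * u p.+1| <= 1.
    by rewrite normrM -[1]mulr1; apply: ler_pM => //; exact: u_bound.
  by move: uu; rewrite !ler_norml => /andP[? ?]; apply/andP; split; lra.
have e0 := e_le1; have ee : 0 <= e ^+ 2 by exact: sqr_ge0.
have eb : `|1 - e ^+ 4| <= 2 * h.
  have e4 : e ^+ 4 = (e ^+ 2) ^+ 2 by rewrite -exprM.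
  have : 0 <= 1 - e ^+ 4 by rewrite e4 subr_ge0 expr_le1.
  move=> n0; rewrite ger0_norm // e4.
  have -> : 1 - (e ^+ 2) ^+ 2 = (1 - e ^+ 2) * (1 + e ^+ 2) by ring.
  have l1 : 1 - e ^+ 2 <= h by have := e_lower; lra.
  have := h_ge0 => h0.
  by rewrite mulrC; apply: ler_pM => //; lra.
have -> : e ^+ 2 * (- (h * e ^+ 2) * w) + e * T (Eb * (y * Ea * x)) + T (Eb * (x * E * y)) + h * w =
  (h * (1 - e ^+ 4)) * w + (e * T (Eb * (y * Ea * x)) + T (Eb * (x * E * y))) by ring.
apply: le_trans (ler_normD _ _) _.
have main : `|h * (1 - e ^+ 4) * w| <= 8 * r ^+ 3.
  rewrite normrM [`|h * _|]normrM (ger0_norm h_ge0).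
  have -> : 8 * r ^+ 3 = 2 * r ^+ 3 * 4 by ring.
  apply: ler_pM => //; first by rewrite mulr_ge0 ?h_ge0.
  apply: (@le_trans _ _ (h * (2 * h))); first by rewrite ler_wpM2l // h_ge0.
  by rewrite mulrCA -expr2; have := h2_le; lra.
have rest : `|e * T (Eb * (y * Ea * x)) + T (Eb * (x * E * y))| <= 24 * r ^+ 3.
  apply: le_trans (ler_normD _ _) _; rewrite normrM (gtr0_norm e_gt0).
  have e1 : e <= 1 by rewrite -(expr_le1 (ltn0Sn 1)) // ltW.
  have : e * `|T (Eb * (y * Ea * x))| <= `|T (Eb * (y * Ea * x))| by rewrite ler_piMl.
  lra.
lra.
Qed.

Fact telescope_l n : X ^+ n = (S * B) ^+ n + \sum_(i < n) X ^+ i * E * (S * B) ^+ (n - i.+1).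
Proof.
elim: n => [|n IH]; first by rewrite big_ord0 addr0.
rewrite big_ord_recr /= subnn mulr1.
have -> : \sum_(i < n) X ^+ i * E * (S * B) ^+ (n.+1 - i.+1) =
   (\sum_(i < n) X ^+ i * E * (S * B) ^+ (n - i.+1)) * (S * B).
  rewrite mulr_suml; apply: eq_bigr => -[i /= lti] _.
  by rewrite -[in RHS]mulrA -exprSr (_ : (n.+1 - i.+1 = (n - i.+1).+1)%N) //; lia.
have -> : X ^+ n.+1 = X ^+ n * (S * B) + X ^+ n * E by rewrite -mulrDr /E addrC subrK exprSr.
by rewrite addrA exprSr -mulrDl -IH.
Qed.

Fact telescope_r n : X ^+ n = (S * B) ^+ n + \sum_(j < n) (S * B) ^+ j * E * X ^+ (n - j.+1).
Proof.
elim: n => [|n IH]; first by rewrite big_ord0 addr0.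
rewrite big_ord_recr /= subnn mulr1.
have -> : \sum_(j < n) (S * B) ^+ j * E * X ^+ (n.+1 - j.+1) =
   (\sum_(j < n) (S * B) ^+ j * E * X ^+ (n - j.+1)) * X.
  rewrite mulr_suml; apply: eq_bigr => -[i /= lti] _.
  by rewrite -[in RHS]mulrA -exprSr (_ : (n.+1 - i.+1 = (n - i.+1).+1)%N) //; lia.
have e1 : (S * B) ^+ n.+1 + (S * B) ^+ n * E = (S * B) ^+ n * X.
  by rewrite exprSr -mulrDr /E addrC subrK.
by rewrite [_ * X + _]addrC addrA e1 -mulrDl -IH exprSr.
Qed.

(** Replacing X^q by (S B)^q costs q terms with three factors E, estimated by
   pairing two of them (440) with the third (4): 222 = (440 + 4) / 2. *)
Fact third_order q p : `|T (E * X ^+ q * (E * (S * B) ^+ p)) - T (E * (S * B) ^+ q * (E * (S * B) ^+ p))|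
  <= q%:R * (222 * r ^+ 3).
Proof.
rewrite [in X in X - _]telescope_l mulrDr mulrDl (retrD tau) addrAC subrr add0r.
rewrite mulr_sumr mulr_suml (retr_sum tau).
apply: le_trans (ler_norm_sum _ _ _) _.
rewrite -[q in q%:R]card_ord mulr_natl -sumr_const; apply: ler_sum => l _.
have -> : T (E * (X ^+ l * E * (S * B) ^+ (q - l.+1)) * (E * (S * B) ^+ p)) =
    T (E * (S * B) ^+ (q - l.+1) * E * ((S * B) ^+ p * E * X ^+ l)).
  by rewrite -!mulrA (retrC htau) -!mulrA (retrC htau) -!mulrA (retrC htau) !mulrA.
have -> : 222 = (440 + 4) / 2 :> R by field.
apply: T_small; first exact/N_ExE/word_X.
by rewrite N_mulXr N_mulwl ?N_E //; exact: word_X.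
Qed.

(** The coefficient of h in the expansion: n first order terms, and one second
   order term for each pair of positions of the two factors E. *)
Definition drift n : R := \sum_(i < n) (kappa ^+ 2 - u n -
  \sum_(j < i) (2 * u (i - j) * u (n - (i - j)) - 2 * kappa ^+ 2)).

Definition driftC n : R := n%:R * (2 + n%:R * (32 + n%:R * 222)).

Fact first_order n i : (i < n)%N ->
  `|T ((S * B) ^+ i * E * (S * B) ^+ (n - i.+1)) - h * (kappa ^+ 2 - u n)| <= 2 * r ^+ 3.
Proof.
move=> ltin; have -> : T ((S * B) ^+ i * E * (S * B) ^+ (n - i.+1)) = T ((S * B) ^+ n.-1 * E).
  by rewrite (retrC htau) mulrA -exprD; congr (T (_ ^+ _ * _)); lia.
rewrite T_E prednK; last by lia.
have -> : (kappa ^+ 2 - u n) * (1 - e ^+ 2) - h * (kappa ^+ 2 - u n) =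
  (kappa ^+ 2 - u n) * (1 - e ^+ 2 - h) by ring.
rewrite normrM; apply: ler_pM => //.
  have := u_bound n; have := kappa_bound; have := sqr_ge0 kappa.
  by rewrite !ler_norml => ? ? /andP[? ?]; apply/andP; split; lra.
apply: le_trans h2_le; have := e_upper; have := e_lower => l1 l2.
by rewrite ler_norml; apply/andP; split; have := sqr_ge0 h; lra.
Qed.

Fact higher_order n i j : (j < i)%N -> (i < n)%N ->
  `|T ((S * B) ^+ j * E * X ^+ (i - j.+1) * E * (S * B) ^+ (n - i.+1))
    + h * (2 * u (i - j) * u (n - (i - j)) - 2 * kappa ^+ 2)| <= (32 + n%:R * 222) * r ^+ 3.
Proof.
move=> ltji ltin; set q := (i - j.+1)%N; set p := (n - i.+1 + j)%N.
have -> : T ((S * B) ^+ j * E * X ^+ q * E * (S * B) ^+ (n - i.+1)) =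
    T (E * X ^+ q * (E * (S * B) ^+ p)).
  by rewrite -!mulrA (retrC htau) -!mulrA -exprD.
have -> : (i - j = q.+1)%N by rewrite /q; lia.
have -> : (n - q.+1 = p.+1)%N by rewrite /q /p; lia.
have b1 := third_order q p; have b2 := second_order q p.
have b3 : q%:R * (222 * r ^+ 3) <= n%:R * (222 * r ^+ 3).
  apply: ler_wpM2r; first by rewrite mulr_ge0 // r3_ge0.
  by rewrite ler_nat /q; lia.
move: b1 b2; rewrite !ler_norml => /andP[? ?] /andP[? ?]; apply/andP; split; lra.
Qed.

(** The power X^n is telescoped around (S B)^n twice, from the left and then from
   the right, so that terms with two factors E appear for every pair of positions
   j < i. *)
Lemma increment_bound n : `|T (X ^+ n) - u n - h * drift n| <= driftC n * r ^+ 3.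
Proof.
rewrite telescope_l (retrD tau) -/(u n) [_ + _ - u n]addrAC subrr add0r (retr_sum tau) /drift mulr_sumr -sumrB.
apply: le_trans (ler_norm_sum _ _ _) _.
apply: (@le_trans _ _ (\sum_(i < n) (2 + n%:R * (32 + n%:R * 222)) * r ^+ 3)); last first.
  by rewrite sumr_const card_ord -[leLHS]mulr_natl /driftC -[leRHS]mulrA.
apply: ler_sum => i _.
have -> : T (X ^+ i * E * (S * B) ^+ (n - i.+1)) = T ((S * B) ^+ i * E * (S * B) ^+ (n - i.+1)) +
    \sum_(j < i) T ((S * B) ^+ j * E * X ^+ (i - j.+1) * E * (S * B) ^+ (n - i.+1)).
  by rewrite telescope_r !mulrDl (retrD tau) !mulr_suml (retr_sum tau).
have -> : forall a b c d : R, a + b - h * (c - d) = (a - h * c) + (b + h * d) by move=> *; ring.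
apply: le_trans (ler_normD _ _) _; rewrite [leRHS]mulrDl; apply: lerD; first exact: first_order.
rewrite mulr_sumr -big_split /=; apply: le_trans (ler_norm_sum _ _ _) _.
apply: (@le_trans _ _ (\sum_(j < i) (32 + n%:R * 222) * r ^+ 3)).
  by apply: ler_sum => j _; apply: higher_order.
rewrite sumr_const card_ord -[leLHS]mulr_natl -[leRHS]mulrA.
apply: ler_wpM2r; last by rewrite ler_nat ltnW.
by rewrite mulr_ge0 ?r3_ge0 // addr_ge0 // mulr_ge0.
Qed.

End Increment.

(** * The moments of the conjugated reflection *)

(** Injectivity of the relabelling keeps neighbouring indices distinct. *)
Lemma alt_map (R : realType) (A : algType R[i]) (tau : {scalar A}) (I J : Type)
    (f : I -> J) (B : I -> set A) (B' : J -> set A) o w :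
  injective f -> (forall i, B i `<=` B' (f i)) ->
  alt tau B o w -> alt tau B' (omap f o) w.
Proof.
move=> finj BB'; elim=> [|i {}o x {}w Bx x0 _ IH oi]; first exact: alt_nil.
apply: alt_cons IH _ => //; first exact: BB'.
by case: o oi => // j oi [/finj e]; apply: oi; rewrite e.
Qed.

Lemma expR_quadratic (R : realType) (h : R) : 0 <= h ->
  1 - h <= expR (- h) <= 1 - h + h ^+ 2.
Proof.
move=> h0; rewrite expR_ge1Dx /= expRN.
have h1 := expR_ge1Dx h.
have p1 : 0 < 1 + h by lra.
apply: (@le_trans _ _ (1 + h)^-1).
  by rewrite lef_pV2 // ?posrE // ?expR_gt0.
rewrite -[_^-1]mul1r ler_pdivrMr //.
have -> : (1 + - h + h ^+ 2) * (1 + h) = 1 + h ^+ 3 by ring.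
by rewrite lerDl exprn_ge0.
Qed.

Lemma sum_binomial_even (R : comNzRingType) n :
  4 ^+ n = \sum_(i < (2 * n).+1) 'C(2 * n, i)%:R :> R.
Proof.
have -> : 4 = (1 + 1) ^+ 2 :> R by ring.
by rewrite -exprM exprDn; apply: eq_bigr => i _; rewrite !expr1n mul1r.
Qed.

Section Process.
Variables (R : realType) (A : algType R[i]) (star : A -> A)
    (tau : {scalar A}) (P : A) (Y : R -> A) (kappa : R).
Hypotheses (hstar : star_laws star) (htau : is_tracial_state star tau)
    (hP : is_projection star P)
    (hY : free_unitary_brownian_motion star tau Y)
    (hfree : free_sets star tau [set Y s | s in [set s : R | 0 <= s]] [set P])
    (hkappa : tau (symmetry_of P) = kappa%:C).

Let S := symmetry_of P.
Let B t := Y t * S * star (Y t).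

Fact S_eq : S = P + P - 1.
Proof. by rewrite /S /symmetry_of mulr_natl mulr2n. Qed.

Fact SS : S * S = 1.
Proof.
have [PP _] := hP.
have e : (P + P) * (P + P) = P + P + (P + P) by rewrite !mulrDl !mulrDr PP.
by rewrite S_eq mulrBr mulr1 mulrBl mul1r e addrK subKr.
Qed.

Fact Sstar : star S = S.
Proof. by have [_ Ps] := hP; rewrite S_eq (starB hstar) (starD hstar) Ps (star1 hstar). Qed.

Fact Yu t : 0 <= t -> star (Y t) * Y t = 1.
Proof. by move=> t0; have [] := fubm_unitary hY t0. Qed.
Fact Yu' t : 0 <= t -> Y t * star (Y t) = 1.
Proof. by move=> t0; have [] := fubm_unitary hY t0. Qed.

Fact BB t : 0 <= t -> B t * B t = 1.
Proof.
move=> t0; rewrite /B -!mulrA [star (Y t) * (Y t * _)]mulrA Yu // mul1r.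
by rewrite [S * (S * _)]mulrA SS mul1r Yu'.
Qed.

Fact Bstar t : star (B t) = B t.
Proof. by rewrite /B !(starM hstar) (starK hstar) Sstar mulrA. Qed.

Fact tauBt t : 0 <= t -> tau (B t) = kappa%:C.
Proof. by move=> t0; rewrite /B (tauC htau) mulrA Yu // mul1r. Qed.

Fact Y0 : star (Y 0) = 1.
Proof. by rewrite (fubm_start hY) (star1 hstar). Qed.

Section Step.
Variables (t h : R).
Hypotheses (t_ge0 : 0 <= t) (h_gt0 : 0 < h) (h_le1 : h <= 1).
Let V := Y (t + h) * star (Y t).
(* The generator of GY is written as the increment from time 0, to which the
   freeness of increments applies. *)
Let GY : set A := [set Y t * star (Y 0)].
Let GV : set A := [set V].
Let GD : set A := [set Y s | s in [set s : R | 0 <= s]].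
Let th_ge0 : 0 <= t + h. Proof. by rewrite addr_ge0 // ltW. Qed.

Fact step_VV : star V * V = 1.
Proof.
rewrite /V (starM hstar) (starK hstar) -mulrA [star (Y (t + h)) * _]mulrA Yu // mul1r.
by rewrite Yu'.
Qed.

Fact step_VV' : V * star V = 1.
Proof.
rewrite /V (starM hstar) (starK hstar) -mulrA [star (Y t) * _]mulrA Yu // mul1r.
by rewrite Yu'.
Qed.

Fact step_U : S * B (t + h) = S * V * B t * star V.
Proof.
rewrite /B /V (starM hstar) (starK hstar) -!mulrA.
rewrite [star (Y t) * (Y t * (S * _))]mulrA Yu // mul1r.
by rewrite [star (Y t) * (Y t * _)]mulrA Yu // mul1r.
Qed.

Let e := expR (- h / 2).

Fact e_sqr : e ^+ 2 = expR (- h).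
Proof. by rewrite /e -expRM_natl; congr expR; field. Qed.

Fact step_tau n : (0 < n)%N -> tau (V ^+ n) = (free_unitary_moment n h)%:C.
Proof.
move=> n0; rewrite (fubm_increment_law hY) //; last by rewrite lerDl ltW.
by rewrite addrAC subrr add0r.
Qed.

Fact step_tauV : tau V = e%:C.
Proof.
rewrite -[V]expr1 step_tau // /free_unitary_moment /laguerre big_ord_recl big_ord0 /=.
by rewrite big_geq // !fact0 expr0 !divr1 !mulr1 addr0 mulr1 mul1r.
Qed.

Fact step_tauV2 : tau (V * V) = (e ^+ 2 * (1 - h))%:C.
Proof.
rewrite -expr2 step_tau // /free_unitary_moment /laguerre !big_ord_recl big_ord0 /= e_sqr.
rewrite [X in X / 0`!%:R]big_ltn // !big_geq // /bump /= !fact0 !factS expr0 expr1.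
have -> : - (2 * h) / 2 = - h by field.
by rewrite mul1n fact0; congr (_%:C); field.
Qed.

Fact scalar_subalgebra : star_subalgebra star [set c%:A | c in [set: R[i]]].
Proof.
split.
- by exists 1; rewrite ?scale1r.
- move=> a _ _ [c _ <-] [d _ <-]; exists (a * c + d) => //.
  by rewrite scalerDl scalerA.
- by move=> _ _ [c _ <-] [d _ <-]; exists (c * d) => //; rewrite mulr_algl scalerA.
- by move=> _ [c _ <-]; exists (Num.conj c) => //; rewrite (starZ hstar) (star1 hstar).
Qed.

(** For t > 0 this is the freeness of the increments along 0 < t < t + h.  At t = 0
   these times are not distinct, but then the algebra of GY consists of scalars
   and has no nonzero centred element. *)
Fact step_free b w :
  alt tau (fun b : bool => star_algebra_gen star (if b then GV else GY)) (Some b) w -> tau w = 0.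
Proof.
move: t_ge0; rewrite le_eqVlt => /predU1P[t0|t0].
  have Ysc x : star_algebra_gen star GY x -> tau x = 0 -> x = 0.
    move=> hx; have : [set c%:A | c in [set: R[i]]] x.
      apply: (gen_min scalar_subalgebra _ hx) => _ ->; exists 1 => //.
      by rewrite /= -t0 Y0 mulr1 (fubm_start hY) scale1r.
    by case=> c _ <-; rewrite (tau_alg htau) => ->; rewrite scale0r.
  suff H o w1 : alt tau (fun b : bool => star_algebra_gen star (if b then GV else GY)) o w1 ->
      w1 = 0 \/ (o = None /\ w1 = 1) \/ (o = Some true /\ tau w1 = 0).
    by move/H => [->|[[]//|[_ ->]]//]; rewrite raddf0.
  elim=> [|i {}o x {}w1 Bx x0 _ IH oi]; first by right; left.
  case: i Bx oi => Bx oi; last by left; rewrite (Ysc _ Bx x0) mul0r.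
  case: IH => [->|[[_ ->]|[oe _]]]; first by left; rewrite mulr0.
    by right; right; rewrite mulr1.
  by case: oi.
pose tt k := nth 0 [:: 0; t; t + h] k.
have tt0 : 0 <= tt 0%N by [].
have ttS k : (k < 2)%N -> tt k < tt k.+1.
  by case: k => [|[|k]] // _; rewrite /tt /= ltrDl.
have := fubm_free_increments hY tt0 ttS => hfr.
pose f (b : bool) : 'I_2 := inord b.
have finj : injective f.
  by move=> [] [] // /(congr1 val); rewrite /= !inordK.
move=> aw; apply: (alt_free hfr (i := f b)).
apply: (alt_map finj _ aw) => b1 x.
by case: b1; rewrite /f /= inordK.
Qed.

Fact step_word x : isword S (B t) x -> inPY star tau [set P] GY GV x.
Proof.
have PS : star_algebra_gen star [set P] S.
  by rewrite S_eq; apply: genB; [apply: genD; exact: gen_subset|exact: gen1].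
have YY : star_algebra_gen star GY (Y t).
  by apply: gen_subset; rewrite /GY /= Y0 mulr1.
have mulS z : inPY star tau [set P] GY GV z -> inPY star tau [set P] GY GV (S * z).
  exact: (inPY_mul (tau1 htau) (l := None)).
have mulY g z : star_algebra_gen star GY g ->
    inPY star tau [set P] GY GV z -> inPY star tau [set P] GY GV (g * z).
  by move=> hg; exact: (inPY_mul (tau1 htau) (l := Some false)).
elim=> [|w _ IH|w _ IH]; [exact: inPY1|exact: mulS|].
rewrite /B -!mulrA; apply: (mulY) => //; apply: (mulS); apply: (mulY) => //.
exact: gen_star.
Qed.

Fact step_bound n :
  `|umom tau S (B (t + h)) n - umom tau S (B t) n - h * drift tau S (B t) kappa n|
    <= driftC R n * h * Num.sqrt h.
Proof.
have h0 : 0 <= h by exact: ltW.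
have hh : Num.sqrt h ^+ 2 = h by rewrite sqr_sqrtr.
have free x y a b : isword S (B t) x -> isword S (B t) y ->
    star_algebra_gen star [set V] a -> star_algebra_gen star [set V] b ->
    tau (x * a * y * b) = tau x * tau y * tau (a * b) + tau (x * y) * tau a * tau b
                        - tau x * tau y * tau a * tau b.
  move=> wx wy; apply: (inPY_free2 (tau1 htau) (tauC htau) (GP := [set P]) (GY := GY) (GV := GV) (GD := GD)).
  - apply: gen_min; first exact: gen_subalgebra.
    move=> _ ->; apply: genM; first by apply: gen_subset; exists t.
    by apply: gen_star; apply: gen_subset; exists 0 => /=.
  - apply: gen_min; first exact: gen_subalgebra.
    move=> _ ->; apply: genM; first by apply: gen_subset; exists (t + h).
    by apply: gen_star; apply: gen_subset; exists t => /=.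
  - exact: hfree.
  - exact: step_free.
  - exact: step_word.
  - exact: step_word.
  - by apply: step_word; exact: wordM.
  - by apply: step_word; exact: wordM.
have r0 : 0 < Num.sqrt h by rewrite sqrtr_gt0.
have r1 : Num.sqrt h <= 1 by rewrite -sqrtr1; exact: ler_wsqrtr.
have := expR_quadratic h0; rewrite -e_sqr => /andP[el eu].
have := @increment_bound R A star tau hstar htau S (B t) kappa SS (BB t_ge0) Sstar (Bstar t)
  hkappa (tauBt t_ge0) V e (Num.sqrt h) r0 r1 (expR_gt0 _).
rewrite hh => /(_ el eu step_VV step_VV' step_tauV step_tauV2 free n).
rewrite -step_U -/(umom tau S (B (t + h)) n).
have -> : Num.sqrt h ^+ 3 = h * Num.sqrt h by rewrite exprSr hh.
by rewrite mulrA.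
Qed.

End Step.

(** The difference k = i - j occurs for n - k pairs, and the symmetry of the
   summand under k <-> n - k replaces this multiplicity by n / 2. *)
Lemma drift_ode n (w : nat -> R) :
  \sum_(i < n) (kappa ^+ 2 - w n - \sum_(j < i) (2 * w (i - j)%N * w (n - (i - j))%N - 2 * kappa ^+ 2)) =
  - (n%:R * w n) - n%:R * (\sum_(1 <= k < n) w k * w (n - k)%N) + n%:R ^+ 2 * kappa ^+ 2.
Proof.
pose f k := w k * w (n - k)%N - kappa ^+ 2.
have step m (g : nat -> R) : \sum_(i < m) \sum_(j < i) g (i - j)%N = \sum_(1 <= k < m) (m - k)%:R * g k.
  elim: m => [|m IH]; first by rewrite big_ord0 big_geq.
  rewrite big_ord_recr /= IH.
  have -> : \sum_(j < m) g (m - j)%N = \sum_(1 <= k < m.+1) g k.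
    rewrite [RHS]big_add1 [RHS]big_nat_rev add0n big_mkord; apply: eq_bigr => -[j /= ltj] _.
    by rewrite -subSn.
  have -> : \sum_(1 <= k < m) (m - k)%:R * g k = \sum_(1 <= k < m.+1) (m - k)%:R * g k.
    case: m {IH} => [|m]; first by rewrite !big_geq.
    by rewrite [RHS]big_nat_recr // subnn mul0r Monoid.mulm1.
  rewrite -big_split !big_nat; apply: eq_bigr => k /andP[_ ltk].
  by rewrite subSn // -natr1 mulrDl mul1r.
have symm : 2 * (\sum_(1 <= k < n) (n - k)%:R * f k) = n%:R * \sum_(1 <= k < n) f k.
  have e : \sum_(1 <= k < n) (n - k)%:R * f k = \sum_(1 <= k < n) k%:R * f k.
    rewrite [LHS]big_nat_rev !big_nat; apply: eq_bigr => k /andP[k0 ltk].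
    have -> : (1 + n - k.+1 = n - k)%N by lia.
    by rewrite /f subKn ?(ltnW ltk) // [w (n - k)%N * _]mulrC.
  rewrite mulr2n mulrDl mul1r {2}e -big_split mulr_sumr !big_nat.
  by apply: eq_bigr => k /andP[_ ltk]; rewrite /= natrB ?(ltnW ltk) //; ring.
rewrite sumrB sumr_const card_ord -[_ *+ n]mulr_natl.
have -> : \sum_(i < n) \sum_(j < i) (2 * w (i - j)%N * w (n - (i - j))%N - 2 * kappa ^+ 2) =
    2 * (\sum_(1 <= k < n) (n - k)%:R * f k).
  rewrite (step n (fun k => 2 * w k * w (n - k)%N - 2 * kappa ^+ 2)) mulr_sumr.
  by apply: eq_bigr => k _; rewrite /f; ring.
rewrite symm /f sumrB sumr_const_nat.
case: n {f step symm} => [|n]; first by rewrite !mul0r ?big_geq // expr0n mul0r; ring.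
by rewrite subn1 /= -mulr_natl -natr1; ring.
Qed.

Let u n t := umom tau S (B t) n.

Fact drift_eq n t : drift tau S (B t) kappa n =
  - (n%:R * u n t) - n%:R * (\sum_(1 <= k < n) u k t * u (n - k)%N t) + n%:R ^+ 2 * kappa ^+ 2.
Proof. exact: (drift_ode n (fun k => u k t)). Qed.

Fact u_le1 n t : 0 <= t -> `|u n t| <= 1.
Proof. by move=> t0; exact: (u_bound hstar htau SS (BB t0) Sstar (Bstar t)). Qed.

Fact drift_bound n t : 0 <= t -> `|drift tau S (B t) kappa n| <= n%:R * (2 + n%:R * 4).
Proof.
move=> t0; apply: le_trans (ler_norm_sum _ _ _) _.
have k1 := kappa_bound hstar htau SS Sstar hkappa; have k0 := sqr_ge0 kappa.
apply: (@le_trans _ _ (\sum_(i < n) (2 + n%:R * 4))); last first.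
  by rewrite sumr_const card_ord -[leLHS]mulr_natl.
apply: ler_sum => i _; apply: le_trans (ler_normB _ _) _; apply: lerD.
  have ub : `|umom tau S (B t) n| <= 1 := u_le1 n t0.
  by move: ub; rewrite !ler_norml => /andP[? ?]; apply/andP; split; lra.
apply: le_trans (ler_norm_sum _ _ _) _.
apply: (@le_trans _ _ (\sum_(j < i) 4)); last first.
  rewrite sumr_const card_ord -[leLHS]mulr_natl; apply: ler_wpM2r => //.
  by rewrite ler_nat ltnW.
apply: ler_sum => j _.
have uu : `|umom tau S (B t) (i - j) * umom tau S (B t) (n - (i - j))| <= 1.
  by rewrite normrM -[1]mulr1; apply: ler_pM => //; exact: u_le1.
by move: uu; rewrite -mulrA !ler_norml => /andP[? ?]; apply/andP; split; lra.
Qed.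

Fact u_expansion n t h : 0 <= t -> 0 < h <= 1 ->
  `|u n (t + h) - u n t - h * drift tau S (B t) kappa n| <= driftC R n * h * Num.sqrt h.
Proof. by move=> t0 /andP[h0 h1]; exact: step_bound. Qed.

Fact driftC_ge0 n : 0 <= driftC R n.
Proof. by rewrite /driftC mulr_ge0 // addr_ge0 // mulr_ge0 // addr_ge0 // mulr_ge0. Qed.

(** The drift is a polynomial in the moments, whose continuity comes from the
   Lipschitz bound that the expansion itself provides. *)
Fact tder_u n : tder (u n) (fun t => - (n%:R * u n t)
  - n%:R * (\sum_(1 <= k < n) u k t * u (n - k)%N t) + n%:R ^+ 2 * kappa ^+ 2).
Proof.
have K0 m : 0 <= m%:R * (2 + m%:R * 4) :> R by rewrite mulr_ge0 // addr_ge0 // mulr_ge0.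
have cu m (t : R) : 0 < t -> {for t, continuous (u m)}.
  have L0 : 0 <= driftC R m + m%:R * (2 + m%:R * 4) by rewrite addr_ge0 ?driftC_ge0.
  have [c _] := lipschitz_continuous L0
    (expansion_lipschitz (driftC_ge0 m) (drift_bound m) (u_expansion m)).
  exact: c.
have := expansion_tder (driftC_ge0 n) (K0 n) (drift_bound n) (u_expansion n).
have -> : (fun t => drift tau S (B t) kappa n) = (fun t => - (n%:R * u n t)
  - n%:R * (\sum_(1 <= k < n) u k t * u (n - k)%N t) + n%:R ^+ 2 * kappa ^+ 2).
  by apply/funext => t; exact: drift_eq.
apply=> t t0.
have csum (r : seq nat) : {for t, continuous (fun t => \sum_(k <- r) u k t * u (n - k)%N t)}.
  elim: r => [|k r IH]; rewrite /prop_for /continuous_at.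
    by under eq_fun do rewrite big_nil; rewrite big_nil; exact: cvg_cst.
  under eq_fun do rewrite big_cons.
  by rewrite big_cons; apply: cvgD => //; apply: cvgM; exact: cu.
apply: cvgD; last exact: cvg_cst.
apply: cvgB; first by apply: cvgN; apply: cvgM; [exact: cvg_cst|exact: cu].
by apply: cvgM; [exact: cvg_cst|exact: csum].
Qed.

Fact u_start n : u n 0 = 1.
Proof.
rewrite /u /umom /B Y0 (fubm_start hY) mul1r mulr1 SS expr1n.
by rewrite /retr (tau1 htau).
Qed.

Fact tau_U n t : tau (U_process star P Y t ^+ n) = (u n t)%:C.
Proof.
have -> : U_process star P Y t = S * B t by rewrite /U_process /B !mulrA.
exact: (tau_umom hstar htau Sstar (Bstar t)).
Qed.

(** * The moments of the free Jacobi process *)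

Section Jacobi.
Variable t : R.
Hypothesis t_ge0 : 0 <= t.
Let b := B t.
Let U := S * b.
Let U' := b * S.

Fact UU' : U * U' = 1. Proof. by rewrite /U /U' mulrA -[S * b * b]mulrA BB // mulr1 SS. Qed.
Fact U'U : U' * U = 1. Proof. by rewrite /U /U' mulrA -[b * S * S]mulrA SS mulr1 BB. Qed.

Fact proj_symmetry : P * S = P /\ S * P = P.
Proof. by have [PP _] := hP; rewrite S_eq !mulrDr !mulrDl PP mulrN1 mulN1r addrK. Qed.

Fact proj_double : P + P = 1 + S. Proof. by rewrite S_eq [RHS]addrC subrK. Qed.

Fact proj_reflections : P * (U + U') = P * b * P + P * b * P /\ (U + U') * P = P * b * P + P * b * P.
Proof.
have [ePS eSP] := proj_symmetry; rewrite /U /U'; split.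
  have -> : P * b * P + P * b * P = P * b + P * b * S by rewrite -mulrDr proj_double mulrDr mulr1.
  by rewrite mulrDr !mulrA ePS.
have -> : P * b * P + P * b * P = (P + P) * b * P by rewrite !mulrDl.
have expand (s c : A) : (1 + s) * c * P = c * P + s * c * P by rewrite !mulrDl mul1r.
rewrite proj_double expand.
by rewrite mulrDl -[b * S * P]mulrA eSP addrC.
Qed.

(** The conjugate Q of P is (1 + B)/2, so 2 P Q P = P + P B P, and 2 P = 1 + S
   with P S = P turns 2 P B P into P (U + U'). *)
Fact jacobi_four : free_jacobi star P Y t *+ 4 = P * (2 + (U + U')).
Proof.
have [PP _] := hP.
pose Q := Y t * P * star (Y t).
have Q2 : Q + Q = 1 + b.
  by rewrite /Q -mulrDl -mulrDr proj_double mulrDr mulrDl mulr1 Yu'.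
have -> : free_jacobi star P Y t = P * Q * P by rewrite /free_jacobi /Q !mulrA.
have J2 : P * Q * P + P * Q * P = P + P * b * P.
  by rewrite -mulrDl -mulrDr Q2 mulrDr mulr1 mulrDl PP.
rewrite -[4%N]/(2 + 2)%N mulrnDr mulr2n J2 mulrDr proj_reflections.1 mulr_natr mulr2n.
by rewrite addrACA.
Qed.

(** As U' is the inverse of U, 2 + U + U' = (1 + U)^2 U', and P commutes with
   it. *)
Fact jacobi_power n : (0 < n)%N ->
  free_jacobi star P Y t ^+ n *+ 4 ^ n = P * ((1 + U) ^+ (2 * n) * U' ^+ n).
Proof.
move=> n0; have [PP _] := hP.
have -> : (1 + U) ^+ (2 * n) * U' ^+ n = (2 + (U + U')) ^+ n.
  rewrite exprM -exprMn_comm; last first.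
    apply: commr_sym; apply: commrX; apply: commrD; first exact: commr1.
    by rewrite /GRing.comm UU' U'U.
  congr (_ ^+ n); move: UU'; generalize U U' => a a' aa'.
  rewrite expr2 -mulrA [(1 + a) * a']mulrDl mul1r aa' mulrDr mulr1 mulrDl mul1r aa'.
  by rewrite [a' + 1]addrC addrACA [a' + a]addrC -mulr2n.
have PP' : GRing.comm P (2 + (U + U')).
  by apply: commrD; [exact: commr_nat|rewrite /GRing.comm proj_reflections.1 proj_reflections.2].
have Pn : P ^+ n = P.
  by case: n n0 => // n _; elim: n => [|n IH]; rewrite ?expr1 // exprS IH PP.
rewrite -[in RHS]Pn -exprMn_comm // -jacobi_four.
by rewrite exprMn_n.
Qed.

(** The truncated subtractions add up to the distance |i - n|; moments depend on
   it only, as tau (U^k) = tau (U'^k). *)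
Fact tau_UU' n i : tau (U ^+ i * U' ^+ n) = (u (i - n + (n - i)) t)%:C /\
  tau (S * (U ^+ i * U' ^+ n)) = kappa%:C.
Proof.
have oddt := tau_odd htau SS (BB t_ge0) hkappa (tauBt t_ge0).
have SU' k : S * U' ^+ k = U ^+ k * S.
  by elim: k => [|k IH]; rewrite ?expr0 ?mul1r ?mulr1 // exprSr mulrA IH exprSr /U /U' !mulrA.
have com : GRing.comm U U' by rewrite /GRing.comm UU' U'U.
case: (leqP n i) => [leni|ltin].
  have -> : U ^+ i * U' ^+ n = U ^+ (i - n).
    by rewrite -{1}(subnK leni) exprD -mulrA -exprMn_comm // UU' expr1n mulr1.
  have -> : (i - n + (n - i) = i - n)%N by lia.
  split; first exact: (tau_umom hstar htau Sstar (Bstar t)).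
  by rewrite (tauC htau); have [] := oddt (i - n)%N.
have -> : U ^+ i * U' ^+ n = U' ^+ (n - i).
  by rewrite -{1}(subnKC (ltnW ltin)) exprD mulrA -exprMn_comm // UU' expr1n mul1r.
have -> : (i - n + (n - i) = n - i)%N by lia.
rewrite SU'; split; last by have [] := oddt (n - i)%N.
rewrite /U' (tau_expX_comm htau).
exact: (tau_umom hstar htau Sstar (Bstar t)).
Qed.

(** From 2 P = 1 + S: the part with S is a sum of words of odd length, each of
   trace kappa. *)
Fact tau_jacobi n : (0 < n)%N -> tau (free_jacobi star P Y t ^+ n) =
  (((\sum_(i < (2 * n).+1) 'C(2 * n, i)%:R * u (i - n + (n - i)) t) / 4 ^+ n + kappa) / 2)%:C.
Proof.
move=> n0; set c := (X in X%:C).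
have e4 : 4 ^+ n != 0 :> R by rewrite expf_neq0 // pnatr_eq0.
have tP x : tau (P * x) + tau (P * x) = tau x + tau (S * x).
  by rewrite -!tau_add -mulrDl proj_double mulrDl mul1r.
set Z := (1 + U) ^+ (2 * n) * U' ^+ n.
have ZE : Z = \sum_(i < (2 * n).+1) (U ^+ i * U' ^+ n) *+ 'C(2 * n, i).
  by rewrite /Z [1 + U]addrC exprD1n mulr_suml; apply: eq_bigr => i _; rewrite mulrnAl.
have tZ : tau Z = (\sum_(i < (2 * n).+1) 'C(2 * n, i)%:R * u (i - n + (n - i)) t)%:C.
  rewrite ZE raddf_sum rmorph_sum; apply: eq_bigr => i _.
  by rewrite raddfMn /= (tau_UU' n i).1 mulr_natl rmorphMn.
have tSZ : tau (S * Z) = (4 ^+ n * kappa)%:C.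
  rewrite sum_binomial_even.
  rewrite ZE mulr_sumr raddf_sum mulr_suml rmorph_sum; apply: eq_bigr => i _.
  by rewrite mulrnAr raddfMn /= (tau_UU' n i).2 mulr_natl rmorphMn.
have := tP Z; rewrite -jacobi_power // raddfMn /= tZ tSZ -rmorphD /= -mulr2n -mulrnA => e.
have n4 : (4 ^ n * 2)%:R != 0 :> R[i] by rewrite pnatr_eq0 muln_eq0 expn_eq0.
apply: (mulIf n4); rewrite mulr_natr e -(rmorph_nat (real_complex R)) -rmorphM /c; congr (_%:C).
by rewrite natrM natrX; field.
Qed.

End Jacobi.

Hypothesis hkappa_range : -1 < kappa < 1.

Fact kappa_sqr_neq1 : 1 - kappa ^+ 2 != 0.
Proof.
case/andP: hkappa_range => k1 k2; have -> : 1 - kappa ^+ 2 = (1 - kappa) * (1 + kappa) by ring.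
by rewrite mulf_neq0 // gt_eqF //; lra.
Qed.

Fact tau_P : tau P = ((1 + kappa) / 2)%:C.
Proof.
have : tau (P + P) = 1 + kappa%:C by rewrite proj_double tau_add (tau1 htau) hkappa.
rewrite tau_add -mulr2n -[_ *+ 2]mulr_natr => e.
have n2 : 2%:R != 0 :> R[i] by rewrite pnatr_eq0.
apply: (mulIf n2); rewrite e -(rmorph_nat (real_complex R)) -rmorphM divfK ?pnatr_eq0 //.
by rewrite rmorphD rmorph1.
Qed.

Fact tder_u_b n : (0 < n)%N -> tder (u n) (fun t =>
  - (n%:R * \sum_(1 <= k < n.+1) b_coef k kappa t * b_coef (n - k) kappa t)).
Proof.
by apply: tder_moment => [m _||]; [exact: tder_u|exact: u_start|exact: kappa_sqr_neq1].
Qed.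

Fact conv_continuous n :
  continuous ((fun t => \sum_(1 <= k < n.+1) b_coef k kappa t * b_coef (n - k) kappa t) : R -> R).
Proof.
by apply: continuous_bigsum => k; apply: continuous_mul; exact: b_coef_continuous.
Qed.

Fact u_integral n t : (0 < n)%N -> 0 <= t ->
  u n t = 1 - n%:R * \int[lebesgue_measure]_(s in `[0, t])
               \sum_(1 <= k < n.+1) b_coef k kappa s * b_coef (n - k) kappa s.
Proof.
move=> n0 t0; have nn0 : n%:R != 0 :> R by rewrite pnatr_eq0 -lt0n.
have d := tderM (tder_cst (- n%:R^-1)) (tder_u_b n0).
rewrite (tder_FTC (phi := fun t => - n%:R^-1 * u n t) _ (@conv_continuous n) t0).
  by rewrite u_start; field.
by apply: tder_ext d => s _; field.
Qed.

Fact u_integral_weighted n t : (0 < n)%N -> 0 <= t ->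
  u n t = 1 - \int[lebesgue_measure]_(s in `[0, t])
               (n%:R * b_coef n kappa s
                + 2 * \sum_(1 <= k < n) k%:R * b_coef k kappa s * b_coef (n - k) kappa s).
Proof.
move=> n0 t0; have E : (fun s => n%:R * b_coef n kappa s
    + 2 * \sum_(1 <= k < n) k%:R * b_coef k kappa s * b_coef (n - k) kappa s) =
    (fun s => n%:R * \sum_(1 <= k < n.+1) b_coef k kappa s * b_coef (n - k) kappa s).
  by apply/funext => s; rewrite -(@convolution_symmetrize _ n (fun k => b_coef k kappa s)).
rewrite E (tder_FTC (phi := fun t => - u n t) _ _ t0).
- by rewrite u_start; ring.
- by apply: tder_ext (tderN (tder_u_b n0)) => s _; rewrite opprK.
by apply: continuous_mul; [exact: continuous_const|exact: conv_continuous].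
Qed.

(** The binomial row is symmetric about its middle term, where w vanishes. *)
Fact binomial_fold n (w : nat -> R) : w 0%N = 0 ->
  \sum_(i < (2 * n).+1) 'C(2 * n, i)%:R * w (i - n + (n - i))%N =
  2 * (\sum_(1 <= k < n.+1) 'C(2 * n, n - k)%:R * w k).
Proof.
move=> w0; have len : (n <= (2 * n).+1)%N by lia.
rewrite -(big_mkord xpredT (fun i => 'C(2 * n, i)%:R * w (i - n + (n - i))%N)).
rewrite (big_cat_nat (leq0n n) len) /= mulr2n mulrDl mul1r; congr (_ + _).
  rewrite [RHS]big_add1 [RHS]big_nat_rev add0n !big_nat; apply: eq_bigr => i /andP[_ lti].
  by congr ('C(_, _)%:R * w _); lia.
rewrite big_ltn; last by lia.
rewrite !subnn w0 mulr0 add0r.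
rewrite (big_addn 1 (2 * n).+1 n) (_ : (2 * n).+1 - n = n.+1)%N; last by lia.
rewrite !big_nat; apply: eq_bigr => i /andP[i1 lti].
rewrite -bin_sub; last by lia.
by congr ('C(_, _)%:R * w _); lia.
Qed.

(** With v_k = 1 - u_k, the integrand is the derivative of the sum of
   C(2n, n - k) v_k, and the moment of J_t is an affine function of that sum. *)
Fact jacobi_integral n t : (0 < n)%N -> 0 <= t ->
  tau (free_jacobi star P Y t ^+ n) / tau P =
        (1 - 2 / (2 ^+ (2 * n) * (1 + kappa))
             * \int[lebesgue_measure]_(s in `[0, t])
                 \sum_(1 <= k < n.+1)
                   k%:R * 'C(2 * n, n - k)%:R
                   * \sum_(1 <= j < k.+1)
                       b_coef j kappa s * b_coef (k - j) kappa s)%:C.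
Proof.
move=> n0 t0; case/andP: hkappa_range => k1 k2.
have d : tder (fun t => \sum_(1 <= k < n.+1) (- 'C(2 * n, n - k)%:R) * u k.-1.+1 t)
   (fun s => \sum_(1 <= k < n.+1) k%:R * 'C(2 * n, n - k)%:R
                   * \sum_(1 <= j < k.+1) b_coef j kappa s * b_coef (k - j) kappa s).
  have := @tder_sum R _ (index_iota 1 n.+1) _ _
    (fun k => tderM (tder_cst (- 'C(2 * n, n - k)%:R)) (tder_u_b (ltn0Sn k.-1))).
  apply: tder_ext => s _; rewrite !big_nat; apply: eq_bigr => k /andP[k0 _].
  by rewrite prednK //; ring.
rewrite (tder_FTC d _ t0); last first.
  apply: continuous_bigsum => k; apply: continuous_mul; first exact: continuous_const.
  exact: conv_continuous.
rewrite -sumrB tau_jacobi // tau_P -fmorphV -rmorphM; congr (_%:C).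
have -> : \sum_(i < (2 * n).+1) 'C(2 * n, i)%:R * u (i - n + (n - i)) t =
    4 ^+ n - 2 * \sum_(1 <= k < n.+1) 'C(2 * n, n - k)%:R * (1 - u k t).
  rewrite -(@binomial_fold n (fun k => 1 - u k t)); last by rewrite /u /umom expr0 /retr (tau1 htau) subrr.
  rewrite sum_binomial_even.
  by rewrite -sumrB; apply: eq_bigr => i _; ring.
set T1 := \sum_(1 <= k < n.+1) _; set T2 := \sum_(1 <= k < n.+1) _.
have -> : T2 = T1.
  rewrite /T1 /T2 !big_nat; apply: eq_bigr => k /andP[k0 _].
  by rewrite prednK // u_start; ring.
have -> : 2 ^+ (2 * n) = 4 ^+ n :> R by rewrite exprM; congr (_ ^+ n); ring.
have e4 : 4 ^+ n != 0 :> R by rewrite expf_neq0 // pnatr_eq0.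
field; rewrite e4 gt_eqF //; lra.
Qed.

End Process.

Theorem corollary3 (R : realType) (A : algType R[i]) (star : A -> A)
    (tau : {scalar A}) (P : A) (Y : R -> A) (kappa t : R) (n : nat)
    (hA : is_von_neumann_algebra star)
    (htau : is_tracial_state star tau)
    (hP : is_projection star P)
    (hY : free_unitary_brownian_motion star tau Y)
    (hfree : free_sets star tau [set Y s | s in [set s : R | 0 <= s]] [set P])
    (hkappa : tau (symmetry_of P) = kappa%:C)
    (hkappa_range : -1 < kappa < 1)
    (ht : 0 <= t)
    (hn : (1 <= n)%N) :
  [/\ tau (U_process star P Y t ^+ n) =
        (1 - \int[lebesgue_measure]_(s in `[0, t])
               (n%:R * b_coef n kappa s
                + 2 * \sum_(1 <= k < n)
                        k%:R * b_coef k kappa s * b_coef (n - k) kappa s))%:C,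
      tau (U_process star P Y t ^+ n) =
        (1 - n%:R * \int[lebesgue_measure]_(s in `[0, t])
               \sum_(1 <= k < n.+1)
                 b_coef k kappa s * b_coef (n - k) kappa s)%:C
    & tau (free_jacobi star P Y t ^+ n) / tau P =
        (1 - 2 / (2 ^+ (2 * n) * (1 + kappa))
             * \int[lebesgue_measure]_(s in `[0, t])
                 \sum_(1 <= k < n.+1)
                   k%:R * 'C(2 * n, n - k)%:R
                   * \sum_(1 <= j < k.+1)
                       b_coef j kappa s * b_coef (k - j) kappa s)%:C].
Proof.
have hstar := von_neumann_star_laws hA.
split.
- rewrite (tau_U Y hstar htau hP); congr (_%:C).
  exact: (u_integral_weighted hstar htau hP hY hfree hkappa hkappa_range).
- rewrite (tau_U Y hstar htau hP); congr (_%:C).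
  exact: (u_integral hstar htau hP hY hfree hkappa hkappa_range).
exact: (jacobi_integral hstar htau hP hY hfree hkappa hkappa_range).
Qed.
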